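(* Let $\delta>0$, let $S_n=\{0,\dots,n-1\}^m$ be an $m$-dimensional hypercube of size $n$, let $\mathbf g$ be a fixed two-sided geodesic in $\mathcal T$, parametrized as $\mathbf g:\mathbb{Z}\to\mathcal T$ with $\mathbf g(0)=\mathbf r$, and let $s\in\mathbb{R}^m$ be such that $|s|_{\ell_1}<1$. Let $h_{\partial S_n}:\partial S_n\to\mathcal T$ be a boundary graph homomorphism such that for all $x\in\partial S_n$ $$d_{\mathcal T}\big(h_{\partial S_n}(x),\mathbf g(\lfloor s\cdot x\rfloor)\big)\le\delta n.$$ Then $$\mathrm{Ent}(S_n,h_{\partial S_n})=\mathrm{ent}_n(s)+\theta\big(\tfrac1n\big)+\theta(\delta),$$ where $\theta$ denotes a generic smooth function with $\lim_{\varepsilon\to0}\theta(\varepsilon)=0$ (possibly different at each occurrence).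
   Context: $m\ge2$. In $\mathbb{Z}^m$, $x\sim y$ means $|x-y|_{\ell_1}=1$; $\vec i_1,\dots,\vec i_m$ are the standard basis vectors. The $d$-regular rooted tree $\mathcal T$, with graph distance $d_{\mathcal T}$, is identified with the Cayley graph of $G=\langle\alpha_1,\dots,\alpha_d\mid\alpha_1^2=\dots=\alpha_d^2=e\rangle$ generated by the $\alpha_i$, the root $\mathbf r$ being the identity, so that neighbouring vertices $w,w'$ satisfy $w'=\alpha_iw$ for a unique $i$. For $\Lambda\subset\mathbb{Z}^m$, $h:\Lambda\to\mathcal T$ is a graph homomorphism if $d_{\mathcal T}(h(x),h(y))=1$ whenever $x,y\in\Lambda$, $x\sim y$; $\partial\Lambda=\{x\in\Lambda:\exists y\notin\Lambda,\ y\sim x\}$, and a boundary graph homomorphism is a graph homomorphism $\partial\Lambda\to\mathcal T$. $M(S_n,h_{\partial S_n})$ is the set of graph homomorphisms $h:S_n\to\mathcal T$ with $h=h_{\partial S_n}$ on $\partial S_n$, and $\mathrm{Ent}(S_n,h_{\partial S_n})=-\frac1{|S_n|}\ln|M(S_n,h_{\partial S_n})|$. For a graph homomorphism $h:\mathbb{Z}^m\to\mathcal T$ the dual map is $\tilde h(e_{xy})=\alpha_i$, where $x\sim y$ and $\alpha_i$ is the unique generator with $h(y)=\alpha_ih(x)$ ($e_{xy}$ is the oriented edge from $x$ to $y$). $h$ is $n$-translation invariant if $\tilde h(e_{xy})=\tilde h(e_{(x+n\vec i_k)(y+n\vec i_k)})$ for all $x\sim y$ and $k\in\{1,\dots,m\}$.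 The slope of such an $h$ is $(s_1,\dots,s_m)$ with $s_k=\frac1n\min_{x\in\mathbb{Z}^m}d_{\mathcal T}(h(x),h(x+n\vec i_k))$. A two-sided geodesic is a one-to-one graph homomorphism $\mathbf g:\mathbb{Z}\to\mathcal T$; $\Pi_{\mathbf g}:\mathcal T\to\mathbf g$ is the projection onto it. An $n$-translation invariant $h$ is supported on $\mathbf g$ if $d_{\mathcal T}(h(x),\mathbf g)\le\frac{mn}2$ for all $x\in\mathbb{Z}^m$ (if the slope is nonzero there is exactly one such two-sided geodesic). For a periodic two-sided geodesic $\mathbf g$ (its sequence of edge colours $\alpha_i$ is periodic), parametrized with $\mathbf g(0)=\mathbf r$, and $s\in[-1,1]^m$ with $|s|_{\ell_1}<1$, $\mathcal H^{\mathbf g}_n(s)$ is the set of $n$-translation invariant graph homomorphisms $h:\mathbb{Z}^m\to\mathcal T$ with slope $\big(\frac{\lfloor s_1n\rfloor}n,\dots,\frac{\lfloor s_mn\rfloor}n\big)$, supported on $\mathbf g$, such that $\Pi_{\mathbf g}(h(0))=\mathbf g(0)$ if $d_{\mathcal T}(h(0),\Pi_{\mathbf g}(h(0)))$ is even and $\Pi_{\mathbf g}(h(0))=\mathbf g(1)$ otherwise. The microscopic surface tension is $\mathrm{ent}_n(s)=-\frac1{n^m}\ln|\mathcal H^{\mathbf g}_n(s)|$; it does not depend on the choice of $\mathbf g$.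
   Formalization: It is assumed that H_n^g(s) is nonempty (it is empty, so ent_n(s) is infinite, if some floor(s_k n) is negative or lacks the parity of n), and that delta and 1/n are below a threshold depending on m, d, s, as M may be empty for large delta; theta is smooth for small positive arguments. *)

(* Defs.v *)
From HB Require Import structures.
From mathcomp Require Import all_boot all_order all_algebra finmap.
From mathcomp Require Import all_classical all_reals all_analysis.
Set Implicit Arguments.
Unset Strict Implicit.
Unset Printing Implicit Defensive.
Import Order.TTheory GRing.Theory Num.Theory.
Import numFieldNormedType.Exports.
Local Open Scope classical_set_scope.
Local Open Scope ring_scope.

(* An element of G = < a_1, ..., a_d | a_i^2 = e > is represented by its
   unique reduced word: a sequence of generators with no two equal adjacent
   letters; the vertices of the d-regular tree are the elements of G. *)
Definition reduced (d : nat) (w : seq 'I_d) : bool :=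
  sorted (fun i j => i != j) w.

Record tree (d : nat) := Tree { word : seq 'I_d; _ : reduced word }.

HB.instance Definition _ (d : nat) := [isSub for @word d].
HB.instance Definition _ (d : nat) := [Countable of tree d by <:].

Definition tree_root (d : nat) : tree d := @Tree d [::] isT.

Definition lmul_word (d : nat) (i : 'I_d) (w : seq 'I_d) : seq 'I_d :=
  if w is j :: w' then if i == j then w' else i :: w else [:: i].

Lemma lmul_word_reduced (d : nat) (i : 'I_d) (w : seq 'I_d) :
  reduced w -> reduced (lmul_word i w).
Proof.
case: w => [//|j w] /= jw; case: ifPn => [_|ij]; first exact: path_sorted jw.
by rewrite /reduced /= ij.
Qed.

(* gen i w is the product a_i w in G. *)
Definition gen (d : nat) (i : 'I_d) (w : tree d) : tree d :=
  Tree (lmul_word_reduced i (valP w)).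

Definition tree_adj (d : nat) : rel (tree d) :=
  fun w w' => [exists i, w' == gen i w].

(* The infimum is a minimum, and the set is nonempty as the graph is
   connected. *)
Definition tree_dist (d : nat) (w w' : tree d) : nat :=
  infimum 0%N
    [set size p | p in [set p | path (@tree_adj d) w p /\ last w p = w']].

(* The i with w' = gen i w, which is unique; None if w, w' are not adjacent. *)
Definition colour (d : nat) (w w' : tree d) : option 'I_d :=
  [pick i | w' == gen i w].

Definition l1norm (K : numDomainType) (m : nat) (v : 'rV[K]_m) : K :=
  \sum_(k < m) `|v 0 k|.

Definition nbr (m : nat) (x y : 'rV[int]_m) : Prop := l1norm (x - y) = 1.

Definition basis_vec (m : nat) (k : 'I_m) : 'rV[int]_m := delta_mx 0 k.

Definition graph_hom (V : Type) (e : V -> V -> Prop) (d : nat)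
    (h : V -> tree d) : Prop :=
  forall x y, e x y -> tree_dist (h x) (h y) = 1%N.

(* A subset A of Z^m also denotes the type of its elements; sub_nbr is the
   adjacency of Z^m restricted to A. *)
Definition sub_nbr (m : nat) (A : set 'rV[int]_m) (x y : A) : Prop :=
  nbr (val x) (val y).

Definition vertex_boundary (m : nat) (A : set 'rV[int]_m) : set 'rV[int]_m :=
  [set x | A x /\ exists2 y, ~ A y & nbr y x].

Definition cube (m n : nat) : set 'rV[int]_m :=
  [set x | forall k, 0 <= x 0 k < n%:Z].
Arguments cube : clear implicits.

Definition extensions (m d : nat) (A : set 'rV[int]_m)
    (hb : vertex_boundary A -> tree d) : set (A -> tree d) :=
  [set h | graph_hom (@sub_nbr m A) h /\
           forall (x : A) (y : vertex_boundary A), val x = val y -> h x = hb y].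

(* Entropies are extended reals: lne 0 = -oo, so the entropy of an empty set
   of homomorphisms is +oo. *)
Definition Ent (R : realType) (m d : nat) (A : set 'rV[int]_m)
    (hb : vertex_boundary A -> tree d) : \bar R :=
  (- ((#|` fset_set A|%:R^-1)%:E * lne (counting (extensions hb))))%E.

Definition dual (m d : nat) (h : 'rV[int]_m -> tree d) (x y : 'rV[int]_m) :
  option 'I_d := colour (h x) (h y).

Definition translation_invariant (m d n : nat) (h : 'rV[int]_m -> tree d) :
  Prop :=
  forall x y k, nbr x y ->
    dual h x y = dual h (x + basis_vec k *+ n) (y + basis_vec k *+ n).

Definition slope (R : realType) (m d n : nat) (h : 'rV[int]_m -> tree d)
    (k : 'I_m) : R :=
  let shift x := x + basis_vec k *+ n in
  n%:R^-1 * (infimum 0%N (range (fun x => tree_dist (h x) (h (shift x)))))%:R.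

Definition two_sided_geodesic (d : nat) (g : int -> tree d) : Prop :=
  injective g /\ graph_hom (fun i j : int => `|i - j| = 1) g.

Definition periodic_geodesic (d : nat) (g : int -> tree d) : Prop :=
  two_sided_geodesic g /\
  exists2 p : nat, (0 < p)%N &
    forall j : int,
      colour (g (j + p%:Z)) (g (j + p%:Z + 1)) = colour (g j) (g (j + 1)).

Definition dist_to (d : nat) (w : tree d) (g : int -> tree d) : nat :=
  infimum 0%N (range (fun j => tree_dist w (g j))).

(* The vertex of g nearest to w, which exists and is unique for a geodesic. *)
Definition geodesic_proj (d : nat) (g : int -> tree d) (w : tree d) : tree d :=
  xget (g 0) [set u | range g u /\ tree_dist w u = dist_to w g].

Definition supported_on (m d n : nat) (g : int -> tree d)
    (h : 'rV[int]_m -> tree d) : Prop :=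
  forall x, ((dist_to (h x) g).*2 <= m * n)%N.

Definition Hset (R : realType) (m d n : nat) (g : int -> tree d)
    (s : 'rV[R]_m) : set ('rV[int]_m -> tree d) :=
  [set h | [/\ graph_hom (@nbr m) h,
               translation_invariant n h,
               forall k, slope R n h k = (Num.floor (s 0 k * n%:R))%:~R / n%:R,
               supported_on n g h &
               geodesic_proj g (h 0) =
                 if odd (tree_dist (h 0) (geodesic_proj g (h 0)))
                 then g 1 else g 0]].

(* Hset n g s is empty, and ent n g s = +oo, when for instance some
   floor (s_k n) is negative or does not have the parity of n. *)
Definition ent (R : realType) (m d n : nat) (g : int -> tree d)
    (s : 'rV[R]_m) : \bar R :=
  (- (((n ^ m)%:R^-1)%:E * lne (counting (Hset n g s))))%E.

Definition dot (R : realType) (m : nat) (s : 'rV[R]_m) (x : 'rV[int]_m) : R :=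
  \sum_(k < m) s 0 k * (x 0 k)%:~R.

(* Germ at 0+ of an error function: smoothness is only required on ]0, r[, so
   no rate of convergence to 0 is implied. *)
Definition theta_fun (R : realType) (r : R) (theta : R -> R) : Prop :=
  (forall (j : nat) (x : R), 0 < x < r -> derivable (derive1n j theta) x 1) /\
  theta x @[x --> 0^'+] --> (0 : R).

(* Main.v *)
(** Balls in the tree have the Helly property, so 1-Lipschitz maps into the tree
    extend one vertex at a time.  Hence two boundary conditions that stay within
    distance E of the same affine profile along a geodesic, one on a cube and one
    on a smaller concentric cube, can be joined across an annulus of width
    O(E / (1 - |s|)); this bounds the number of fillings of the small cube by that
    of the large one.  Let z_k be the logarithm of the number of fillings of the
    cube of side k with exactly affine boundary heights.  It does not depend on
    the geodesic, because an injective adjacency-preserving map of the tree carries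
    any segment of one geodesic to that of another, and it is superadditive up to
    a bounded margin, so z_k / k^m converges.  The cube entropy lies between the values for
    cubes of side n - C(delta n + 1) and n + C(delta n + 1).

    A filling of the cube of side n extends to an n-translation invariant map,
    which bounds the number of these from below.  For the upper bound, fix the
    most frequent restriction to the boundary shell of a period; there are
    exp(O(n^(m-1))) choices, and n^m maps with the same shell, chosen
    independently in each period, combine to a filling of the cube of side n^2
    whose boundary data are within O(n) of an affine profile.

    No rate is available for z_k / k^m, so the error function is a smooth majorant
    of the optimal error, built as a power series in 1 - x. *)
Require Import Defs.
From mathcomp Require Import all_boot all_order all_algebra perm finmap.
From mathcomp Require Import zify ring lra.
From mathcomp Require Import all_classical all_reals all_analysis.
Set Implicit Arguments.
Unset Strict Implicit.
Unset Printing Implicit Defensive.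
Import Order.TTheory GRing.Theory Num.Theory.
Import numFieldNormedType.Exports.
Local Open Scope classical_set_scope.
Local Open Scope ring_scope.

(** Lipschitz bounds alone do not yield homomorphisms; as the tree and the lattice are both
    bipartite, every extension statement also carries a parity class. The boundary data follow a
    geodesic that need not be periodic and the translation invariant maps another, periodic one; the
    two are compared only through counts along a third geodesic fixed in advance. The slope is a
    minimum of distances and has no sign, so each of the m periods may move the geodesic in either
    direction; reflecting coordinates removes the ambiguity at the cost of a factor [2 ^ m]. A
    period whose least displacement is 1 could invert an edge and fail to translate the geodesic;
    this is avoided because, for n large in terms of s, the integer part of [s_k n] is 0 when [s_k]
    vanishes and at least 2 when [s_k] is positive. Finally, an error that is small jointly in
    [1 / n] and [delta] is split into two one-variable errors by bounding it through the larger of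
    the two parameters. *)

Fixpoint cpl (d : nat) (s t : seq 'I_d) : nat :=
  match s, t with
  | a :: s', b :: t' => if a == b then (cpl s' t').+1 else 0
  | _, _ => 0
  end.

(** * The word metric on the tree *)

Section CommonPrefix.
Variable d : nat.
Implicit Types s t u : seq 'I_d.

Lemma cplC s t : cpl s t = cpl t s.
Proof.
by elim: s t => [|a s IH] [|b t] //=; rewrite eq_sym; case: eqP => // _; rewrite IH.
Qed.

Lemma cpl_le_size s t : (cpl s t <= size s)%N.
Proof. by elim: s t => [|a s IH] [|b t] //=; case: eqP => // _; rewrite ltnS. Qed.

Lemma cplss s : cpl s s = size s.
Proof. by elim: s => //= a s ->; rewrite eqxx. Qed.

(** On reversed words [cpl] is the Gromov product based at the root, since generators act at the
    head of a word; this ultrametric inequality is the source of the four-point condition. *)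
Lemma cpl_ultra s t u : (minn (cpl s t) (cpl t u) <= cpl s u)%N.
Proof.
elim: s t u => [|a s IH] [|b t] [|c u] //=; rewrite ?minn0 ?min0n //.
case: (eqVneq a b) => [->|ab]; last by rewrite min0n.
case: (eqVneq b c) => [_|bc]; last by rewrite minn0.
by rewrite minnSS ltnS.
Qed.

Lemma cpl_size_eq s t : cpl s t = size s -> exists u, t = s ++ u.
Proof.
elim: s t => [|a s IH] [|b t] //=; [by exists [::] | by exists (b :: t) |].
by case: eqP => // -> [] /IH [u ->]; exists u.
Qed.

Lemma cpl_catl s t : cpl s (s ++ t) = size s.
Proof. by elim: s => [|a s /= ->]; [case: t | rewrite eqxx]. Qed.

Lemma cpl_rcons s a t : (cpl (rcons s a) t <= size s)%N ->
  cpl (rcons s a) t = cpl s t.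
Proof.
elim: s t => [|b s IH] [|c t] //=; first by case: eqP.
by case: eqP => //= _; rewrite ltnS => /IH ->.
Qed.

End CommonPrefix.

Section TreeMetric.
Variable d : nat.
Implicit Types u v w p q : tree d.

(* Twice the common suffix of [word u] and [word v] is the length of the common
   part of the geodesics from the root. *)
Definition td u v : nat :=
  size (word u) + size (word v) - (cpl (rev (word u)) (rev (word v))).*2.

Let gr u v := cpl (rev (word u)) (rev (word v)).

Let gr_le u v : (gr u v <= size (word u))%N /\ (gr u v <= size (word v))%N.
Proof.
rewrite /gr; split; first by rewrite -(size_rev (word u)) cpl_le_size.
by rewrite cplC -(size_rev (word v)) cpl_le_size.
Qed.

Let tdE u v : (td u v + (gr u v).*2 = size (word u) + size (word v))%N.
Proof. by have [] := gr_le u v; rewrite /td -/(gr u v); lia. Qed.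

Lemma tdC u v : td u v = td v u.
Proof. by rewrite /td cplC addnC. Qed.

Lemma td0P u v : td u v = 0%N <-> u = v.
Proof.
split=> [uv0|->]; last by rewrite /td cplss size_rev addnn subnn.
have := tdE u v; have [] := gr_le u v; rewrite uv0 => l1 l2 e.
have /cpl_size_eq[/= s es] : cpl (rev (word u)) (rev (word v)) = size (rev (word u)).
  by rewrite size_rev -/(gr u v); lia.
have s0 : size s = 0%N.
  by have := congr1 (@size 'I_d) es; rewrite size_cat !size_rev; lia.
move: es; rewrite (size0nil s0) cats0 => /(can_inj revK) es; exact: val_inj.
Qed.

Lemma td_refl u : td u u = 0%N. Proof. exact/td0P. Qed.

(* The four-point condition: the tree is 0-hyperbolic. *)
Lemma td_four u v p q : (td u v + td p q <= maxn (td u p + td v q) (td u q + td v p))%N.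
Proof.
have U a b c : (minn (gr a b) (gr b c) <= gr a c)%N by exact: cpl_ultra.
have C a b : gr a b = gr b a by exact: cplC.
move: (tdE u v) (tdE p q) (tdE u p) (tdE v q) (tdE u q) (tdE v p).
move: (U u p v) (U u q v) (U p u q) (U p v q).
rewrite ?(C p u) ?(C q u) ?(C v u) ?(C p v) ?(C q v) ?(C q p).
lia.
Qed.

Lemma td_tri u v w : (td u w <= td u v + td v w)%N.
Proof. by have := td_four u w v v; rewrite td_refl (tdC w v); lia. Qed.

Definition par u : bool := odd (size (word u)).

Lemma td_par u v : odd (td u v) = par u (+) par v.
Proof.
have /(congr1 odd) := tdE u v.
by rewrite !oddD odd_double addbF.
Qed.

Lemma genK i : involutive (@gen d i).
Proof.
move=> [[|j w] rw]; apply: val_inj => //=; first by rewrite eqxx.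
case: (eqVneq i j) => [eij|nij] /=; last by rewrite eqxx.
subst j; case: w rw => [|k w] //= rw; rewrite /reduced /= in rw.
by case/andP: rw => /negPf ->.
Qed.

Lemma td_gen i u : td u (gen i u) = 1%N.
Proof.
suff H j s (r : reduced (j :: s)) (r' : reduced s) : td (Tree r) (Tree r') = 1%N.
  case: u => [[|j s] r]; rewrite /gen /=.
    by [].
  move: (lmul_word_reduced _ _) => /=; case: (eqVneq i j) => [_|nij] r'; first exact: H.
  by rewrite tdC; exact: H.
rewrite tdC /td /= rev_cons -cats1 cpl_catl size_rev; lia.
Qed.

(** If the common part is shorter than [u], deleting the head of [u] moves closer to [v]; otherwise
    [u] is a suffix of [v], and the next letter of [v] is prepended. *)
Lemma td_step u v : u != v -> exists i, (td (gen i u) v).+1 = td u v.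
Proof.
move=> uv.
case: (ltnP (gr u v) (size (word u))) => [lt_gr|ge_gr].
  case: u uv lt_gr => [[|i s] r] //= uv lt_gr.
  have r' : reduced s by exact: path_sorted r.
  have e : gen i (Tree r) = Tree r' by apply: val_inj; rewrite /= eqxx.
  exists i; rewrite e.
  have grE : gr (Tree r) (v) = gr (Tree r') v.
    by move: lt_gr; rewrite /gr /= rev_cons ltnS -(size_rev s) => /cpl_rcons.
  have := tdE (Tree r) v; have := tdE (Tree r') v; rewrite grE /=.
  have [] := gr_le (Tree r') v => /=; lia.
have /cpl_size_eq[[|i t] et] : cpl (rev (word u)) (rev (word v)) = size (rev (word u)).
- by apply/eqP; rewrite eqn_leq cpl_le_size size_rev.
- by case/eqP: uv; apply: val_inj; move: et; rewrite cats0 => /(can_inj revK).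
have vE : word v = rev t ++ i :: word u.
  by rewrite -(revK (word v)) et rev_cat rev_cons revK cat_rcons.
exists i.
have rg : reduced (i :: word u).
  by have := valP v; rewrite /= vE /reduced => /cat_sorted2[].
have -> : gen i u = Tree rg.
  apply: val_inj => /=; case: (word u) rg => //= j s; rewrite /reduced /=.
  by case: eqP => // ->; rewrite ?eqxx.
have := tdE u v; have := tdE (Tree rg) v.
have -> : gr u v = size (word u) by rewrite /gr et cpl_catl size_rev.
have -> : gr (Tree rg) v = (size (word u)).+1.
  by rewrite /gr et /= rev_cons -cat_rcons cpl_catl size_rcons size_rev.
by rewrite /= vE size_cat /= size_rev; lia.
Qed.

Lemma td1P u v : td u v = 1%N <-> exists i, v = gen i u.
Proof.
split=> [uv1|[i ->]]; last exact: td_gen.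
have uv : u != v by apply/eqP => /td0P; rewrite uv1.
have [i] := td_step uv; rewrite uv1 => -[] /td0P <-; by exists i.
Qed.

Lemma gen_inj i j u : gen i u = gen j u -> i = j.
Proof.
move=> /(congr1 (@word d)) /=; case: (word u) => [|k w] /=; first by case.
case: (eqVneq i k) => [->|ik]; case: (eqVneq j k) => [->|jk] //.
- by move/(congr1 size) => /=; lia.
- by move/(congr1 size) => /=; lia.
- by case.
Qed.

Lemma td_between u v n : (n <= td u v)%N ->
  exists w, td u w = n /\ (td w v + n = td u v)%N.
Proof.
elim: n => [_|n IH lt_n]; first by exists u; rewrite td_refl addn0.
have [w [uw wv]] := IH (ltnW lt_n).
have /td_step[i iw] : w != v by apply/eqP => /td0P; lia.
exists (gen i w); split; last by lia.
have := td_tri u w (gen i w); have := td_tri u (gen i w) v; rewrite td_gen; lia.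
Qed.

Lemma td_adj_par u v : td u v = 1%N -> par v = ~~ par u.
Proof. by move=> uv; have := td_par u v; rewrite uv; case: par; case: par. Qed.

Lemma td_between_uniq u v p q : (td p u + td u q = td p q)%N ->
  td p v = td p u -> td v q = td u q -> u = v.
Proof.
move=> e1 e2 e3; apply/td0P.
have := td_four u v p q; rewrite (tdC u p) (tdC v p) e2 e3; lia.
Qed.

End TreeMetric.

Lemma infimum_nat (A : set nat) n : A n -> (forall k, A k -> (n <= k)%N) ->
  infimum 0%N A = n.
Proof.
move=> An minA; rewrite /infimum ifF; last first.
  by apply/negP => /eqP A0; rewrite A0 in An.
have inf_n : infimums A n.
  split; [move=> k Ak; rewrite leEnat; exact: minA | move=> k /(_ n An)].
  by rewrite leEnat.
case: xgetP => [y _ [lb gt]|/(_ n)//].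
apply/eqP; rewrite eqn_leq; apply/andP; split.
  by have := lb n An; rewrite leEnat.
by have := gt n inf_n.1; rewrite leEnat.
Qed.

Lemma infimum_natP (A : set nat) : A !=set0 ->
  A (infimum 0%N A) /\ forall k, A k -> (infimum 0%N A <= k)%N.
Proof.
move=> [a Aa].
have ex : exists n, `[< A n >] by exists a; apply/asboolP.
case: (ex_minnP ex) => n /asboolP An minn.
have minA k : A k -> (n <= k)%N by move=> Ak; apply: minn; apply/asboolP.
by rewrite (infimum_nat An minA).
Qed.

(** * The group product and its translations of the tree *)

Section TreeDist.
Variable d : nat.
Implicit Types u v w t : tree d.

Lemma tree_adjE u v : tree_adj u v = (td u v == 1%N).
Proof.
apply/idP/idP => [/existsP[i /eqP ->]|/eqP/td1P[i ->]]; first by rewrite td_gen.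
by apply/existsP; exists i.
Qed.

Lemma td_le_path u p : path (@tree_adj d) u p -> (td u (last u p) <= size p)%N.
Proof.
elim: p u => [|v p IH] u /=; first by rewrite td_refl.
by rewrite tree_adjE => /andP[/eqP uv /IH]; have := td_tri u v (last v p); lia.
Qed.

Lemma td_path u v : exists p, [/\ path (@tree_adj d) u p, last u p = v & size p = td u v].
Proof.
move e : (td u v) => n; elim: n u e => [|n IH] u e.
  by move/td0P: e => ->; exists [::].
have /td_step[i iu] : u != v by apply/eqP => /td0P; lia.
have [|p [pp lp sp]] := IH (gen i u); first by lia.
exists (gen i u :: p); split=> //=; last by rewrite sp.
by rewrite tree_adjE td_gen eqxx.
Qed.

Lemma tree_distE u v : tree_dist u v = td u v.
Proof.
apply: infimum_nat => [|_ [p [pp <-] <-]]; last exact: td_le_path.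
by have [p [pp lp <-]] := td_path u v; exists p.
Qed.

(** The group product. Edges are left multiplications by generators, so a right translation
    [tmul^~ t] is a tree automorphism that preserves edge colours; the periods of translation
    invariant maps are of this form. *)
Definition tmul u t : tree d := foldr (@gen d) t (word u).

Lemma tmul1t t : tmul (tree_root d) t = t. Proof. by []. Qed.

Lemma tmul_gen i u t : tmul (gen i u) t = gen i (tmul u t).
Proof.
case: u => [[|j s] r] //; rewrite /tmul /=.
by case: (eqVneq i j) => [->|ij] //=; rewrite genK.
Qed.

Lemma tree_ind (P : tree d -> Prop) : P (tree_root d) ->
  (forall i u, P u -> P (gen i u)) -> forall u, P u.
Proof.
move=> P0 PS; suff H n u : td u (tree_root d) = n -> P u by move=> u; apply: H.
elim: n u => [|n IH] u e; first by move/td0P: e => ->.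
have /td_step[i iu] : u != tree_root d by apply/eqP => /td0P; lia.
by rewrite -(genK i u); apply: PS; apply: IH; lia.
Qed.

Lemma tmulA u v w : tmul (tmul u v) w = tmul u (tmul v w).
Proof. by elim/tree_ind: u => // i u IH; rewrite !tmul_gen IH. Qed.

Lemma tmult1 u : tmul u (tree_root d) = u.
Proof. by elim/tree_ind: u => // i u IH; rewrite tmul_gen IH. Qed.

Lemma exists_inv u : exists v, tmul u v = tree_root d /\ tmul v u = tree_root d.
Proof.
elim/tree_ind: u => [|i u [v [uv vu]]]; first by exists (tree_root d).
exists (tmul v (gen i (tree_root d))); split.
  by rewrite tmul_gen -tmulA uv tmul1t genK.
by rewrite tmulA tmul_gen tmul1t genK.
Qed.

Lemma td_tmul_le u v t : (td (tmul u t) (tmul v t) <= td u v)%N.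
Proof.
move e : (td u v) => n; elim: n u e => [|n IH] u e.
  by move/td0P: e => ->; rewrite td_refl.
have /td_step[i iu] : u != v by apply/eqP => /td0P; lia.
have := IH (gen i u); rewrite tmul_gen => /(_ ltac:(lia)).
by have := td_tri (tmul u t) (gen i (tmul u t)) (tmul v t); rewrite td_gen; lia.
Qed.

Lemma td_tmul u v t : td (tmul u t) (tmul v t) = td u v.
Proof.
apply/eqP; rewrite eqn_leq td_tmul_le /=.
have [t' [tt' _]] := exists_inv t.
by rewrite -{1}(tmult1 u) -{1}(tmult1 v) -tt' -!tmulA td_tmul_le.
Qed.

Lemma colourE u v i : v = gen i u -> colour u v = Some i.
Proof.
move=> ->; rewrite /colour; case: pickP => [j /eqP /gen_inj -> //|/(_ i)].
by rewrite eqxx.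
Qed.

Lemma colour_tmul u v t : colour (tmul u t) (tmul v t) = colour u v.
Proof.
rewrite /colour; apply: eq_pick => i; apply/eqP/eqP => [|->]; last by rewrite tmul_gen.
rewrite -tmul_gen => /(congr1 (td (tmul (gen i u) t))); rewrite td_refl td_tmul.
by move/td0P.
Qed.

Lemma tmul_inj t : injective (tmul^~ t).
Proof. by move=> u v e; apply/td0P; rewrite -(td_tmul u v t) e td_refl. Qed.

End TreeDist.

(** * Lattice homomorphisms and Kirszbraun extension *)

Section Lattice.
Variable m : nat.
Local Notation V := 'rV[int]_m.
Implicit Types x y z : V.

Definition l1 x y : nat := (\sum_(k < m) absz (x 0%R k - y 0%R k)%R)%N.

Lemma entryD x y k : (x + y) 0 k = x 0 k + y 0 k.
Proof. by rewrite mxE. Qed.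

Lemma entryN x k : (- x) 0 k = - x 0 k.
Proof. by rewrite mxE. Qed.

Lemma entry0 k : (0 : V) 0 k = 0.
Proof. by rewrite mxE. Qed.

Definition entryE := (entry0, entryD, entryN).

Definition upd x (k : 'I_m) (a : int) : V :=
  \row_j (if j == k then a else x 0 j).

Lemma updE x k a j : upd x k a 0 j = if j == k then a else x 0 j.
Proof. by rewrite mxE. Qed.

Lemma l1_upd x y k a :
  (l1 (upd x k a) y + absz (x 0%R k - y 0%R k)%R = l1 x y + absz (a - y 0%R k)%R)%N.
Proof.
rewrite /l1 (bigD1 k) //= [in RHS](bigD1 k) //= updE eqxx.
rewrite (eq_bigr (fun j => absz (x 0%R j - y 0%R j)%R)) => [|j /negPf jk]; last first.
  by rewrite updE jk.
by lia.
Qed.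

Lemma nbrE x y : nbr x y <-> l1 x y = 1%N.
Proof.
rewrite /nbr /l1norm.
have -> : \sum_k `|(x - y) 0 k| = (l1 x y)%:Z :> int.
  rewrite /l1 -[RHS]intz sumMz; apply: eq_bigr => k _; by rewrite !mxE intz abszE.
by split=> [[]|->].
Qed.

Lemma l1C x y : l1 x y = l1 y x.
Proof. by apply: eq_bigr => k _; lia. Qed.

Lemma l1_tri x y z : (l1 x z <= l1 x y + l1 y z)%N.
Proof. by rewrite /l1 -big_split; apply: leq_sum => k _ /=; lia. Qed.

Lemma l1_eq0 x y : l1 x y = 0%N <-> x = y.
Proof.
split=> [/eqP|->]; last by rewrite /l1 big1 // => k _; lia.
rewrite sum_nat_eq0 => /forallP H; apply/rowP => k.
by have := H k; rewrite /=; lia.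
Qed.

Lemma l1_refl x : l1 x x = 0%N. Proof. exact/l1_eq0. Qed.

Lemma l1_neq x y : x != y -> exists k, x 0 k != y 0 k.
Proof.
move=> xy; apply/existsP; apply: contraNT xy; rewrite negb_exists => /forallP H.
by apply/eqP/rowP => k; have := H k; rewrite negbK => /eqP.
Qed.

Definition toward x y k : V := upd x k (x 0 k + Num.sg (y 0 k - x 0 k)).

Lemma l1_toward x y k : x 0 k != y 0 k ->
  l1 x (toward x y k) = 1%N /\ (l1 (toward x y k) y).+1 = l1 x y.
Proof.
move=> xyk; have := l1_upd x y k (x 0 k + Num.sg (y 0 k - x 0 k)).
have := l1_upd x x k (x 0 k + Num.sg (y 0 k - x 0 k)).
rewrite -/(toward x y k) l1_refl (l1C x (toward x y k)).
by case: (ltrgt0P (y 0 k - x 0 k)) => [yx|yx|yx]; rewrite ?(gtr0_sg yx) ?(ltr0_sg yx); lia.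
Qed.

Lemma toward_between x y k j : x 0 k != y 0 k ->
  (x 0 j <= toward x y k 0 j <= y 0 j) || (y 0 j <= toward x y k 0 j <= x 0 j).
Proof.
move=> xyk; rewrite updE; case: eqP => [->|_]; last by lia.
by case: (ltrgt0P (y 0 k - x 0 k)) => [yx|yx|yx]; rewrite ?(gtr0_sg yx) ?(ltr0_sg yx); lia.
Qed.

Lemma toward_other x y k j : j != k -> toward x y k 0 j = x 0 j.
Proof. by rewrite updE => /negPf ->. Qed.

Lemma nbrP x y : l1 x y = 1%N ->
  exists k e, (e = 1 \/ e = -1) /\ y = upd x k (x 0 k + e).
Proof.
move=> xy1; have /l1_neq[k xyk] : x != y by apply/eqP => /l1_eq0; rewrite xy1.
have [_] := l1_toward xyk; rewrite xy1 => -[] /l1_eq0 <-.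
exists k, (Num.sg (y 0 k - x 0 k)); split=> //.
by case: (ltrgt0P (y 0 k - x 0 k)) => [yx|yx|yx];
   rewrite ?(gtr0_sg yx) ?(ltr0_sg yx); by [left|right|lia].
Qed.

Lemma lattice_ind (P : V -> Prop) x0 : P x0 ->
  (forall x y, l1 x y = 1%N -> P x -> P y) -> forall x, P x.
Proof.
move=> P0 PS x; move e : (l1 x x0) => n; elim: n x e => [|n IH] x e.
  by move/l1_eq0: e => ->.
have /l1_neq[k /l1_toward[e1 e2]] : x != x0 by apply/eqP => /l1_eq0; rewrite e.
by apply: PS (IH (toward x x0 k) ltac:(lia)); rewrite l1C.
Qed.

Definition vpar x : bool := odd (l1 x 0).

Lemma odd_sum (F : 'I_m -> nat) : odd (\sum_k F k) = \big[addb/false]_k odd (F k).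
Proof. by apply: (big_morph odd); [exact: oddD|]. Qed.

Lemma l1_par x y : odd (l1 x y) = vpar x (+) vpar y.
Proof.
rewrite /vpar /l1 !odd_sum -big_split; apply: eq_bigr => k _ /=.
by rewrite !mxE; lia.
Qed.

End Lattice.

Section Lipschitz.
Variables m d : nat.
Local Notation V := 'rV[int]_m.
Implicit Types (x y z : V) (f h : V -> tree d) (A : set V) (b : bool).

(** The parity clause makes the images of two neighbours lie at odd distance; as this distance is at
    most 1, they are adjacent. *)
Definition lip b A f := (forall x y, A x -> A y -> (td (f x) (f y) <= l1 x y)%N) /\
  (forall x, A x -> par (f x) = b (+) vpar x).

Definition edge f x y := td (f x) (f y) = 1%N.

Lemma graph_homE h : graph_hom (@nbr m) h <-> forall x y, l1 x y = 1%N -> edge h x y.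
Proof.
split=> [H x y /nbrE /H|H x y /nbrE /H]; first by rewrite tree_distE.
by rewrite /edge tree_distE.
Qed.

Lemma lip_edge b A f x y : lip b A f -> A x -> A y -> l1 x y = 1%N -> edge f x y.
Proof.
move=> [lf pf] Ax Ay xy; have := lf x y Ax Ay; rewrite xy leq_eqVlt ltnS leqn0.
case/orP => [/eqP//|/eqP/td0P fxy].
have := l1_par x y; have := pf x Ax; have := pf y Ay.
by rewrite fxy xy => -> /= /addbI ->; rewrite addbb.
Qed.

(* Helly's theorem for balls in the tree: among the balls [B(f x, l1 z x)] take
   one farthest from [o]; its point nearest to [o] lies in all the others. *)
Lemma lip_extend1 (i0 : 'I_d) b A f z : lip b A f ->
  exists v, (forall x, A x -> (td v (f x) <= l1 z x)%N) /\ par v = b (+) vpar z.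
Proof.
move=> [lf pf].
suff [v Hv] : exists v, forall x, A x -> (td v (f x) <= l1 z x)%N.
  (* If the common point has the wrong parity, every bound [td v (f x) <= l1 z x] is between numbers
     of different parity, hence strict, and any neighbour of [v] serves. *)
  case: (eqVneq (par v) (b (+) vpar z)) => [pv|/eqP pv]; first by exists v.
  have pgv : par (gen i0 v) = ~~ par v by apply: td_adj_par; rewrite td_gen.
  exists (gen i0 v); split=> [x Ax|]; last first.
    by rewrite pgv; move: pv; case: par; case: (b); case: vpar.
  have := td_tri (gen i0 v) v (f x); rewrite (tdC _ v) td_gen.
  have := Hv x Ax; rewrite leq_eqVlt => /orP[/eqP e|]; last by lia.
  have := l1_par z x; have := td_par v (f x); rewrite e (pf x Ax) => ->.
  by move: pv; case: par; case: (b); case: vpar; case: vpar.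
have [A0|/set0P[a Aa]] := eqVneq A set0.
  by exists (tree_root d) => x; rewrite A0.
set o := f a.
pose P k := `[< exists2 x, A x & (td o (f x) = k + l1 z x)%N >].
have [exP|nexP] := pselect (exists k, P k); last first.
  exists o => x Ax; rewrite leqNgt; apply/negP => lt; apply: nexP.
  by exists (td o (f x) - l1 z x)%N; apply/asboolP; exists x => //; lia.
have boundP k : P k -> (k <= l1 z a)%N.
  move=> /asboolP[x Ax e]; have := lf a x Aa Ax; have := l1_tri a z x.
  by rewrite (l1C a z) -/o; lia.
case: (ex_maxnP exP boundP) => k /asboolP[x1 Ax1 e1] maxk.
have [v [ov vx1]] : exists v, td o v = k /\ (td v (f x1) + k = td o (f x1))%N.
  by apply: td_between; lia.
exists v => x Ax.
have := td_four o (f x1) v (f x); rewrite ov.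
have le1 : (td (f x1) (f x) <= l1 z x1 + l1 z x)%N.
  by apply: leq_trans (lf _ _ Ax1 Ax) _; rewrite (l1C z x1) l1_tri.
have le2 : (td o (f x) <= k + l1 z x)%N.
  rewrite leqNgt; apply/negP => lt.
  have : P (td o (f x) - l1 z x)%N by apply/asboolP; exists x => //; lia.
  by move/maxk; lia.
by rewrite (tdC (f x1) v); lia.
Qed.

Lemma lip_extend (i0 : 'I_d) b A f (r : seq V) : lip b A f ->
  exists f', (forall x, A x -> f' x = f x) /\ lip b (A `|` [set` r]) f'.
Proof.
move=> lf; elim: r => [|z r [f1 [f1E lf1]]].
  exists f; split=> //; congr (lip b _ f): lf.
  by apply/seteqP; split=> x; [left|case].
have [Az|nAz] := pselect ((A `|` [set` r]) z).
  exists f1; split=> //; congr (lip b _ f1): lf1.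
  apply/seteqP; split=> x /=; first by case=> [|xr]; [left|right; rewrite inE xr orbT].
  by case=> [|]; [left|rewrite inE => /orP[/eqP ->//|xr]; right].
have [v [vd vp]] := lip_extend1 i0 z lf1.
exists (fun x => if x == z then v else f1 x); split=> [x Ax|].
  by case: eqP => [xz|_]; [case: nAz; left; rewrite -xz | exact: f1E].
have mem x : (A `|` [set` z :: r]) x -> x = z \/ x != z /\ (A `|` [set` r]) x.
  case: (eqVneq x z) => [->|xz]; first by left.
  by case=> [Ax|/=]; [|rewrite inE (negPf xz) /= => xr]; right; split=> //; [left|right].
case: lf1 => lf1 pf1; split=> [x y /mem[->|[xz Ax]] /mem[->|[yz Ay]]|x /mem[->|[xz Ax]]].
- by rewrite eqxx td_refl.
- by rewrite eqxx (negPf yz); exact: vd.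
- by rewrite eqxx (negPf xz) tdC l1C; exact: vd.
- by rewrite (negPf xz) (negPf yz); exact: lf1.
- by rewrite eqxx.
- by rewrite (negPf xz); exact: pf1.
Qed.

End Lipschitz.

(** * Counting fillings *)

Section Cardinality.

Definition ncard (T : choiceType) (X : set T) : nat := #|` fset_set X|.

Lemma ncard_surj (T U : choiceType) (X : set T) (Y : set U) (f : U -> T) :
  finite_set Y -> X `<=` f @` Y -> finite_set X /\ (ncard X <= ncard Y)%N.
Proof.
move=> finY sXY; have finX : finite_set X := sub_finite_set sXY (finite_image f finY).
split=> //; apply: (@leq_trans #|` (f @` fset_set Y)%fset|); last exact: leq_imfset_card.
apply: fsubset_leq_card; apply/fsubsetP => x; rewrite in_fset_set // inE => /sXY[y Yy <-].
by apply/imfsetP; exists y => //=; rewrite in_fset_set // inE.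
Qed.

Lemma ncard_inj (T U : choiceType) (X : set T) (Y : set U) (f : T -> U) :
  finite_set Y -> (forall x, X x -> Y (f x)) ->
  (forall x y, X x -> X y -> f x = f y -> x = y) ->
  finite_set X /\ (ncard X <= ncard Y)%N.
Proof.
move=> finY fXY finj; have [->|/set0P[x0 Xx0]] := eqVneq X set0.
  by split; [exact: finite_set0 | rewrite /ncard fset_set0 cardfs0].
apply: (@ncard_surj _ _ _ _ (fun y => xget x0 [set x | X x /\ f x = y])) => // x Xx.
exists (f x); first exact: fXY.
case: xgetP => [y _ [Xy fy]|/(_ x)]; first exact: finj.
by case.
Qed.

Lemma ncard_sub (T : choiceType) (X Y : set T) : finite_set Y -> X `<=` Y ->
  (ncard X <= ncard Y)%N.
Proof. by move=> finY sXY; apply: (ncard_inj (f := id) finY _ _).2. Qed.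

Lemma ncard_setX (T U : choiceType) (X : set T) (Y : set U) :
  finite_set X -> finite_set Y -> ncard (X `*` Y) = (ncard X * ncard Y)%N.
Proof.
move=> fX fY; rewrite /ncard -(size_allpairs (fun x y => (x, y))); apply: perm_size.
apply: uniq_perm => [||[x y]]; first exact: fset_uniq.
  by apply: allpairs_uniq; rewrite ?fset_uniq // => -[a b] [a' b'].
rewrite in_fset_set; last exact: finite_setX.
apply/idP/allpairsP => [|[[a b] /= []]].
  by rewrite inE => -[/= Xx Yy]; exists (x, y); rewrite !in_fset_set // !inE.
by rewrite !in_fset_set // !inE => Xa Yb [-> ->].
Qed.

Lemma ncard_gt0 (T : choiceType) (X : set T) x : finite_set X -> X x -> (0 < ncard X)%N.
Proof.
by move=> fX Xx; rewrite cardfs_gt0; apply/fset0Pn; exists x; rewrite in_fset_set // inE.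
Qed.

Lemma ncard_setT (T : finType) : ncard [set: T] = #|T|.
Proof.
rewrite /ncard cardfE -[RHS]cardsT; apply/eqP; rewrite eqn_leq; apply/andP; split.
  by rewrite cardsT; apply: (leq_card val); exact: val_inj.
rewrite cardsT.
have H (x : T) : x \in fset_set [set: T] by rewrite in_fset_set ?inE //; exact: finite_finset.
by apply: (leq_card (fun x => FSetSub (H x))) => x y /(congr1 val).
Qed.

Lemma ncard_fibre (T U : choiceType) (X : set T) (Y : set U) (f : T -> U) B :
  finite_set Y -> (forall x, X x -> Y (f x)) ->
  (forall y, finite_set (X `&` f @^-1` [set y]) /\
             (ncard (X `&` f @^-1` [set y]) <= B)%N) ->
  finite_set X /\ (ncard X <= ncard Y * B)%N.
Proof.
move=> finY fXY fib; have [->|/set0P[x0 Xx0]] := eqVneq X set0.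
  by split; [exact: finite_set0 | rewrite /ncard fset_set0 cardfs0].
have finB : finite_set [set: 'I_B] by exact: finite_finset.
rewrite -(card_ord B) -ncard_setT -ncard_setX //.
apply: (@ncard_surj _ _ X (Y `*` [set: 'I_B])
  (fun p => nth x0 (fset_set (X `&` f @^-1` [set p.1])) p.2)); first exact: finite_setX.
move=> x Xx; have [finF leF] := fib (f x).
have xF : x \in fset_set (X `&` f @^-1` [set f x]) by rewrite in_fset_set // inE.
have lt : (index x (fset_set (X `&` f @^-1` [set f x])) < B)%N.
  by apply: leq_trans leF; rewrite /ncard index_mem.
by exists (f x, Ordinal lt) => //=; [split => //; exact: fXY | rewrite nth_index].
Qed.

End Cardinality.

Section Fillings.
Variables m d : nat.
Local Notation V := 'rV[int]_m.
Implicit Types (x y z : V) (f h : V -> tree d) (D : set V) (b : bool).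

(** Total maps, frozen to [f] off [D]. Only edges that meet [D] are constrained, so [f] may be
    arbitrary away from the outer boundary, and gluing is a pointwise choice. *)
Definition fill D f : set (V -> tree d) :=
  [set h | (forall x, ~ D x -> h x = f x) /\
           forall x y, D x -> l1 x y = 1%N -> edge h x y].

Definition obd D : set V := [set y | ~ D y /\ exists2 x, D x & l1 x y = 1%N].

Lemma edgeC h x y : edge h x y -> edge h y x.
Proof. by rewrite /edge tdC. Qed.

(** A map of [X] is recovered from its values off [P] and the colours of the edges from parents, by
    recursion on [mu]. The base [d.+1] comes from recording a colour as an option. *)
Lemma count_parents (X : set (V -> tree d)) (P : seq V) (prt : V -> V) (mu : V -> nat) :
  (forall h h' x, X h -> X h' -> x \notin P -> h x = h' x) ->
  (forall h x, X h -> x \in P -> edge h (prt x) x) ->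
  (forall x, x \in P -> (mu (prt x) < mu x)%N) ->
  finite_set X /\ (ncard X <= d.+1 ^ size P)%N.
Proof.
move=> Xoff Xedge Xmu.
pose z : V := 0.
pose cf (h : V -> tree d) := [ffun i : 'I_(size P) =>
  [pick c | h (nth z P i) == gen c (h (prt (nth z P i)))]].
have fT : finite_set [set: {ffun 'I_(size P) -> option 'I_d}] by exact: finite_finset.
have -> : (d.+1 ^ size P = ncard [set: {ffun 'I_(size P) -> option 'I_d}])%N.
  by rewrite ncard_setT card_ffun card_option !card_ord.
apply: (ncard_inj (f := cf)) => // h h' Xh Xh' ehh'.
apply/funext => x; move e : (mu x) => n.
elim/ltn_ind: n x e => n IH x e.
have [xP|xP] := boolP (x \in P); last exact: Xoff.
have hp : h (prt x) = h' (prt x) by apply: IH (erefl _); rewrite -e; exact: Xmu.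
have := Xedge _ _ Xh xP; rewrite /edge => /td1P[i hi].
have := Xedge _ _ Xh' xP; rewrite /edge => /td1P[i' hi'].
have lt : (index x P < size P)%N by rewrite index_mem.
have := congr1 (fun F : {ffun _} => F (Ordinal lt)) ehh'.
rewrite !ffunE /= nth_index //.
case: pickP => [c /eqP hc|/(_ i)]; last by rewrite hi eqxx.
case: pickP => [c' /eqP hc'|/(_ i')]; last by rewrite hi' eqxx.
by move=> [cc']; rewrite hc hc' hp cc'.
Qed.

(** The parent of a vertex is its successor in direction [k]; the chain of parents climbs until it
    leaves [D], where the map is frozen. *)
Lemma finite_fill (k : 'I_m) (B : int) D f : finite_set D ->
  (forall x, D x -> x 0 k <= B) ->
  finite_set (fill D f) /\ (ncard (fill D f) <= d.+1 ^ ncard D)%N.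
Proof.
move=> finD DB.
have := @count_parents (fill D f) (fset_set D) (fun x => upd x k (x 0 k + 1))
  (fun x => absz (B + 1 - x 0%R k)%R); apply.
- move=> h h' x [hf _] [hf' _] /negP xn.
  have nDx : ~ D x by move=> Dx; apply: xn; rewrite in_fset_set // inE.
  by rewrite hf // hf'.
- move=> h x [_ hD]; rewrite in_fset_set // inE => Dx; apply: edgeC; apply: hD => //.
  by have := l1_upd x x k (x 0 k + 1); rewrite l1_refl l1C; lia.
- by move=> x; rewrite in_fset_set // inE => /DB; rewrite updE eqxx; lia.
Qed.

(** Completing fillings of [D'] by the single map [H] is injective, because off [D'] they are all
    equal to [f']. *)
Lemma fill_glue D D' f f' H : finite_set (fill D f) -> D' `<=` D -> fill D f H ->
  (forall x, obd D' x -> H x = f' x) ->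
  finite_set (fill D' f') /\ (ncard (fill D' f') <= ncard (fill D f))%N.
Proof.
move=> fin sD'D [Hf HD] Hf'.
apply: (ncard_inj (f := fun h x => if `[< D' x >] then h x else H x)) => //.
- move=> h [hf' hD']; split=> [x nDx|x y Dx xy].
    by case: asboolP => [/sD'D//|_]; exact: Hf.
  have E z w : D' z -> l1 z w = 1%N ->
      edge (fun x => if `[< D' x >] then h x else H x) z w.
    move=> D'z zw; have := hD' z w D'z zw; rewrite /edge.
    case: asboolP => // _; case: asboolP => // nD'w.
    by rewrite (Hf' w) ?(hf' w) //; split=> //; exists z.
  have [D'x|nD'x] := pselect (D' x); first exact: E.
  have [D'y|nD'y] := pselect (D' y); first by apply: edgeC; apply: E => //; rewrite l1C.
  by rewrite /edge; case: asboolP => // _; case: asboolP => // _; exact: HD.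
- move=> h h' [hf _] [hf' _] e; apply/funext => x.
  have := congr1 (fun g => g x) e => /=; case: asboolP => // nD'x _.
  by rewrite hf // hf'.
Qed.

Lemma fill_mono D D' f : finite_set (fill D f) -> D' `<=` D -> fill D f f ->
  finite_set (fill D' f) /\ (ncard (fill D' f) <= ncard (fill D f))%N.
Proof. by move=> fin s Df; apply: (fill_glue fin s Df). Qed.

(* Kirszbraun extension across the region between [D'] and [D]. *)
Lemma fill_compare (i0 : 'I_d) b D D' f f' :
  finite_set D -> finite_set (fill D f) -> D' `<=` D -> obd D' `<=` D ->
  lip b (obd D `|` obd D') (fun x => if `[< D x >] then f' x else f x) ->
  fill D f !=set0 /\ (ncard (fill D' f') <= ncard (fill D f))%N.
Proof.
move=> finD fin sD' sobd lf.
have [f1 [f1E lf1]] := lip_extend i0 (fset_set D) lf.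
pose H x := if `[< D x >] then f1 x else f x.
have FH : fill D f H.
  split=> [x nDx|x y Dx xy]; first by rewrite /H; case: asboolP.
  have Dr z : D z -> [set` fset_set D] z by move=> Dz; rewrite /= in_fset_set // inE.
  rewrite /edge /H; case: asboolP => // _; case: asboolP => [Dy|nDy].
    by apply: (lip_edge lf1) => //; right; exact: Dr.
  have oy : obd D y by split=> //; exists x.
  have := f1E y (or_introl oy); case: asboolP => // _ <-.
  by apply: (lip_edge lf1) => //; [right; exact: Dr|left; left].
split; first by exists H.
apply: (fill_glue fin sD' FH _).2 => x ox.
by rewrite /H; case: asboolP => [Dx|/(_ (sobd _ ox))//]; rewrite f1E; [case: asboolP|right].
Qed.

Lemma fill_tree_map D f f' (phi : tree d -> tree d) : finite_set (fill D f') ->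
  injective phi -> (forall u v, td u v = 1%N -> td (phi u) (phi v) = 1%N) ->
  (forall x, obd D x -> phi (f x) = f' x) ->
  (ncard (fill D f) <= ncard (fill D f'))%N.
Proof.
move=> fin inj_phi adj_phi phif.
apply: (ncard_inj (f := fun h x => if `[< D x >] then phi (h x) else f' x) fin _ _).2.
- move=> h [hf hD]; split=> [x nDx|x y Dx xy]; first by case: asboolP.
  rewrite /edge; case: asboolP => // _; have := adj_phi _ _ (hD x y Dx xy).
  case: asboolP => // nDy; rewrite (hf y nDy) phif //; split=> //; by exists x.
- move=> h h' [hf _] [hf' _] e; apply/funext => x.
  have := congr1 (fun g => g x) e => /=; case: asboolP => [_ /inj_phi //|nDx _].
  by rewrite hf // hf'.
Qed.

Lemma fill_lattice_map D f (rho rho' : V -> V) : finite_set (fill (D \o rho) (f \o rho)) ->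
  cancel rho' rho -> (forall x y, l1 (rho x) (rho y) = l1 x y) ->
  (ncard (fill D f) <= ncard (fill (D \o rho) (f \o rho)))%N.
Proof.
move=> fin K iso; apply: (ncard_inj (f := fun h => h \o rho) fin _ _).2.
- move=> h [hf hD]; split=> [x nDx /=|x y Dx xy]; first exact: hf.
  by rewrite /edge /=; apply: hD => //; rewrite iso.
- by move=> h h' _ _ e; apply/funext => x; rewrite -(K x); exact: (congr1 (fun g => g (rho' x)) e).
Qed.

Lemma fill_pair D D' f : finite_set (fill (D `|` D') f) ->
  (forall x, D x -> ~ D' x) -> (forall x y, D x -> D' y -> l1 x y != 1%N) ->
  finite_set (fill D f) -> finite_set (fill D' f) ->
  (ncard (fill D f) * ncard (fill D' f) <= ncard (fill (D `|` D') f))%N.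
Proof.
move=> fin dis sep fD fD'; rewrite -ncard_setX //.
apply: (ncard_inj (f := fun p x => if `[< D x >] then p.1 x else p.2 x) fin _ _).2.
- move=> [h h'] [[/= hf hD] [hf' hD']]; split=> [x nD|x y Dx xy].
    by case: asboolP => [Dx|_]; [case: nD; left|apply: hf' => D'x; apply: nD; right].
  rewrite /edge /=; case: asboolP => [D1x|nDx].
    have := hD x y D1x xy; rewrite /edge; case: asboolP => // nDy.
    rewrite (hf y nDy) hf' // => D'y; by have := sep _ _ D1x D'y; rewrite xy.
  case: Dx => // D'x; have := hD' x y D'x xy; rewrite /edge; case: asboolP => // Dy.
  by have := sep _ _ Dy D'x; rewrite l1C xy.
- move=> [h h'] [k k'] [[/= hf _] [hf' _]] [[/= kf _] [kf' _]] e; congr pair.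
    apply/funext => x; have := congr1 (fun g => g x) e => /=; case: asboolP => // nDx _.
    by rewrite hf // kf.
  apply/funext => x; have := congr1 (fun g => g x) e => /=; case: asboolP => // Dx _.
  by rewrite hf' ?kf' //; exact: dis.
Qed.

(** Domains at mutual distance at least 2 share no edge and are filled independently; between them
    the values of [f], itself a filling of [D], are kept. *)
Lemma fill_prod (I : finType) (D : set V) (Di : I -> set V) f c :
  (forall D', D' `<=` D -> finite_set (fill D' f)) -> fill D f f ->
  (forall i, Di i `<=` D) ->
  (forall i j x y, i != j -> Di i x -> Di j y -> (1 < l1 x y)%N) ->
  (forall i, c <= ncard (fill (Di i) f))%N ->
  (c ^ #|I| <= ncard (fill D f))%N.
Proof.
move=> fin Ff sub sep cle.
have H (s : seq I) : uniq s ->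
    (c ^ size s <= ncard (fill [set x | exists2 i, i \in s & Di i x] f))%N.
  elim: s => [|i s IH] /=.
    move=> _; apply: (@ncard_gt0 _ _ f); first by apply: fin => x [].
    by split=> // x y [].
  case/andP=> nis us.
  have -> : [set x | exists2 j, j \in i :: s & Di j x] =
            Di i `|` [set x | exists2 j, j \in s & Di j x].
    apply/seteqP; split=> x /=.
      move=> [j]; rewrite inE => /orP[/eqP ->|js] Dx; first by left.
      by right; exists j.
    by move=> [Dx|[j js Dx]]; [exists i; rewrite // inE eqxx|exists j; rewrite // inE js orbT].
  have subs : [set x | exists2 j, j \in s & Di j x] `<=` D by move=> x [j _ /sub].
  have nij j : j \in s -> i != j by apply: contraTneq => <-.
  rewrite expnS; apply: leq_trans (fill_pair _ _ _ _ _).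
  - by apply: leq_mul => //; exact: IH.
  - by apply: fin => x [/sub|/subs].
  - move=> x Dx [j js Dj]; have := sep i j x x (nij j js) Dx Dj; by rewrite l1_refl.
  - by move=> x y Dx [j js Dj]; have := sep i j x y (nij j js) Dx Dj; lia.
  - exact: fin.
  - exact: fin.
rewrite cardE; apply: leq_trans (H (enum I) (enum_uniq _)) _.
by apply: (fill_mono (fin _ _) _ Ff).2 => // x [i _ /sub].
Qed.

End Fillings.

(** * Independence of the geodesic *)

Section Geodesics.
Variable d : nat.
Implicit Types (g : int -> tree d) (u v w : tree d).

Definition geo g := injective g /\ forall j, td (g j) (g (j + 1)) = 1%N.

Lemma geoE g : two_sided_geodesic g <-> geo g.
Proof.
split=> -[ig hg]; split=> //.
  by move=> j; have := hg j (j + 1); rewrite tree_distE; apply; lia.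
move=> i j ij; rewrite tree_distE.
by have [->|->] : j = i + 1 \/ i = j + 1; [lia|exact: hg|rewrite tdC; exact: hg].
Qed.

(** Injectivity excludes backtracking, so points two steps apart are at distance 2; the four-point
    condition then turns this local property into a global one. *)
Lemma geo_tdn g (n : nat) j : geo g -> td (g j) (g (j + n%:Z)) = n.
Proof.
move=> [ig hg]; elim/ltn_ind: n => -[_|[_|n IH]]; first by rewrite addr0 td_refl.
  exact: hg.
have e1 := IH n.+1 ltac:(lia); have e2 := IH n ltac:(lia).
have h1 := hg (j + n%:Z); have h2 := hg (j + n.+1%:Z).
rewrite (_ : j + n%:Z + 1 = j + n.+1%:Z) in h1; last by lia.
rewrite (_ : j + n.+1%:Z + 1 = j + n.+2%:Z) in h2; last by lia.
have n2 : td (g (j + n%:Z)) (g (j + n.+2%:Z)) = 2%N.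
  have tri := td_tri (g (j + n%:Z)) (g (j + n.+1%:Z)) (g (j + n.+2%:Z)).
  have := td_par (g (j + n%:Z)) (g (j + n.+2%:Z)).
  rewrite (td_adj_par h2) (td_adj_par h1) negbK addbb.
  have : td (g (j + n%:Z)) (g (j + n.+2%:Z)) <> 0%N by move/td0P/ig; lia.
  by move: tri; rewrite h1 h2; lia.
have := td_four (g j) (g (j + n.+1%:Z)) (g (j + n%:Z)) (g (j + n.+2%:Z)).
have := td_tri (g j) (g (j + n.+1%:Z)) (g (j + n.+2%:Z)).
rewrite e1 e2 h2 n2 (tdC (g (j + n.+1%:Z)) (g (j + n%:Z))) h1; lia.
Qed.

Lemma geo_td g i j : geo g -> td (g i) (g j) = absz (i - j)%R.
Proof.
move=> gg; have [ij|ij] := lerP i j.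
  by have := geo_tdn (absz (i - j)%R) i gg; rewrite (_ : i + _ = j) //; lia.
rewrite tdC; have := geo_tdn (absz (i - j)%R) j gg; rewrite (_ : j + _ = i) //; lia.
Qed.

Lemma geo_par g j : geo g -> par (g j) = par (g 0) (+) odd (absz j).
Proof.
move=> gg; have := td_par (g j) (g 0); rewrite geo_td // subr0 => ->.
by case: par; case: par.
Qed.

Lemma geo_shift g q : geo g -> geo (fun j => g (j + q)).
Proof.
move=> [ig hg]; split=> [i j /ig|j]; first by lia.
by rewrite (_ : j + 1 + q = j + q + 1) ?hg //; lia.
Qed.

Lemma geo_mul g t : geo g -> geo (fun j => tmul (g j) t).
Proof.
by move=> [ig hg]; split=> [i j /tmul_inj/ig//|j]; rewrite td_tmul hg.
Qed.

Lemma td_root u : td (tree_root d) u = size (word u).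
Proof. by rewrite /td /= subn0. Qed.

Lemma geo_word g (n : nat) : geo g -> g 0 = tree_root d ->
  exists i, word (g n.+1%:Z) = i :: word (g n%:Z).
Proof.
move=> gg g0; have h k : size (word (g (Posz k))) = k.
  by rewrite -td_root -g0 geo_td //; lia.
have := gg.2 n%:Z; rewrite (_ : n%:Z + 1 = n.+1%:Z); last by lia.
move=> /td1P[i e]; exists i; have := h n.+1; have := h n; rewrite e /=.
case: (word (g n)) => //= j w; case: eqP => //= _; lia.
Qed.

End Geodesics.

Section Transport.
Variables (d : nat) (i0 : 'I_d) (U W : nat -> seq 'I_d).
Hypotheses (U0 : U 0%N = [::]) (W0 : W 0%N = [::]).
Hypotheses (US : forall n, exists i, U n.+1 = i :: U n).
Hypotheses (WS : forall n, exists i, W n.+1 = i :: W n).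
Hypotheses (redU : forall n, reduced (U n)) (redW : forall n, reduced (W n)).

(* The letter permutation applied below the word [w], whose image is [w']: it
   maps the edge towards the root to the edge towards the root and, on the ray
   [U], the next edge of [U] to the next edge of [W]. *)
Let sig (w w' : seq 'I_d) : {perm 'I_d} :=
  let q := head i0 (U (size w).+1) in
  let q' := head i0 (W (size w).+1) in
  if w is p :: _ then
    let p' := head i0 w' in
    if w == U (size w) then (tperm p p' * tperm (tperm p p' q) q')%g
    else tperm p p'
  else tperm q q'.

Let Fixpoint phi (w : seq 'I_d) : seq 'I_d :=
  if w is a :: w0 then sig w0 (phi w0) a :: phi w0 else [::].

Let sizeU n : size (U n) = n.
Proof. by elim: n => [|n IH]; [rewrite U0|have [i ->] := US n; rewrite /= IH]. Qed.

Let phiU n : phi (U n) = W n.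
Proof.
elim: n => [|n IH]; first by rewrite U0 W0.
have [q eq] := US n; have [q' eq'] := WS n; rewrite eq /= IH eq'; congr cons.
have sU : size (U n) = n by [].
rewrite /sig sU eq eq' /=.
case: (U n) sU => [|p w] sU; first by rewrite tpermL.
by rewrite -sU eqxx permM tpermL.
Qed.

Let reduced_cons a (w : seq 'I_d) : reduced (a :: w) = (w == [::]) || (a != head i0 w) && reduced w.
Proof. by case: w. Qed.

(** Carrying the parent letter to the parent letter is what keeps images reduced. On the ray the
    second transposition must not move the parent letter of the image, which holds since consecutive
    letters of [U], and of [W], differ. *)
Let sig_parent p w w' : phi (p :: w) = w' -> sig (p :: w) w' p = head i0 w'.
Proof.
move=> e; rewrite /sig; case: eqP => [ew|_]; last by rewrite tpermL.
rewrite permM tpermL; set n := size _ in ew *.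
have [q eq] := US n; have [q' eq'] := WS n; rewrite eq eq' /=.
have ew' : w' = W n by rewrite -e ew phiU.
have pq : p != q.
  by have := redU n.+1; rewrite eq reduced_cons -ew /= eq_sym => /andP[].
have [p' [w0 ep']] : exists p' w0, w' = p' :: w0.
  by case: w' e {ew'} => // p' w0; exists p', w0.
have pq' : p' != q'.
  by have := redW n.+1; rewrite eq' reduced_cons -ew' ep' /= eq_sym => /andP[].
rewrite ep' /=; apply: tpermD; last by rewrite eq_sym.
have : tperm p p' q != tperm p p' p by rewrite (inj_eq perm_inj) eq_sym.
by rewrite tpermL.
Qed.

Let reduced_phi w : reduced w -> reduced (phi w).
Proof.
elim: w => // a [|p w] IH //.
rewrite reduced_cons => /andP[/= ap rw].
change (reduced (sig (p :: w) (phi (p :: w)) a :: phi (p :: w))).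
rewrite reduced_cons.
apply/orP; right; apply/andP; split; last exact: IH.
set w' := (X in head _ X); have e : phi (p :: w) = w' by [].
by rewrite -(sig_parent e) -e (inj_eq perm_inj).
Qed.

Let phi_inj : injective phi.
Proof.
elim=> [|a w IH] [|b w'] //= [eab /IH eww']; subst w'.
by move/perm_inj: eab => ->.
Qed.

Definition tree_map (u : tree d) : tree d := Tree (reduced_phi (valP u)).

Lemma tree_map_inj : injective tree_map.
Proof. by move=> u v /(congr1 (@word d)) /phi_inj /val_inj. Qed.

Lemma tree_map_ray u n : word u = U n -> word (tree_map u) = W n.
Proof. by move=> /= ->; exact: phiU. Qed.

Lemma tree_map_adj u v : td u v = 1%N -> td (tree_map u) (tree_map v) = 1%N.
Proof.
have H a w (r : reduced (a :: w)) (r' : reduced w) :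
    td (tree_map (Tree r)) (tree_map (Tree r')) = 1%N.
  apply/td1P; exists (sig w (phi w) a); apply: val_inj => /=.
  by rewrite eqxx.
case/td1P => i ->; case: u => [[|j w] r].
  have -> : gen i (Tree r) = Tree (isT : reduced [:: i]) by exact: val_inj.
  by rewrite tdC; exact: H.
case: (eqVneq i j) => [eij|nij].
  have rw : reduced w by exact: path_sorted r.
  have -> : gen i (Tree r) = Tree rw by apply: val_inj; rewrite /= eij eqxx.
  exact: H.
have rw : reduced (i :: j :: w) by rewrite reduced_cons /= nij.
have -> : gen i (Tree r) = Tree rw by apply: val_inj; rewrite /= (negPf nij).
by rewrite tdC; exact: H.
Qed.

End Transport.

Section GeodesicTransport.
Variable d : nat.
Implicit Types (g : int -> tree d).

Lemma geo_gen g : geo g -> exists i : 'I_d, true.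
Proof. by move=> [_ /(_ 0)] /td1P[i _]; exists i. Qed.

(** The tree map is built for rays issuing from the root. Right translations bring [g (- M)] and
    [g' (- M)] to the root, so a half-geodesic starting arbitrarily far back is matched, which is
    enough for finite boxes. *)
Lemma geo_transport g g' (M : nat) : geo g -> geo g' ->
  exists phi : tree d -> tree d, [/\ injective phi,
    forall u v, td u v = 1%N -> td (phi u) (phi v) = 1%N &
    forall j, - M%:Z <= j -> phi (g j) = g' j].
Proof.
move=> gg gg'; have [i0 _] := geo_gen gg.
have [t [gt tg]] := exists_inv (g (- M%:Z)).
have [t' [gt' tg']] := exists_inv (g' (- M%:Z)).
pose h j := tmul (g (j - M%:Z)) t; pose h' j := tmul (g' (j - M%:Z)) t'.
have gh : geo h by exact/geo_mul/geo_shift.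
have gh' : geo h' by exact/geo_mul/geo_shift.
have h0 : h 0 = tree_root d by rewrite /h sub0r gt.
have h0' : h' 0 = tree_root d by rewrite /h' sub0r gt'.
pose U n := word (h (Posz n)); pose W n := word (h' (Posz n)).
have U0 : U 0%N = [::] by rewrite /U h0.
have W0 : W 0%N = [::] by rewrite /W h0'.
have US n : exists i, U n.+1 = i :: U n by exact: geo_word.
have WS n : exists i, W n.+1 = i :: W n by exact: geo_word.
have rU n : reduced (U n) by exact: valP.
have rW n : reduced (W n) by exact: valP.
exists (fun u => tmul (tree_map i0 U0 W0 US WS rU rW (tmul u t)) (g' (- M%:Z))); split.
- by move=> u v /tmul_inj /tree_map_inj /tmul_inj.
- by move=> u v uv; rewrite td_tmul; apply: tree_map_adj; rewrite td_tmul.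
move=> j Mj; have -> : tmul (g j) t = h (Posz (absz (j + M%:Z))).
  by rewrite /h; congr (tmul (g _) t); lia.
have -> : tree_map i0 U0 W0 US WS rU rW (h (Posz (absz (j + M%:Z)))) = h' (Posz (absz (j + M%:Z))).
  by apply: val_inj; exact: tree_map_ray.
by rewrite /h' tmulA tg' tmult1; congr g'; lia.
Qed.

End GeodesicTransport.

(** * Boxes with affine boundary heights *)

Section Boxes.
Variables (m : nat).
Local Notation V := 'rV[int]_m.
Implicit Types (x y a : V) (n c : nat).

Definition hbox a n : set V := [set x | forall k, a 0 k <= x 0 k < a 0 k + n%:Z].
(** Open on both sides: there are [n - 1] layers in each direction, and boxes of side [n] with
    corners spaced by [n] are separated by hyperplanes that contain their outer boundaries. *)
Definition box a n : set V := [set x | forall k, a 0 k < x 0 k < a 0 k + n%:Z].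

Lemma hbox_card a n : finite_set (hbox a n) /\ ncard (hbox a n) = (n ^ m)%N.
Proof.
have fT : finite_set [set: {ffun 'I_m -> 'I_n}] by exact: finite_finset.
have cT : ncard [set: {ffun 'I_m -> 'I_n}] = (n ^ m)%N.
  by rewrite ncard_setT card_ffun !card_ord.
pose r (F : {ffun 'I_m -> 'I_n}) : V := \row_k (a 0 k + (F k : nat)%:Z).
have [fin le] : finite_set (hbox a n) /\ (ncard (hbox a n) <= ncard [set: {ffun 'I_m -> 'I_n}])%N.
  apply: (ncard_surj (f := r)) => //.
  have sub (x : V) : hbox a n x -> exists2 F, True & r F = x.
    move=> hx; have lt k : (absz (x 0%R k - a 0%R k)%R < n)%N by have := hx k; lia.
    exists [ffun k => Ordinal (lt k)] => //; apply/rowP => k; rewrite !mxE !ffunE /=.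
    by have := hx k; lia.
  exact: sub.
have rP (F : {ffun 'I_m -> 'I_n}) : hbox a n (r F).
  by move=> k; rewrite mxE; have := ltn_ord (F k); lia.
have r_inj : injective r.
  move=> F G e; apply/ffunP => k; apply: val_inj.
  by have := congr1 (fun x : V => x 0 k) e; rewrite !mxE /=; lia.
split=> //; apply/eqP; rewrite eqn_leq -cT le /=.
by apply: (ncard_inj (f := r) fin _ _).2 => [F _|F G _ _]; [exact: rP|exact: r_inj].
Qed.

Lemma box_hbox a n : box a n `<=` hbox a n.
Proof. by move=> x H k; have := H k; lia. Qed.

Lemma finite_box a n : finite_set (box a n).
Proof. exact: sub_finite_set (@box_hbox a n) (hbox_card a n).1. Qed.

Lemma ncard_box a n : (ncard (box a n) <= n ^ m)%N.
Proof.
have [fin <-] := hbox_card a n; exact: ncard_sub fin (@box_hbox a n).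
Qed.

Lemma l1_coord x y k : (absz (x 0%R k - y 0%R k)%R <= l1 x y)%N.
Proof. by rewrite /l1 (bigD1 k) //= leq_addr. Qed.

Lemma obd_box a n y : obd (box a n) y ->
  (forall k, a 0 k <= y 0 k <= a 0 k + n%:Z) /\
  exists k, y 0 k = a 0 k \/ y 0 k = a 0 k + n%:Z.
Proof.
move=> [ny [x Dx /nbrP[k [e [he yE]]]]].
have cy j : j != k -> y 0 j = x 0 j by move=> /negPf jk; rewrite yE updE jk.
have ck : y 0 k = x 0 k + e by rewrite yE updE eqxx.
have Dk := Dx k.
have ek : y 0 k = a 0 k \/ y 0 k = a 0 k + n%:Z.
  have [lt|] := boolP (a 0 k < y 0 k < a 0 k + n%:Z); last by lia.
  case: ny => j; have [->//|/cy ->] := eqVneq j k; exact: Dx.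
split; last by exists k.
by move=> j; have [->|/cy ->] := eqVneq j k; [lia|have := Dx j; lia].
Qed.

Lemma obd_box_dist a n a' n' c x y :
  (forall k, a 0 k + c%:Z <= a' 0 k) ->
  (forall k, a' 0 k + n'%:Z + c%:Z <= a 0 k + n%:Z) ->
  obd (box a n) x -> obd (box a' n') y -> (c <= l1 x y)%N.
Proof.
move=> h1 h2 /obd_box[_ [k xk]] /obd_box[/(_ k) yk _].
by apply: leq_trans (l1_coord x y k); have := h1 k; have := h2 k; lia.
Qed.

Lemma box_sub a n a' n' c : (0 < c)%N ->
  (forall k, a 0 k + c%:Z <= a' 0 k) ->
  (forall k, a' 0 k + n'%:Z + c%:Z <= a 0 k + n%:Z) ->
  box a' n' `<=` box a n /\ obd (box a' n') `<=` box a n.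
Proof.
move=> c0 h1 h2; split=> [x Dx k|x /obd_box[Dx _] k].
  by have := Dx k; have := h1 k; have := h2 k; lia.
by have := Dx k; have := h1 k; have := h2 k; lia.
Qed.

End Boxes.

(** * Affine reference heights and comparison of boxes *)

Section Reference.
Variables (R : realType) (m d : nat) (s : 'rV[R]_m).
Local Notation V := 'rV[int]_m.
Implicit Types (x y a : V) (n c : nat) (g : int -> tree d) (f : V -> tree d).

Lemma fill_box_fin (k : 'I_m) f a n D : D `<=` box a n ->
  finite_set (fill D f) /\ (ncard (fill D f) <= d.+1 ^ n ^ m)%N.
Proof.
move=> sD; have finD := sub_finite_set sD (finite_box a n).
have [|fin le] := @finite_fill m d k (a 0 k + n%:Z) D f finD.
  by move=> x /sD /(_ k); lia.
split=> //; apply: leq_trans le _; apply: leq_pexp2l => //.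
by apply: leq_trans (ncard_box a n); apply: ncard_sub => //; exact: finite_box.
Qed.

Lemma hom_lip (h : V -> tree d) : (forall x y, l1 x y = 1%N -> edge h x y) ->
  lip (par (h 0)) setT h.
Proof.
move=> eh; split=> [x y _ _|x _].
  move e : (l1 x y) => n; elim: n x e => [|n IH] x e.
    by move/l1_eq0: e => ->; rewrite td_refl.
  have /l1_neq[k /l1_toward[e1 e2]] : x != y by apply/eqP => /l1_eq0; rewrite e.
  have := IH (toward x y k) ltac:(lia); have := eh _ _ e1; rewrite /edge.
  by have := td_tri (h x) (h (toward x y k)) (h y); lia.
move: x; apply: (@lattice_ind m (fun x => par (h x) = par (h 0) (+) vpar x) 0) => [|x y xy px].
  by rewrite /vpar l1_refl addbF.
have := l1_par x y; rewrite (td_adj_par (eh x y xy)) px xy /=.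
by case: vpar; case: vpar; case: par.
Qed.

Lemma dotB x y : dot s (x - y) = dot s x - dot s y.
Proof.
rewrite /dot -sumrB; apply: eq_bigr => k _; rewrite !mxE.
by rewrite rmorphB /=; ring.
Qed.

Lemma dot_le x y : `|dot s x - dot s y| <= l1norm s * (l1 x y)%:R.
Proof.
rewrite -dotB; apply: le_trans (ler_norm_sum _ _ _) _.
rewrite /l1 natr_sum mulr_sumr; apply: ler_sum => k _.
rewrite normrM !mxE natr_absz intr_norm; apply: ler_wpM2r => //.
by rewrite /l1norm (bigD1 k) //= lerDl; apply: sumr_ge0.
Qed.

Definition vsum x : int := \sum_k x 0 k.

(* The largest integer below [dot s x] with the parity of [x]. *)
Definition height x : int := vsum x + 2 * Num.floor ((dot s x - (vsum x)%:~R) / 2).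

Lemma height_itv x : (height x)%:~R <= dot s x < (height x)%:~R + 2.
Proof.
have := floor_itv ((dot s x - (vsum x)%:~R) / 2).
by rewrite /height !rmorphD /= rmorphM /=; lra.
Qed.

Lemma odd_abszD (i j : int) : odd (absz (i + j)) = odd (absz i) (+) odd (absz j).
Proof. by lia. Qed.

Lemma odd_vsum x : odd (absz (vsum x)) = vpar x.
Proof.
rewrite /vpar /l1 odd_sum /vsum.
rewrite (big_morph (fun i : int => odd (absz i)) odd_abszD (erefl _)).
by apply: eq_bigr => k _; rewrite mxE subr0.
Qed.

Lemma height_par x : odd (absz (height x)) = vpar x.
Proof. by rewrite -odd_vsum /height; lia. Qed.

(** The two heights differ by less than [1 + 2], and by an odd number. *)
Lemma height_step x y : l1norm s < 1 -> l1 x y = 1%N ->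
  height y = height x + 1 \/ height x = height y + 1.
Proof.
move=> s1 xy; have := dot_le x y; rewrite xy mulr1.
have := height_itv x; have := height_itv y.
have := l1_par x y; rewrite xy -!height_par => par_ hy hx.
rewrite ler_norml => hxy.
have h1 : (height x - height y)%:~R < 3%:~R :> R by rewrite rmorphB /=; lra.
have h2 : (-3)%:~R < (height x - height y)%:~R :> R by rewrite rmorphB /=; lra.
by move: h1 h2; rewrite !ltr_int; lia.
Qed.

Lemma ref_edge g q x y : l1norm s < 1 -> geo g -> l1 x y = 1%N ->
  edge (fun x => g (height x + q)) x y.
Proof.
move=> s1 gg xy; rewrite /edge geo_td //.
by case: (height_step s1 xy) => ->; lia.
Qed.

Definition refZ g n : nat := ncard (fill (box 0 n) (g \o height)).

(** On the outer boundary [dot s x] is at least [- (m * n)] and the height exceeds [dot s x - 2], so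
    transporting the geodesic from [- (m * n + 2)] onwards matches all boundary values. *)
Lemma refZ_indep (k : 'I_m) g g' n : l1norm s < 1 -> geo g -> geo g' -> (refZ g n <= refZ g' n)%N.
Proof.
move=> s1 gg gg'; have [phi [phi_inj phi_adj phig]] := geo_transport (m * n + 2)%N gg gg'.
apply: (@fill_tree_map _ _ _ _ _ phi) => //.
  by have [] := @fill_box_fin k (g' \o height) 0 n (box 0 n).
move=> x /obd_box[xn _] /=; apply: phig.
have l1x : (l1 x 0 <= m * n)%N.
  have -> : (m * n = \sum_(k < m) n)%N by rewrite sum_nat_const card_ord.
  apply: leq_sum => j _.
  by have := xn j; rewrite !mxE; lia.
have := height_itv x; have := dot_le x 0.
have -> : dot s 0 = 0 by rewrite /dot big1 // => j _; rewrite mxE mulr0.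
rewrite subr0 ler_norml => hd hh.
have hl : l1norm s * (l1 x 0)%:R <= (m * n)%:R.
  apply: (@le_trans _ _ (1 * (l1 x 0)%:R)); first by apply: ler_wpM2r => //; exact: ltW.
  by rewrite mul1r ler_nat.
have : (- (m * n + 2)%N%:Z)%:~R < (height x)%:~R :> R.
  by rewrite rmorphN /= -pmulrn natrD; lra.
by rewrite ltr_int; lia.
Qed.

Definition nearlin g (rho E : R) f (A : set V) := forall x, A x ->
  exists j : int, (td (f x) (g j))%:R <= E /\ `|j%:~R - (dot s x + rho)| <= E.

Lemma nearlin_cross g rho E E' f f' A A' x y : geo g -> nearlin g rho E f A ->
  nearlin g rho E' f' A' -> A x -> A' y ->
  2 * (E + E') <= (1 - l1norm s) * (l1 x y)%:R -> (td (f x) (f' y) <= l1 x y)%N.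
Proof.
move=> gg nf nf' Ax A'y le; rewrite -(ler_nat R).
have [j [j1 j2]] := nf x Ax; have [j' [j1' j2']] := nf' y A'y.
have t : (td (f x) (f' y))%:R <= (td (f x) (g j))%:R + `|j%:~R - j'%:~R| + (td (f' y) (g j'))%:R :> R.
  rewrite -rmorphB /= -intr_norm -natr_absz -!natrD ler_nat -(geo_td j j' gg).
  have := td_tri (f x) (g j) (f' y); have := td_tri (g j) (g j') (f' y).
  by rewrite (tdC (g j') (f' y)); lia.
have := dot_le x y; move: j2 j2' t; rewrite !ler_norml => j2 j2' t hd.
have : `|j%:~R - j'%:~R| <= E + E' + l1norm s * (l1 x y)%:R by rewrite ler_norml; lra.
by lra.
Qed.

Lemma box_compare (k0 : 'I_m) b a n a' n' c g rho E E' f f' :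
  geo g -> (0 < c)%N -> 2 * (E + E') <= (1 - l1norm s) * c%:R -> l1norm s < 1 ->
  (forall k, a 0 k + c%:Z <= a' 0 k) ->
  (forall k, a' 0 k + n'%:Z + c%:Z <= a 0 k + n%:Z) ->
  nearlin g rho E f (obd (box a n)) -> nearlin g rho E' f' (obd (box a' n')) ->
  lip b (obd (box a n)) f -> lip b (obd (box a' n')) f' ->
  fill (box a n) f !=set0 /\
  (ncard (fill (box a' n') f') <= ncard (fill (box a n) f))%N.
Proof.
move=> gg c0 hc s1 h1 h2 nf nf' [lf pf] [lf' pf'].
have [sD sobd] := box_sub c0 h1 h2.
have [i0 _] := geo_gen gg.
apply: (@fill_compare _ _ i0 b) => //.
- exact: finite_box.
- by have [] := @fill_box_fin k0 f a n (box a n).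
have cross x y : obd (box a n) x -> obd (box a' n') y -> (td (f x) (f' y) <= l1 x y)%N.
  move=> ox oy; apply: (nearlin_cross gg nf nf') => //.
  apply: le_trans hc _; apply: ler_wpM2l; first by lra.
  by rewrite ler_nat; exact: obd_box_dist h1 h2 ox oy.
have outE x : obd (box a n) x -> (if `[< box a n x >] then f' x else f x) = f x.
  by move=> [nx _]; case: asboolP.
have inE' x : obd (box a' n') x -> (if `[< box a n x >] then f' x else f x) = f' x.
  by move=> /sobd; case: asboolP.
split=> [x y [ox|ox] [oy|oy]|x [ox|ox]].
- by rewrite (outE x) // (outE y) //; exact: lf.
- by rewrite (outE x) // (inE' y) //; exact: cross.
- by rewrite (inE' x) // (outE y) // tdC l1C; exact: cross.
- by rewrite (inE' x) // (inE' y) //; exact: lf'.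
- by rewrite (outE x) //; exact: pf.
- by rewrite (inE' x) //; exact: pf'.
Qed.

(** The index shift [q] is the integer part of [rho + dot s a] or the next integer, whichever gives
    parity [b]. The error 3 is 2 from rounding the height plus 1 from [q]. *)
Lemma ref_shift g rho b a : l1norm s < 1 -> geo g ->
  exists q : int, let F x := g (height (x - a) + q) in
    lip b setT F /\ nearlin g rho 3 F setT.
Proof.
move=> s1 gg.
pose q0 := Num.floor (rho + dot s a).
have [q [q1 q2]] : exists q : int, `|q%:~R - (rho + dot s a)| <= 1 /\
    odd (absz q) = b (+) par (g 0) (+) vpar a.
  have := floor_itv (rho + dot s a); rewrite -/q0 rmorphD /= => itv.
  case: (eqVneq (odd (absz q0)) (b (+) par (g 0) (+) vpar a)) => [e|/eqP ne].
    by exists q0; split=> //; rewrite ler_norml; lra.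
  exists (q0 + 1); split; first by rewrite rmorphD /= ler_norml; lra.
  by rewrite odd_abszD; move: ne; case: odd; case: (_ (+) _ (+) _).
exists q => F.
have hF x y : l1 x y = 1%N -> edge F x y.
  move=> xy; apply: (ref_edge q s1 gg (x := x - a) (y := y - a)).
  by apply: etrans xy; apply: eq_bigr => k _; rewrite !mxE; congr absz; ring.
have pF x : par (F x) = b (+) vpar x.
  rewrite /F geo_par // odd_abszD height_par q2.
  have -> : vpar (x - a) = vpar x (+) vpar a.
    by rewrite -l1_par; congr odd; apply: eq_bigr => k _; rewrite !mxE subr0.
  by case: par; case: b {q2}; case: vpar; case: vpar.
split; first by split; [exact: (hom_lip hF).1|move=> x _; exact: pF].
move=> x _; exists (height (x - a) + q); rewrite td_refl; split; first by lra.
have := height_itv (x - a); rewrite dotB; set H := height _ => itv.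
by move: q1; rewrite !ler_norml rmorphD /=; lra.
Qed.

Lemma lipS b A A' f : lip b A f -> A' `<=` A -> lip b A' f.
Proof. by move=> [lf pf] sA; split=> [x y /sA Ax /sA Ay|x /sA Ax]; [exact: lf|exact: pf]. Qed.

Lemma nearlinS g rho E A A' f : nearlin g rho E f A -> A' `<=` A -> nearlin g rho E f A'.
Proof. by move=> nf sA x /sA; exact: nf. Qed.

Lemma ref_shift_card (k0 : 'I_m) g (q : int) a n :
  ncard (fill (box a n) (fun x => g (height (x - a) + q))) = refZ (fun j => g (j + q)) n.
Proof.
have tr x y z : l1 (x + z) (y + z) = l1 x y.
  by apply: eq_bigr => k _; rewrite !mxE; congr absz; ring.
pose F (x : V) := g (height (x - a) + q); rewrite -/F.
have bE : box a n = box 0 n \o (fun x => x - a).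
  by apply/seteqP; split=> x /= H k; have := H k; rewrite !entryE; lia.
have bE' : box 0 n = box a n \o (fun x => x + a).
  by apply/seteqP; split=> x /= H k; have := H k; rewrite !entryE; lia.
have FE : F \o (fun x => x + a) = (fun j => g (j + q)) \o height.
  by apply/funext => x; rewrite /F /= addrK.
apply/eqP; rewrite eqn_leq /refZ; apply/andP; split.
  rewrite -FE [in leqRHS]bE'; apply: (fill_lattice_map (rho' := fun x => x - a)).
  - rewrite -bE'; exact: (fill_box_fin k0 _ (a := 0) (n := n) _).1.
  - by move=> x; rewrite subrK.
  - by move=> x y; exact: tr.
rewrite [in leqRHS]bE; apply: (fill_lattice_map (rho' := fun x => x + a)).
- rewrite -bE; exact: (fill_box_fin k0 _ (a := a) (n := n) _).1.
- by move=> x; rewrite addrK.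
- by move=> x y; exact: tr.
Qed.

(** The inner reference data follow [g], with offset and parity fitted to [f]; once the comparison
    is made, the shifted geodesic is replaced by [gr], so the bound no longer involves [g]. *)
Lemma box_lower (k0 : 'I_m) b a n k c g gr rho E f :
  geo g -> geo gr -> (0 < c)%N -> 2 * (E + 3) <= (1 - l1norm s) * c%:R ->
  l1norm s < 1 -> (k + c.*2 <= n)%N ->
  nearlin g rho E f (obd (box a n)) -> lip b (obd (box a n)) f ->
  fill (box a n) f !=set0 /\ (refZ gr k <= ncard (fill (box a n) f))%N.
Proof.
move=> gg ggr c0 hc s1 kn nf lf.
pose a' : V := \row_j (a 0 j + c%:Z).
have [q [lF nF]] := ref_shift rho b a' s1 gg.
have [||ne le] := box_compare k0 (a' := a') (n' := k) gg c0 hc s1 _ _ nf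
  (nearlinS nF (@subsetT _ _)) lf (lipS lF (@subsetT _ _)).
- by move=> j; rewrite mxE.
- by move=> j; rewrite mxE; lia.
split=> //; apply: leq_trans le; rewrite ref_shift_card //.
exact: refZ_indep (geo_shift q gg).
Qed.

Lemma box_upper (k0 : 'I_m) b a n k c g gr rho E f :
  geo g -> geo gr -> (0 < c)%N -> 2 * (E + 3) <= (1 - l1norm s) * c%:R ->
  l1norm s < 1 -> (n + c.*2 <= k)%N ->
  nearlin g rho E f (obd (box a n)) -> lip b (obd (box a n)) f ->
  (ncard (fill (box a n) f) <= refZ gr k)%N.
Proof.
move=> gg ggr c0 hc s1 kn nf lf.
pose a' : V := \row_j (a 0 j - c%:Z).
have [q [lF nF]] := ref_shift rho b a' s1 gg.
have hc' : 2 * (3 + E) <= (1 - l1norm s) * c%:R by rewrite (addrC 3).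
have [||_ le] := box_compare k0 (a := a') (n := k) gg c0 hc' s1 _ _
  (nearlinS nF (@subsetT _ _)) nf (lipS lF (@subsetT _ _)) lf.
- by move=> j; rewrite mxE; lia.
- by move=> j; rewrite mxE; lia.
apply: leq_trans le _; rewrite ref_shift_card //.
exact: refZ_indep (geo_shift q gg) _.
Qed.

End Reference.

(** * Superadditivity and the limiting entropy *)

Section Tiling.
Variables (m d : nat).
Local Notation V := 'rV[int]_m.
Implicit Types (f : V -> tree d).

Definition corner (q w : nat) (F : {ffun 'I_m -> 'I_q}) : V :=
  \row_k (F k * w)%N%:Z.

Lemma cornerE q w (F : {ffun 'I_m -> 'I_q}) k : corner w F 0 k = (F k * w)%N%:Z.
Proof. by rewrite mxE. Qed.

Lemma corner_sub q w (F : {ffun 'I_m -> 'I_q}) M : (w * q <= M)%N ->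
  box (corner w F) w `<=` box 0 M.
Proof.
move=> wq x Dx k; have := Dx k; rewrite cornerE entry0 => xk.
have : ((F k).+1 * w <= q * w)%N by rewrite leq_mul2r ltn_ord orbT.
by lia.
Qed.

(** The tiles are open boxes, so the hyperplanes between them, together with what remains of the
    large box, stay frozen at [f]. *)
Lemma tile_prod (k0 : 'I_m) (M w q : nat) f c : fill (box 0 M) f f -> (w * q <= M)%N ->
  (forall F : {ffun 'I_m -> 'I_q}, c <= ncard (fill (box (corner w F) w) f))%N ->
  (c ^ (q ^ m) <= ncard (fill (box 0 M) f))%N.
Proof.
move=> Ff wq cle.
have sep (F G : {ffun 'I_m -> 'I_q}) (x y : V) : F != G ->
    box (corner w F) w x -> box (corner w G) w y -> (1 < l1 x y)%N.
  move=> FG Fx Gy; have [k FGk] : exists k : 'I_m, (F k : nat) <> G k.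
    apply: contrapT => nk; case/eqP: FG; apply/ffunP => k; apply: val_inj.
    by apply: contrapT => nFG; apply: nk; exists k.
  apply: leq_trans (l1_coord x y k); have := Fx k; have := Gy k; rewrite !cornerE.
  move: FGk; move: (F k : nat) (G k : nat) => a b ab.
  have [lt|lt|//] := ltngtP a b.
    have : (a.+1 * w <= b * w)%N by rewrite leq_mul2r lt orbT.
    by lia.
  have : (b.+1 * w <= a * w)%N by rewrite leq_mul2r lt orbT.
  by lia.
have -> : (q ^ m = #|{ffun 'I_m -> 'I_q}|)%N by rewrite card_ffun !card_ord.
apply: (fill_prod (Di := fun F => box (corner w F) w)) => //.
- by move=> D' sD'; exact: (fill_box_fin k0 f sD').1.
- by move=> F; exact: corner_sub.
Qed.

End Tiling.

Section Superadditivity.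
Variables (R : realType) (m d : nat) (s : 'rV[R]_m) (k0 : 'I_m) (g : int -> tree d).
Hypotheses (s1 : l1norm s < 1) (gg : geo g).

Lemma height_hom x y : l1 x y = 1%N -> edge (g \o height s) x y.
Proof.
by move=> xy; have := ref_edge 0 s1 gg xy; rewrite /edge !addr0.
Qed.

Lemma fill_height D : fill D (g \o height s) (g \o height s).
Proof. by split=> // x y _; exact: height_hom. Qed.

Lemma refZ_gt0 n : (0 < refZ s g n)%N.
Proof.
apply: (ncard_gt0 (x := g \o height s)); last exact: fill_height.
exact: (fill_box_fin k0 _ (a := 0) (n := n) _).1.
Qed.

Lemma refZ_le n : (refZ s g n <= d.+1 ^ n ^ m)%N.
Proof. exact: (fill_box_fin k0 _ (a := 0) (n := n) _).2. Qed.

Lemma nearlin_height A : nearlin s g 0 2 (g \o height s) A.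
Proof.
move=> x _; exists (height s x); rewrite td_refl addr0; split; first by lra.
by have := height_itv s x; rewrite ler_norml; lra.
Qed.

(** Tiles of side [k + 2c] each hold a reference box of side [k] with margin [c]. The constant is
    [10 = 2 * (2 + 3)]: rounding of the heights in the tile, and of the shifted reference. *)
Lemma refZ_super c k q M : (0 < c)%N -> 10 <= (1 - l1norm s) * c%:R ->
  ((k + c.*2) * q <= M)%N -> (refZ s g k ^ (q ^ m) <= refZ s g M)%N.
Proof.
move=> c0 hc kM; apply: (tile_prod k0 (w := (k + c.*2)%N)) => //; first exact: fill_height.
move=> F; apply: (box_lower k0 (g := g) (c := c) (rho := 0) (E := 2)
  (b := par ((g \o height s) 0)) gg gg c0 _ s1 (leqnn _) _ _).2.
- by apply: le_trans hc; lra.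
- exact: nearlin_height.
- exact: lipS (hom_lip height_hom) (@subsetT _ _).
Qed.

End Superadditivity.

(** * Limits of superadditive sequences with a margin *)

Section Asymptotics.
Variable R : realType.
Implicit Types (u e : R).

(** By convexity the power lies below its chord on [[0, 1]]. *)
Lemma expr1D_le m u : 0 <= u <= 1 -> (1 + u) ^+ m <= 1 + (2 ^+ m - 1) * u.
Proof.
move=> /andP[u0 u1]; elim: m => [|m IH]; first by rewrite !expr0; lra.
rewrite exprS; apply: (@le_trans _ _ ((1 + u) * (1 + (2 ^+ m - 1) * u))).
  by apply: ler_wpM2l IH; lra.
have A1 : 1 <= 2 ^+ m :> R by apply: exprn_ege1; lra.
rewrite (exprS 2); move: (2 ^+ m) A1 => A A1.
have : 0 <= (A - 1) * (u * (1 - u)) by rewrite !mulr_ge0 //; lra.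
by lra.
Qed.

Lemma expr1B_ge m u : 0 <= u <= 1 -> 1 - m%:R * u <= (1 - u) ^+ m.
Proof.
move=> /andP[u0 u1]; elim: m => [|m IH]; first by rewrite expr0; lra.
rewrite exprS; apply: (@le_trans _ _ ((1 - u) * (1 - m%:R * u))).
  have m0 : 0 <= m%:R :> R by [].
  by rewrite -natr1; nra.
by apply: ler_wpM2l IH; lra.
Qed.

Lemma small_inv e : 0 < e -> exists K, forall n, (K <= n)%N -> (0 < n)%N /\ n%:R^-1 <= e.
Proof.
move=> e0; exists (Num.trunc e^-1).+1 => n Kn; split; first by lia.
have n0 : 0 < n%:R :> R by rewrite ltr0n; lia.
rewrite -[leRHS]invrK lef_pV2 ?posrE ?invr_gt0 //.
apply: ltW; apply: lt_le_trans (truncnS_gt _) _; by rewrite ler_nat.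
Qed.

Variables (m c : nat) (z : nat -> R) (Lam : R).
Hypothesis c0 : (0 < c)%N.
Hypothesis z0 : forall n, 0 <= z n.
Hypothesis zLam : forall n, z n <= Lam * n%:R ^+ m.
Hypothesis zS : forall k q M, ((k + c) * q <= M)%N -> (q%:R ^+ m) * z k <= z M.

(** Fekete's argument for the ratios [z k / (k + c)^m], whose supremum is the limit: the upper bound
    is immediate, and the lower one tiles by a nearly optimal [k]. *)
Lemma superadditive_limit : exists2 lam, 0 <= lam & forall e, 0 < e ->
  exists K, forall n, (K <= n)%N -> `|z n - lam * n%:R ^+ m| <= e * n%:R ^+ m.
Proof.
pose v k := z k / (k + c)%:R ^+ m.
have p0 k : 0 < (k + c)%:R ^+ m :> R by rewrite exprn_gt0 // ltr0n; lia.
have Lam0 : 0 <= Lam.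
  have := le_trans (z0 1) (zLam 1); by rewrite expr1n mulr1.
have vL k : v k <= Lam.
  rewrite /v ler_pdivrMr //; apply: le_trans (zLam k) _; apply: ler_wpM2l => //.
  by apply: lerXn2r; rewrite ?nnegrE // ler_nat leq_addr.
have hs : has_sup (range v).
  by split; [exists (v 0%N), 0%N|exists Lam => _ [k _ <-]].
pose lam := sup (range v).
have vlam k : v k <= lam by apply: ub_le_sup; [exact: hs.2|exists k].
have v0 k : 0 <= v k by rewrite /v divr_ge0 // ltW.
have lam0 : 0 <= lam by apply: le_trans (v0 0%N) (vlam 0%N).
exists lam => // e e0.
have [_ [k _ <-] vk] := sup_adherent (eps := e / 2) ltac:(lra) hs.
rewrite -/lam in vk.
(* The relative losses are [(1 + c/n)^m - 1] above and at most [m (k + c) / n] below, the latter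
   because [k + c] need not divide [n]; the summand 1 only makes [A] positive. *)
pose A : R := 2 ^+ m * c%:R * lam + m%:R * (k + c)%:R * lam + 1.
have A0 : 0 < A.
  by apply: (@lt_le_trans _ _ 1) => //; rewrite /A lerDr addr_ge0 // !mulr_ge0 ?exprn_ge0.
have [K1 HK1] := @small_inv (e / (2 * A)) ltac:(by rewrite divr_gt0 // mulr_gt0).
exists (maxn K1 (k + c)%N) => n; rewrite geq_max => /andP[/HK1[n0 ne] kcn].
have nR : 0 < n%:R :> R by rewrite ltr0n.
have nm : 0 < n%:R ^+ m :> R by rewrite exprn_gt0.
have iA : n%:R^-1 * A <= e / 2.
  by rewrite -ler_pdivlMr //; apply: le_trans ne _; rewrite invfM mulrA.
rewrite ler_norml; apply/andP; split.
  pose q := (n %/ (k + c))%N; pose u : R := (k + c)%:R / n%:R.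
  have u01 : 0 <= u <= 1.
    by rewrite /u divr_ge0 //= ler_pdivrMr // mul1r ler_nat.
  have qn : (1 - u) * n%:R <= (q * (k + c))%:R.
    rewrite mulrBl mul1r /u divfK ?gt_eqF // lerBlDr -natrD ler_nat -mulSnr.
    by apply/ltnW/ltn_ceil; rewrite addn_gt0 c0 orbT.
  have h1 : v k * (q * (k + c))%:R ^+ m <= z n.
    apply: le_trans (@zS k q n _); last by rewrite /q mulnC leq_divM.
    by rewrite /v natrM exprMn mulrCA mulfVK ?gt_eqF // mulrC.
  have h2 : v k * ((1 - u) ^+ m * n%:R ^+ m) <= z n.
    apply: le_trans h1; apply: ler_wpM2l => //; rewrite -exprMn.
    apply: lerXn2r => //; rewrite nnegrE ?mulr_ge0 //; lra.
  have h3 : v k * (1 - m%:R * u) * n%:R ^+ m <= z n.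
    apply: le_trans h2; rewrite [leRHS]mulrA; apply: ler_wpM2r; first exact: ltW.
    by apply: ler_wpM2l => //; exact: expr1B_ge.
  have h4 : lam - e <= v k * (1 - m%:R * u).
    have : v k * (m%:R * u) <= e / 2.
      apply: (@le_trans _ _ (lam * (m%:R * u))).
        by apply: ler_wpM2r => //; rewrite mulr_ge0 //; case/andP: u01.
      apply: le_trans iA; rewrite /u /A.
      have : 0 <= n%:R^-1 * (2 ^+ m * c%:R * lam) by rewrite !mulr_ge0 ?invr_ge0 ?exprn_ge0 // ltW.
      have : 0 <= n%:R^-1 :> R by rewrite invr_ge0 ltW.
      by lra.
    by lra.
  have := ler_wpM2r (ltW nm) h4; lra.
pose u : R := c%:R / n%:R.
have u01 : 0 <= u <= 1.
  by rewrite /u divr_ge0 //= ler_pdivrMr // mul1r ler_nat (leq_trans (leq_addl k c)).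
have h1 : z n <= lam * (n + c)%:R ^+ m by rewrite -ler_pdivrMr //; exact: vlam.
have h2 : (n + c)%:R = (1 + u) * n%:R :> R.
  by rewrite mulrDl mul1r /u divfK ?gt_eqF // natrD.
have h3 : z n <= lam * (1 + (2 ^+ m - 1) * u) * n%:R ^+ m.
  apply: le_trans h1 _; rewrite h2 exprMn mulrA; apply: ler_wpM2r; first exact: ltW.
  by apply: ler_wpM2l => //; exact: expr1D_le.
have h4 : lam * ((2 ^+ m - 1) * u) <= e.
  apply: (@le_trans _ _ (n%:R^-1 * A)); last by lra.
  rewrite /u /A.
  have a0 : 0 <= n%:R^-1 * (m%:R * (k + c)%:R * lam) by rewrite !mulr_ge0 ?invr_ge0 ?exprn_ge0 // ltW.
  have a1 : 0 <= n%:R^-1 * c%:R * lam by rewrite !mulr_ge0 ?invr_ge0 ?exprn_ge0 // ltW.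
  have a2 : 0 <= n%:R^-1 :> R by rewrite invr_ge0 ltW.
  by lra.
have := ler_wpM2r (ltW nm) h4; lra.
Qed.

End Asymptotics.

(** * Transfer of the limit to perturbed side lengths *)

Section EpsilonComparison.
Variables (R : realType) (m : nat) (z : nat -> R) (lam : R).
Hypothesis lam0 : 0 <= lam.
Hypothesis zlim : forall e : R, 0 < e -> exists K, forall n, (K <= n)%N ->
  `|z n - lam * n%:R ^+ m| <= e * n%:R ^+ m.

Lemma small_radius (a b : R) : 0 < a -> 0 <= b -> exists2 r : R, 0 < r & b * r <= a.
Proof.
move=> a0 b0; exists (a / (b + 1)); first by rewrite divr_gt0 //; lra.
rewrite mulrCA ler_piMr //; first exact: ltW.
by rewrite ler_pdivrMr; lra.
Qed.

(** The hypothesis is used for a single [k], the integer part of [n - C (delta n + 1)]; then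
    [k >= (1 - u) n] with [u = C (delta + 1/n) + 1/n], and Bernoulli's inequality controls [k^m]. *)
Lemma compare_lower (C e : R) : 0 <= C -> 0 < e -> exists2 r : R, 0 < r &
  forall (n : nat) (delta A : R), (0 < n)%N -> n%:R^-1 < r -> 0 <= delta < r ->
  (forall k : nat, k%:R + C * (delta * n%:R + 1) <= n%:R -> z k <= A) ->
  lam * n%:R ^+ m - e * n%:R ^+ m <= A.
Proof.
move=> C0 e0; have [K HK] := zlim (e := e / 2) ltac:(lra).
(* The three radii keep [u] below 1/2, make the loss [lam * m * u] at most [e / 2], and force [k]
   past the threshold [K]. *)
have [r1 r10 hr1] := @small_radius (1 / 2) (2 * C + 1) ltac:(lra) ltac:(lra).
have [r2 r20 hr2] := @small_radius (e / 2) (lam * m%:R * (2 * C + 1)) ltac:(lra)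
  ltac:(by rewrite !mulr_ge0 //; lra).
have [r3 r30 hr3] := @small_radius (1 / 2) K.+1%:R ltac:(lra) ltac:(by []).
exists (Num.min r1 (Num.min r2 r3)); first by rewrite !lt_min r10 r20 r30.
move=> n delta A n0; rewrite !lt_min => /and3P[n1 n2 n3] /andP[d0 /and3P[d1 d2 d3]] HA.
have nR : 0 < n%:R :> R by rewrite ltr0n.
have nm : 0 < n%:R ^+ m :> R by rewrite exprn_gt0.
have ni : 0 < n%:R^-1 :> R by rewrite invr_gt0.
have nn : n%:R^-1 * n%:R = 1 :> R by rewrite mulVf ?gt_eqF.
pose u := C * (delta + n%:R^-1) + n%:R^-1.
have u0 : 0 <= u by rewrite addr_ge0 ?mulr_ge0 ?addr_ge0 // ltW.
have uW r' : n%:R^-1 < r' -> delta < r' -> u <= (2 * C + 1) * r'.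
  move=> a b; have : C * (delta + n%:R^-1) <= C * (2 * r') by apply: ler_wpM2l => //; lra.
  by rewrite /u; lra.
have u1 : u <= 1 / 2 by apply: le_trans hr1; exact: uW.
have u2 : lam * (m%:R * u) <= e / 2.
  apply: le_trans hr2; rewrite mulrA -[leRHS]mulrA; apply: ler_wpM2l; last exact: uW.
  by rewrite mulr_ge0.
have nK : K.+1%:R <= n%:R / 2 :> R.
  have : K.+1%:R * n%:R^-1 <= 1 / 2 :> R.
    by apply: le_trans hr3; apply: ler_wpM2l => //; exact: ltW.
  by rewrite ler_pdivrMr //; lra.
pose y := n%:R - C * (delta * n%:R + 1).
have yE : y = (1 - u + n%:R^-1) * n%:R.
  have -> : (1 - u + n%:R^-1) * n%:R = n%:R - C * (delta * n%:R + n%:R^-1 * n%:R).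
    by rewrite /u; ring.
  by rewrite nn.
have y0 : 0 <= y by rewrite yE mulr_ge0 //; lra.
have /andP[k1 k2] := truncn_itv y0; set k := Num.trunc y in k1 k2.
have k3 : (1 - u) * n%:R <= k%:R.
  have : (1 - u) * n%:R = y - 1 by rewrite yE !mulrDl nn; ring.
  by move: k2; rewrite -natr1; lra.
have Kk : (K <= k)%N.
  rewrite -ltnS -(ltr_nat R); apply: le_lt_trans k2.
  have : 1 / 2 * n%:R <= y by rewrite yE; apply: ler_wpM2r => //; lra.
  by move: nK; rewrite -natr1; lra.
have kn : k%:R <= n%:R :> R.
  by apply: le_trans k1 _; rewrite /y gerBl mulr_ge0 // addr_ge0 // mulr_ge0.
have zk : z k <= A by apply: HA; move: k1; rewrite /y; lra.
have := HK k Kk; rewrite ler_norml => /andP[h _].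
have h1 : k%:R ^+ m <= n%:R ^+ m :> R by apply: lerXn2r; rewrite ?nnegrE.
have h2 : (1 - m%:R * u) * n%:R ^+ m <= k%:R ^+ m.
  apply: (@le_trans _ _ ((1 - u) ^+ m * n%:R ^+ m)).
    by apply: ler_wpM2r; [exact: ltW|apply: expr1B_ge; lra].
  rewrite -exprMn; apply: lerXn2r => //; rewrite nnegrE ?mulr_ge0 //; lra.
have h3 := ler_wpM2l lam0 h2.
have h4 : e / 2 * k%:R ^+ m <= e / 2 * n%:R ^+ m by apply: ler_wpM2l => //; lra.
have h5 := ler_wpM2r (ltW nm) u2.
by lra.
Qed.

Lemma compare_upper (C e : R) : 0 <= C -> 0 < e -> exists2 r : R, 0 < r &
  forall (n : nat) (delta A : R), (0 < n)%N -> n%:R^-1 < r -> 0 <= delta < r ->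
  (forall k : nat, n%:R + C * (delta * n%:R + 1) <= k%:R -> A <= z k) ->
  A <= lam * n%:R ^+ m + e * n%:R ^+ m.
Proof.
move=> C0 e0; have [K HK] := zlim (e := e / 2) ltac:(lra).
have p2 : 1 <= 2 ^+ m :> R by apply: exprn_ege1; lra.
have le0 : 0 <= lam + e / 2 by apply: addr_ge0 => //; lra.
have [r1 r10 hr1] := @small_radius 1 (2 * C + 1) ltac:(lra) ltac:(lra).
have [r2 r20 hr2] := @small_radius (e / 2) ((lam + e / 2) * 2 ^+ m * (2 * C + 1)) ltac:(lra)
  ltac:(by rewrite !mulr_ge0 ?exprn_ge0 //; lra).
have [r3 r30 hr3] := @small_radius 1 K.+1%:R ltac:(lra) ltac:(by []).
exists (Num.min r1 (Num.min r2 r3)); first by rewrite !lt_min r10 r20 r30.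
move=> n delta A n0; rewrite !lt_min => /and3P[n1 n2 n3] /andP[d0 /and3P[d1 d2 d3]] HA.
have nR : 0 < n%:R :> R by rewrite ltr0n.
have nm : 0 < n%:R ^+ m :> R by rewrite exprn_gt0.
have ni : 0 < n%:R^-1 :> R by rewrite invr_gt0.
have nn : n%:R^-1 * n%:R = 1 :> R by rewrite mulVf ?gt_eqF.
pose u := C * (delta + n%:R^-1) + n%:R^-1.
have u0 : 0 <= u by rewrite addr_ge0 ?mulr_ge0 ?addr_ge0 // ltW.
have uW r' : n%:R^-1 < r' -> delta < r' -> u <= (2 * C + 1) * r'.
  move=> a b; have : C * (delta + n%:R^-1) <= C * (2 * r') by apply: ler_wpM2l => //; lra.
  by rewrite /u; lra.
have u1 : u <= 1 by apply: le_trans hr1; exact: uW.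
have u2 : (lam + e / 2) * (2 ^+ m * u) <= e / 2.
  apply: le_trans hr2; rewrite mulrA -[leRHS]mulrA; apply: ler_wpM2l; last exact: uW.
  by rewrite mulr_ge0 ?exprn_ge0 //; lra.
have nK : K.+1%:R <= n%:R :> R.
  have : K.+1%:R * n%:R^-1 <= 1 :> R.
    by apply: le_trans hr3; apply: ler_wpM2l => //; exact: ltW.
  by rewrite ler_pdivrMr //; lra.
pose y := n%:R + C * (delta * n%:R + 1).
have yE : y + 1 = (1 + u) * n%:R.
  have -> : (1 + u) * n%:R = n%:R + C * (delta * n%:R + n%:R^-1 * n%:R) + n%:R^-1 * n%:R.
    by rewrite /u; ring.
  by rewrite nn.
have y0 : 0 <= y by rewrite addr_ge0 // mulr_ge0 // addr_ge0 // mulr_ge0.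
have /andP[k1 k2] := truncn_itv y0; set k := (Num.trunc y).+1 in k2.
have k3 : k%:R <= (1 + u) * n%:R by rewrite -yE -natr1 lerD2r.
have kn : n%:R <= k%:R :> R.
  by apply: ltW; apply: le_lt_trans k2; rewrite lerDl mulr_ge0 // addr_ge0 // mulr_ge0.
have Kk : (K <= k)%N.
  by rewrite -(ler_nat R); apply: le_trans kn; apply: le_trans nK; rewrite ler_nat.
have zk : A <= z k by apply: HA; exact: ltW.
have := HK k Kk; rewrite ler_norml => /andP[_ h].
have h2 : k%:R ^+ m <= (1 + 2 ^+ m * u) * n%:R ^+ m.
  apply: (@le_trans _ _ ((1 + u) ^+ m * n%:R ^+ m)).
    rewrite -exprMn; apply: lerXn2r => //; rewrite nnegrE ?mulr_ge0 //; lra.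
  apply: ler_wpM2r; first exact: ltW.
  by apply: le_trans (expr1D_le _ _) _; lra.
have h3 := ler_wpM2l (_ : 0 <= lam + e / 2) h2.
have h5 := ler_wpM2r (ltW nm) u2.
have := h3 ltac:(lra).
by lra.
Qed.

(** Here [A] stands for the logarithm of the number of periodic maps and [beta] for the cost of
    fixing a shell, of order [n^(m-1)]. The box of side [n * n + C * n] exceeds [n^m] periods in
    volume only by the factor [(1 + C/n)^m], so dividing by [n^m] loses a vanishing proportion. *)
Lemma paste_upper (C : nat) (D e : R) : 0 < e -> 0 <= D -> exists N, forall n : nat,
  (N <= n)%N -> forall A beta : R, beta <= D * n%:R^-1 * n%:R ^+ m ->
  (n%:R ^+ m * (A - beta) <= z (n * n + C * n)%N) ->
  A <= lam * n%:R ^+ m + e * n%:R ^+ m.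
Proof.
move=> e0 D0; have [K HK] := zlim (e := e / 2) ltac:(lra).
have p2 : 1 <= 2 ^+ m :> R by apply: exprn_ege1; lra.
have le0 : 0 <= lam + e / 2 by apply: addr_ge0 => //; lra.
have [r1 r10 hr1] := @small_radius (e / 2) ((lam + e / 2) * 2 ^+ m * C%:R + D) ltac:(lra)
  ltac:(by rewrite addr_ge0 // !mulr_ge0 ?exprn_ge0 //; lra).
have [K1 HK1] := small_inv r10.
exists (maxn K (maxn C K1)) => n; rewrite !geq_max => /and3P[Kn Cn /HK1[n0 nr]] A beta hb hA.
have nR : 0 < n%:R :> R by rewrite ltr0n.
have nm : 0 < n%:R ^+ m :> R by rewrite exprn_gt0.
have ni : 0 < n%:R^-1 :> R by rewrite invr_gt0.
pose u : R := C%:R / n%:R.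
have u01 : 0 <= u <= 1.
  by rewrite /u divr_ge0 //= ler_pdivrMr // mul1r ler_nat.
have kE : (n * n + C * n)%:R = (1 + u) * n%:R * n%:R :> R.
  by rewrite natrD !natrM mulrDl mul1r /u divfK ?gt_eqF // -mulrDl.
have Kk : (K <= n * n + C * n)%N.
  by apply: leq_trans Kn _; apply: leq_trans (leq_addr _ _); rewrite leq_pmulr.
have := HK _ Kk; rewrite ler_norml kE !exprMn => /andP[_ h].
have h2 : (1 + u) ^+ m <= 1 + 2 ^+ m * u by apply: le_trans (expr1D_le _ _) _ => //; lra.
have h3 : z (n * n + C * n)%N <= n%:R ^+ m * ((lam + e / 2) * (1 + 2 ^+ m * u) * n%:R ^+ m).
  apply: (@le_trans _ _ (n%:R ^+ m * ((lam + e / 2) * (1 + u) ^+ m * n%:R ^+ m))); first by lra.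
  apply: ler_wpM2l; first exact: ltW.
  apply: ler_wpM2r; first exact: ltW.
  by apply: ler_wpM2l => //; lra.
have := le_trans hA h3; rewrite ler_pM2l // => h4.
have h5 : ((lam + e / 2) * 2 ^+ m * C%:R + D) * n%:R^-1 <= e / 2.
  apply: le_trans hr1; apply: ler_wpM2l => //.
  by rewrite addr_ge0 // !mulr_ge0 ?exprn_ge0 //; lra.
have := ler_wpM2r (ltW nm) h5; rewrite /u in h4 *; lra.
Qed.

End EpsilonComparison.

(** * Near-linear boundary data on the cube *)

Section BoundaryData.
Variables (R : realType) (m d n : nat).
Local Notation V := 'rV[int]_m.
Local Notation bd := (vertex_boundary (cube m n)).
Variable hb : bd -> tree d.
Hypotheses (m2 : (2 <= m)%N) (n0 : (0 < n)%N).
Implicit Types (x y : V).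

(** The default value off the boundary never enters an edge constraint: every edge from the interior
    ends in the interior or on the boundary. *)
Definition extend_bd x : tree d :=
  if pselect (bd x) is left p then hb (exist _ x (mem_set p)) else tree_root d.

Lemma extend_bdE (y : bd) : extend_bd (val y) = hb y.
Proof.
case: y => y py; rewrite /extend_bd /=; case: pselect => [p|np].
  by congr hb; exact: val_inj.
by case: np; exact: set_mem py.
Qed.

Definition face x (k : 'I_m) := x 0 k = 0 \/ x 0 k = n%:Z - 1.

Lemma bdP x : bd x <-> cube m n x /\ exists k, face x k.
Proof.
split=> [[cx [y ncy /nbrE]]|[cx [k hk]]].
  rewrite l1C => /nbrP[k [e [he yE]]]; split=> //; exists k; have xk := cx k.
  have nk : ~ (0 <= x 0 k + e < n%:Z).
    move=> yk; apply: ncy => j; rewrite yE updE; case: eqP => [_|_] //; exact: cx.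
  by rewrite /face; lia.
split=> //; pose e : int := if x 0 k == 0 then -1 else 1.
exists (upd x k (x 0 k + e)).
  move=> /(_ k); rewrite updE eqxx /e; case: hk => ->; first by rewrite eqxx; lia.
  by case: eqP => //; lia.
apply/nbrE; have := l1_upd x x k (x 0 k + e); rewrite l1_refl /e.
by case: eqP => _; lia.
Qed.

Lemma bd_toward x y i k : bd x -> bd y -> face x i -> i != k -> x 0 k != y 0 k ->
  bd (toward x y k) /\ face (toward x y k) i.
Proof.
move=> /bdP[cx _] /bdP[cy _] fi ik xyk.
have fi' : face (toward x y k) i by rewrite /face toward_other.
split=> //; apply/bdP; split; last by exists i.
by move=> j; have := cx j; have := cy j; have := toward_between j xyk; lia.
Qed.

Lemma bd0 : bd 0.
Proof.
apply/bdP; split; first by move=> k; rewrite entry0; lia.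
by exists (Ordinal (ltnW m2)); left; rewrite entry0.
Qed.

(** Any coordinate other than that of the face can be moved towards 0 within the face. If only the
    face coordinate is nonzero, [2 <= m] provides another one, equal to 0, and the vertex lies on
    that face as well. *)
Lemma bd_parent x : bd x -> x != 0 ->
  exists2 k, x 0 k != (0 : V) 0 k & bd (toward x 0 k).
Proof.
move=> bx x0; have [cx [i fi]] := (bdP x).1 bx.
have [[k ik xk]|nk] := pselect (exists2 k, i != k & x 0 k != 0).
  by exists k; [rewrite entry0|apply: (bd_toward bx bd0 fi ik _).1; rewrite entry0].
have [k xk] := l1_neq x0.
have ik : i = k.
  by apply: contrapT => /eqP ik; apply: nk; exists k => //; rewrite -[X in _ != X](entry0 k).
subst k; exists i => //.
have [j ji] : exists j : 'I_m, j != i.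
  have [i0|i0] := eqVneq i (Ordinal (ltnW m2)).
    by exists (Ordinal m2); rewrite i0.
  by exists (Ordinal (ltnW m2)); rewrite eq_sym.
have fj : face x j.
  left; apply: contrapT => /eqP xj; apply: nk; exists j => //; by rewrite eq_sym.
exact: (bd_toward bx bd0 fj ji xk).1.
Qed.

Variable f : V -> tree d.
Hypothesis ef : forall x y, bd x -> bd y -> l1 x y = 1%N -> edge f x y.

Lemma bd_par x : bd x -> par (f x) = par (f 0) (+) vpar x.
Proof.
move e : (l1 x 0) => N; elim: N x e => [|N IH] x e bx.
  by move/l1_eq0: e => ->; rewrite /vpar l1_refl addbF.
have x0 : x != 0 by apply/eqP => /l1_eq0; rewrite e.
have [k xk bk] := bd_parent bx x0; have [e1 e2] := l1_toward xk.
have := IH (toward x 0 k) ltac:(lia) bk; have := td_adj_par (ef bx bk e1).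
have := l1_par x (toward x 0 k); rewrite e1 /= => + -> /eqP.
by case: vpar; case: vpar; case: par; case: par.
Qed.

(** Boundary data are homomorphisms only along the boundary. Two boundary vertices can be brought
    closer inside a face unless they differ in one coordinate alone and lie on the two opposite
    faces normal to it; such pairs are at distance [n - 1] and are left to the hypothesis. *)
Lemma bd_td x y : (forall x y, bd x -> bd y -> (n.-1 <= l1 x y)%N -> (td (f x) (f y) <= l1 x y)%N) ->
  bd x -> bd y -> (td (f x) (f y) <= l1 x y)%N.
Proof.
move=> opp; move e : (l1 x y) => N; elim: N x y e => [|N IH] x y e bx by_.
  by move/l1_eq0: e => ->; rewrite td_refl.
have H u v k : bd u -> bd v -> l1 u v = N.+1 -> u 0 k != v 0 k -> bd (toward u v k) ->
    (td (f u) (f v) <= N.+1)%N.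
  move=> bu bv uv uvk bt; have [e1 e2] := l1_toward uvk.
  have := IH (toward u v k) v ltac:(lia) bt bv; have := ef bu bt e1; rewrite /edge.
  by have := td_tri (f u) (f (toward u v k)) (f v); lia.
have [cx [i fi]] := (bdP x).1 bx; have [cy [j fj]] := (bdP y).1 by_.
have [[k ik xk]|nk] := pselect (exists2 k, i != k & x 0 k != y 0 k).
  exact: H xk (bd_toward bx by_ fi ik xk).1.
have [[k jk yk]|nk'] := pselect (exists2 k, j != k & y 0 k != x 0 k).
  by rewrite tdC; apply: (H y x k) => //; [rewrite l1C|exact: (bd_toward by_ bx fj jk yk).1].
have [k xyk] : exists k, x 0 k != y 0 k by apply: l1_neq; apply/eqP => /l1_eq0; rewrite e.
have ik : i = k by apply: contrapT => /eqP ik; apply: nk; exists k.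
have jk : j = k by apply: contrapT => /eqP jk; apply: nk'; exists k => //; rewrite eq_sym.
subst i j; rewrite -e; apply: opp => //.
apply: leq_trans (l1_coord x y k); move: xyk fi fj; rewrite /face; lia.
Qed.

Lemma obd_cube x : obd (box 0 n.-1) x -> bd x.
Proof.
move=> /obd_box[cx [k fk]]; apply/bdP; split.
  by move=> j; have := cx j; rewrite entry0; lia.
by exists k; move: fk; rewrite /face entry0; lia.
Qed.

Lemma cube_box x : cube m n x -> box 0 n.-1 x \/ bd x.
Proof.
move=> cx; have [[k fk]|nf] := pselect (exists k, face x k).
  by right; apply/bdP; split=> //; exists k.
left=> k; have nk : ~ face x k by move=> fk; apply: nf; exists k.
by have := cx k; move: nk; rewrite /face entry0; lia.
Qed.

Lemma bd_nbox x : bd x -> ~ box 0 n.-1 x.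
Proof.
by move=> /bdP[cx [k]] fk /(_ k); rewrite entry0; move: fk; rewrite /face; lia.
Qed.

Lemma box_cube x : box 0 n.-1 x -> cube m n x.
Proof. by move=> bx k; have := bx k; rewrite entry0; lia. Qed.

Lemma graph_hom_bd : graph_hom (@sub_nbr m bd) hb ->
  forall x y, bd x -> bd y -> l1 x y = 1%N -> edge extend_bd x y.
Proof.
move=> hh x y bx by_ /nbrE xy.
have := hh (exist _ x (mem_set bx)) (exist _ y (mem_set by_)) xy.
by rewrite tree_distE -!extend_bdE.
Qed.

(** The interior of the cube has coordinates from 1 to [n - 2], hence is [box 0 n.-1]. Edges inside
    the boundary are outside the scope of [fill] and are supplied by the hypothesis on [hb]. *)
Lemma ncard_extensions : graph_hom (@sub_nbr m bd) hb ->
  finite_set (extensions hb) /\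
  ncard (extensions hb) = ncard (fill (box 0 n.-1) extend_bd).
Proof.
move=> hh; have ehb := graph_hom_bd hh.
have fin : finite_set (fill (box 0 n.-1) extend_bd).
  exact: (fill_box_fin (Ordinal (ltnW m2)) _ (a := 0) (n := n.-1) _).1.
pose C := cube m n.
pose up (h : C -> tree d) x := if pselect (C x) is left p then h (exist _ x (mem_set p))
  else extend_bd x.
have upE h (x : C) : up h (val x) = h x.
  case: x => x px; rewrite /up /=; case: pselect => [p|np]; first by congr h; exact: val_inj.
  by case: np; exact: set_mem px.
have upF (h : C -> tree d) : extensions hb h -> fill (box 0 n.-1) extend_bd (up h).
  move=> [hom_h hbE]; split=> [x nx|x y bx xy].
    rewrite /up; case: pselect => // p; have [//|bx] := cube_box p.
    have := hbE (exist _ x (mem_set p)) (exist _ x (mem_set bx)) erefl.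
    by rewrite -extend_bdE.
  have cx := box_cube bx.
  have cy : C y.
    have [[cy _]|nby] := pselect (bd y); first by [].
    have [/box_cube//|ny] := pselect (box 0 n.-1 y).
    by case: nby; apply: obd_cube; split=> //; exists x.
  have := hom_h (exist _ x (mem_set cx)) (exist _ y (mem_set cy)) ((nbrE _ _).2 xy).
  by rewrite tree_distE -!upE.
have up_inj (h h' : C -> tree d) : up h = up h' -> h = h'.
  by move=> e; apply/funext => x; rewrite -!upE e.
pose down (h : V -> tree d) : C -> tree d := fun c => h (val c).
have downF h : fill (box 0 n.-1) extend_bd h -> extensions hb (down h).
  move=> [hf hD]; split=> [x y xy|x y xy].
    rewrite tree_distE /down; move/nbrE: xy => xy.
    have [bx|bx] := cube_box (set_mem (valP x)); first exact: hD.
    have [by_|by_] := cube_box (set_mem (valP y)); first by apply: edgeC; apply: hD => //; rewrite l1C.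
    by rewrite !hf; [exact: ehb|exact: bd_nbox|exact: bd_nbox].
  by rewrite /down xy hf ?extend_bdE //; exact: bd_nbox (set_mem (valP y)).
have [fe le] := ncard_inj (f := up) fin upF (fun h h' _ _ => @up_inj h h').
split=> //; apply/eqP; rewrite eqn_leq le /=.
apply: (ncard_inj (f := down) fe downF _).2.
move=> h h' [hf _] [hf' _] e; apply/funext => x.
have [cx|ncx] := pselect (C x); first exact: (congr1 (fun k => k (exist _ x (mem_set cx))) e).
by rewrite hf ?hf' // => /box_cube.
Qed.

End BoundaryData.

Section EntropyFormulas.
Variable R : realType.

Lemma lne_counting (T : choiceType) (X : set T) x : finite_set X -> X x ->
  lne (counting X : \bar R) = (ln (ncard X)%:R)%:E.
Proof.
move=> fX Xx; rewrite /counting asboolT // lne_EFin //.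
by rewrite ltr0n; exact: ncard_gt0 Xx.
Qed.

Lemma cube_hbox m n : cube m n = hbox 0 n.
Proof.
by apply/seteqP; split=> x H k; have := H k; rewrite entry0 add0r.
Qed.

Lemma EntE m d n (hb : vertex_boundary (cube m n) -> tree d) h : finite_set (extensions hb) ->
  extensions hb h ->
  Ent R hb = (- ((n ^ m)%:R^-1 * ln (ncard (extensions hb))%:R))%:E.
Proof.
move=> fe eh; have cE : #|` fset_set (cube m n)| = (n ^ m)%N.
  by rewrite cube_hbox -(hbox_card (0 : 'rV[int]_m) n).2.
by rewrite /Ent (lne_counting fe eh) cE EFinN EFinM.
Qed.

Lemma entE m d n g (s : 'rV[R]_m) h : finite_set (Hset n g s) ->
  @Hset R m d n g s h ->
  ent n g s = (- ((n ^ m)%:R^-1 * ln (ncard (Hset n g s))%:R))%:E.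
Proof.
by move=> fe eh; rewrite /ent (lne_counting fe eh) EFinN EFinM.
Qed.

End EntropyFormulas.

(** * Periods of translation invariant maps *)

Section Periods.
Variables m d : nat.
Local Notation V := 'rV[int]_m.
Implicit Types (x y z : V) (h : V -> tree d) (t : tree d).

Definition tree_hom h := forall x y, l1 x y = 1%N -> edge h x y.

Lemma l1_add2r x y z : l1 (x + z) (y + z) = l1 x y.
Proof. by apply: eq_bigr => k _; rewrite !mxE; congr absz; ring. Qed.

(** Equal colours mean equal left multipliers along corresponding edges, so the right quotient of
    [h (x + n e_k)] by [h x] is unchanged by a lattice step. *)
Lemma period_exists h n (k : 'I_m) : tree_hom h -> translation_invariant n h ->
  exists t, forall x, h (x + basis_vec k *+ n) = tmul (h x) t.
Proof.
move=> eh th; have [u [hu uh]] := exists_inv (h 0).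
exists (tmul u (h (0 + basis_vec k *+ n))).
apply: (@lattice_ind m (fun x => h (x + basis_vec k *+ n) =
  tmul (h x) (tmul u (h (0 + basis_vec k *+ n)))) 0) => [|x y xy IH].
  by rewrite -tmulA hu tmul1t.
have /td1P[i hy] : edge h x y by exact: eh.
have /td1P[j hy'] : edge h (x + basis_vec k *+ n) (y + basis_vec k *+ n).
  by apply: eh; rewrite l1_add2r.
have := th x y k ((nbrE _ _).2 xy); rewrite /dual (colourE hy) (colourE hy') => -[ij].
by rewrite hy' -ij IH -tmul_gen -hy.
Qed.

(* A path in the tree cannot jump over a vertex of the geodesic. *)
Lemma hom_crosses h x y (v : tree d) : tree_hom h -> td (h x) v = 1%N ->
  (td v (h y)).+1 = td (h x) (h y) -> exists z, h z = v.
Proof.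
move=> eh xv vy; apply: contrapT => nz.
have P z : td (h z) v = (td (h z) (h x)).+1.
  apply: (@lattice_ind m (fun z => td (h z) v = (td (h z) (h x)).+1) x) => [|a b ab Pa].
    by rewrite td_refl xv.
  have eab : td (h a) (h b) = 1%N by exact: eh.
  have bv : td (h b) v <> 0%N by move/td0P => e; apply: nz; exists b.
  have := td_par (h b) v; have := td_par (h b) (h x).
  rewrite (td_adj_par xv) => p1 p2.
  have := td_tri (h b) (h x) v; have := td_tri (h b) v (h x).
  have := td_tri (h b) (h a) (h x); have := td_tri (h a) (h b) v.
  have := td_four (h a) v (h b) (h x).
  rewrite (tdC v (h x)) (tdC (h b) (h a)) (tdC v (h b)) xv eab Pa.
  have : td (h b) v <> td (h b) (h x).
    by move=> e; move: p2; rewrite e p1; case: par; case: par.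
  by lia.
have := P y; rewrite tdC; have := tdC (h x) (h y); lia.
Qed.

Section Axis.
Variables (h : V -> tree d) (sh : V -> V) (t : tree d) (N : nat).
Hypotheses (eh : tree_hom h) (ht : forall x, h (sh x) = tmul (h x) t).
Hypothesis Nmin : forall x, (N <= td (h x) (tmul (h x) t))%N.
Hypothesis N2 : (2 <= N)%N.

(** If the path from [w0] through [w1] to [w2] backtracked at [w1], it would do so along an edge
    from [w1] to some [v]. The translate [v0] of [v] by the inverse of [t] then follows [w0] on the
    geodesic to [w1], so [h] takes the value [v0], and [t] moves [v0] by [N - 2], against
    minimality. *)
Lemma no_backtrack x : td (h x) (tmul (h x) t) = N ->
  td (h x) (tmul (tmul (h x) t) t) = N.*2.
Proof.
set w0 := h x; set w1 := tmul w0 t; set w2 := tmul w1 t => e01.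
have e12 : td w1 w2 = N by rewrite /w2 {1}/w1 td_tmul.
have le2 := td_tri w0 w1 w2.
apply/eqP; rewrite eqn_leq; apply/andP; split; first by lia.
rewrite leqNgt; apply/negP => lt2.
have [v [w1v vw2]] : exists v, td w1 v = 1%N /\ (td v w2 + 1 = td w1 w2)%N.
  by apply: td_between; lia.
have w0v : (td w0 v).+1 = N.
  have := td_four w0 v w1 w2; have := td_tri w0 v w1; have := td_tri w0 w1 v.
  have := td_par w0 v; rewrite (td_adj_par w1v); have := td_par w0 w1.
  rewrite (tdC v w1) e01 e12 w1v => p1 p2.
  have : td w0 v <> N by move=> e; move: p2; rewrite e p1; case: par; case: par.
  by lia.
have [t' [tt' t't]] := exists_inv t.
have v0v : tmul (tmul v t') t = v by rewrite tmulA t't tmult1.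
set v0 := tmul v t' in v0v.
have w0v0 : td w0 v0 = 1%N by rewrite -(td_tmul _ _ t) v0v.
have v0w1 : (td v0 w1).+1 = td w0 w1.
  by rewrite -(td_tmul v0 w1 t) v0v -/w2; lia.
have [y hy] : exists y, h y = v0.
  by apply: (hom_crosses (x := x) (y := sh x) eh w0v0); rewrite ht.
have := Nmin y; rewrite hy v0v.
have := td_four v0 v w0 w1; rewrite (tdC v0 w0) (tdC v w1) (tdC v w0); lia.
Qed.

Variables (X : int -> V).
Hypotheses (XS : forall i : int, X (i + 1) = sh (X i)) (X0 : td (h (X 0)) (tmul (h (X 0)) t) = N).

Let w i := h (X i).

Let wS i : w (i + 1) = tmul (w i) t.
Proof. by rewrite /w XS ht. Qed.

Let disp i : td (w i) (tmul (w i) t) = N.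
Proof.
suff H (a : nat) : td (w a) (tmul (w a) t) = N /\ td (w (- a%:Z)) (tmul (w (- a%:Z)) t) = N.
  have [ge|lt] := lerP 0 i.
    by have [] := H (absz i); rewrite (_ : Posz (absz i) = i) //; lia.
  by have [_] := H (absz i); rewrite (_ : - Posz (absz i) = i) //; lia.
elim: a => [|a [IH1 IH2]]; first by rewrite oppr0.
split.
  by rewrite (_ : Posz a.+1 = Posz a + 1) ?wS ?td_tmul //; lia.
move: IH2; rewrite (_ : - Posz a = - Posz a.+1 + 1); last by lia.
by rewrite wS td_tmul.
Qed.

Let orbit_tdn i (n : nat) : td (w i) (w (i + n%:Z)) = (n * N)%N.
Proof.
elim/ltn_ind: n => -[_|[_|n IH]]; first by rewrite addr0 td_refl.
  by rewrite wS disp mul1n.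
have e1 := IH n.+1 ltac:(lia); have e0 := IH n ltac:(lia).
have d1 := disp (i + n%:Z); have d2 := disp (i + n.+1%:Z).
have d3 := no_backtrack d1.
have E1 : w (i + n.+1%:Z) = tmul (w (i + n%:Z)) t by rewrite -wS; congr w; lia.
have E2 : w (i + n.+2%:Z) = tmul (w (i + n.+1%:Z)) t by rewrite -wS; congr w; lia.
rewrite -/(w _) -E1 -E2 in d1 d2 d3.
have := td_four (w i) (w (i + n.+1%:Z)) (w (i + n%:Z)) (w (i + n.+2%:Z)).
have := td_tri (w i) (w (i + n.+1%:Z)) (w (i + n.+2%:Z)).
rewrite (tdC (w (i + n.+1%:Z)) (w (i + n%:Z))) e1 e0 d1 d2 d3 !mulSn; lia.
Qed.

Variables (g : int -> tree d) (B : nat).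
Hypotheses (gg : geo g) (hB : forall x, exists j, (td (h x) (g j) <= B)%N).

(** A geodesic segment whose ends are within [B] of [g] coincides with [g] at distance more than [B]
    from its ends. *)
Lemma geo_nearby p q v (a b : int) : (td p v + td v q = td p q)%N ->
  (td p (g a) <= B)%N -> (td q (g b) <= B)%N -> (B < td p v)%N -> (B < td v q)%N ->
  exists j, v = g j.
Proof.
move=> pvq pa qb Bp Bq.
have e1 : (td (g a) v + td v q = td (g a) q)%N.
  have := td_tri (g a) v q; have := td_four (g a) v p q; rewrite (tdC (g a) p) (tdC v p); lia.
have e2 : (td (g a) v + td v (g b) = td (g a) (g b))%N.
  have := td_tri (g a) v (g b); have := td_four v (g b) (g a) q.
  by rewrite (tdC v (g a)) (tdC (g b) q) (tdC (g b) (g a)); lia.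
pose j := if a <= b then a + (td (g a) v)%:Z else a - (td (g a) v)%:Z.
exists j; apply: (td_between_uniq (p := g a) (q := g b)) => //; rewrite !geo_td //.
  by move: e2; rewrite geo_td // /j; case: ifP; lia.
by move: e2; rewrite geo_td // /j; case: ifP; lia.
Qed.

Let on_axis i : exists c, w i = g c.
Proof.
(* Going [B + 1] steps along the orbit, each of length [N >= 1], leaves the ball of radius [B] on
   either side. *)
pose M : int := B.+1%:Z.
have [a pa] := hB (X (i - M)); have [b qb] := hB (X (i + M)).
have e1 := orbit_tdn (i - M) B.+1; have e2 := orbit_tdn i B.+1.
have e3 := orbit_tdn (i - M) (B.+1 + B.+1)%N.
rewrite (_ : i - M + B.+1%:Z = i) in e1; last by rewrite /M; lia.
rewrite (_ : i - M + (B.+1 + B.+1)%N%:Z = i + M) in e3; last by rewrite /M; lia.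
have BN : (B < B.+1 * N)%N by rewrite (leq_trans (leqnn _)) // leq_pmulr //; lia.
apply: (geo_nearby (p := w (i - M)) (q := w (i + M)) _ pa qb).
- by rewrite e1 e2 e3 mulnDl.
- by rewrite e1.
- by rewrite e2.
Qed.

(** The orbit of a minimiser lies on [g] at positions in arithmetic progression. Any vertex of [g]
    lies between two orbit points and is determined by its distances to them, so it is shifted by
    the same [dl]. *)
Lemma axis_translation : exists2 dl : int, absz dl = N & forall j, tmul (g j) t = g (j + dl).
Proof.
have [c wc] := choice on_axis.
have cd i j : absz (c i - c j)%R = (absz (i - j)%R * N)%N.
  rewrite -(geo_td (c i) (c j) gg) -!wc.
  have [ij|ij] := lerP i j.
    have := orbit_tdn i (absz (i - j)%R); rewrite (_ : i + _ = j) //; lia.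
  rewrite tdC; have := orbit_tdn j (absz (i - j)%R); rewrite (_ : j + _ = i) //; lia.
pose dl : int := c 1 - c 0.
have adl : absz dl = N by rewrite /dl cd mul1n.
(* Two successive jumps of length [N] whose sum has length [2N] point in the same direction. *)
have step (i : int) : c (i + 2) - c (i + 1) = c (i + 1) - c i.
  have := cd (i + 2) i; have := cd (i + 2) (i + 1); have := cd (i + 1) i.
  rewrite (_ : i + 2 - i = 2); last by ring.
  rewrite (_ : i + 2 - (i + 1) = 1); last by ring.
  rewrite (_ : i + 1 - i = 1); last by ring.
  by rewrite !mul1n; have := N2; lia.
have stepE (i : int) : c (i + 1) - c i = dl.
  suff H (a : nat) : c (a%:Z + 1) - c a%:Z = dl /\ c (- a%:Z + 1) - c (- a%:Z) = dl.
    have [ge|lt] := lerP 0 i.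
      by have [] := H (absz i); rewrite (_ : Posz (absz i) = i) //; lia.
    by have [_] := H (absz i); rewrite (_ : - Posz (absz i) = i) //; lia.
  elim: a => [|a [IH1 IH2]]; first by rewrite oppr0 add0r.
  split.
    rewrite -IH1 -(step a%:Z); congr (c _ - c _); lia.
  rewrite -IH2; have := step (- a.+1%:Z).
  rewrite (_ : - Posz a.+1 + 2 = - Posz a + 1); last by lia.
  by rewrite (_ : - Posz a.+1 + 1 = - Posz a); last by lia.
have cE (a : nat) : c a%:Z = c 0 + dl * a%:Z /\ c (- a%:Z) = c 0 - dl * a%:Z.
  elim: a => [|a [IH1 IH2]]; first by rewrite !(oppr0, mulr0, addr0).
  have s1 := stepE a%:Z; have s2 := stepE (- a.+1%:Z).
  rewrite (_ : a%:Z + 1 = a.+1%:Z) in s1; last by lia.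
  rewrite (_ : - Posz a.+1 + 1 = - Posz a) in s2; last by lia.
  by rewrite (_ : Posz a.+1 = Posz a + 1) in s1 s2 *; [split; lia|lia].
exists dl => // j.
pose A := absz (j - c 0)%R.
have [cA cA'] := cE A.
have big : (A <= absz (dl * A%:Z)%R)%N by rewrite abszM adl leq_pmull //; have := N2; lia.
have gdl (i : int) : tmul (g (c i)) t = g (c i + dl).
  by rewrite -wc -wS wc -(stepE i); congr g; ring.
have p := gdl (- A%:Z); have q := gdl A%:Z; rewrite cA' in p; rewrite cA in q.
clear cA cA'; move: big p q; move: (dl * A%:Z) => D.
rewrite {}/A; move: (c 0) D => a D big p q.
rewrite -[D]/(D : int) in big p q *.
apply/esym; apply: (td_between_uniq (p := g (a - D + dl)) (q := g (a + D + dl))).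
- by rewrite !geo_td //; lia.
- by rewrite -{1}p td_tmul !geo_td //; lia.
- by rewrite -{1}q td_tmul !geo_td //; lia.
Qed.

End Axis.

Lemma tmul_fixed (u t : tree d) : tmul u t = u -> t = tree_root d.
Proof.
move=> e; have [v [_ vu]] := exists_inv u.
by rewrite -(tmul1t t) -vu tmulA e.
Qed.

(* [N = 1] is excluded: there [t] could be an inversion. *)
Lemma period_translation h n (k : 'I_m) t N (g : int -> tree d) B : tree_hom h -> geo g ->
  (forall x, h (x + basis_vec k *+ n) = tmul (h x) t) ->
  infimum 0%N (range (fun x => td (h x) (h (x + basis_vec k *+ n)))) = N ->
  N != 1%N -> (forall x, exists j, (td (h x) (g j) <= B)%N) ->
  exists2 dl : int, absz dl = N & forall j, tmul (g j) t = g (j + dl).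
Proof.
move=> eh gg ht infN N1 hB.
have [|[x0 _ ex0] minN] := @infimum_natP (range (fun x => td (h x) (h (x + basis_vec k *+ n)))).
  by exists (td (h 0) (h (0 + basis_vec k *+ n))); exists 0.
rewrite infN in ex0 minN.
have Nmin x : (N <= td (h x) (tmul (h x) t))%N by rewrite -ht; apply: minN; exists x.
have [N0|Npos] := posnP N.
  exists 0 => // j; move: ex0; rewrite N0 ht => /td0P /esym /tmul_fixed ->.
  by rewrite tmult1 addr0.
apply: (axis_translation (sh := fun x => x + basis_vec k *+ n) eh ht Nmin _
  (X := fun i => x0 + (basis_vec k *+ n) *~ i) _ _ gg hB).
- by lia.
- by move=> i; rewrite mulrzDr mulr1z addrA.
- by rewrite mulr0z addr0 -ht ex0.
Qed.

End Periods.

(** * Periods of a geodesic through the root *)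

Section PeriodGroup.
Variables (d : nat) (g : int -> tree d).
Hypotheses (gg : geo g) (g0 : g 0 = tree_root d).

Definition geo_period (dl : int) := forall j, tmul (g j) (g dl) = g (j + dl).

Lemma translation_period t dl : (forall j, tmul (g j) t = g (j + dl)) ->
  t = g dl /\ geo_period dl.
Proof.
move=> H; have e : t = g dl by rewrite -(tmul1t t) -g0 H add0r.
by split=> // j; rewrite -e.
Qed.

Lemma geo_periodD a b : geo_period a -> geo_period b -> geo_period (a + b).
Proof.
by move=> pa pb j; rewrite -pb -tmulA pa pb addrA.
Qed.

Lemma geo_period0 : geo_period 0.
Proof. by move=> j; rewrite g0 tmult1 addr0. Qed.

Lemma geo_periodN a : geo_period a -> geo_period (- a).
Proof.
move=> pa j; apply: (@tmul_inj _ (g a)).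
by rewrite tmulA !pa !addNr g0 tmult1 addrNK.
Qed.

Lemma geo_periodM a (i : int) : geo_period a -> geo_period (i * a).
Proof.
move=> pa; have H (k : nat) : geo_period (k%:Z * a).
  elim: k => [|k IH]; first by rewrite mul0r; exact: geo_period0.
  by rewrite (_ : k.+1%:Z = k%:Z + 1) ?mulrDl ?mul1r; [exact: geo_periodD|lia].
case: i => k; first exact: H.
by rewrite NegzE mulNr; exact/geo_periodN/H.
Qed.

Lemma geo_period_sum (I : finType) (a b : I -> int) : (forall i, geo_period (a i)) ->
  geo_period (\sum_i b i * a i).
Proof.
move=> pa; apply: (big_ind geo_period) => [|x y|i _]; first exact: geo_period0.
  exact: geo_periodD.
exact: geo_periodM.
Qed.

End PeriodGroup.

Section HsetFacts.
Variables (m d : nat).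
Local Notation V := 'rV[int]_m.

Lemma dist_to_le (g : int -> tree d) w j : (dist_to w g <= td w (g j))%N.
Proof.
have [|_ H] := @infimum_natP (range (fun j => tree_dist w (g j))).
  by exists (tree_dist w (g 0)), 0.
by rewrite -tree_distE; apply: H; exists j.
Qed.

Lemma dist_toP (g : int -> tree d) w : exists j, dist_to w g = td w (g j).
Proof.
have [|[j _ e] _] := @infimum_natP (range (fun j => tree_dist w (g j))).
  by exists (tree_dist w (g 0)), 0.
by exists j; rewrite -tree_distE /dist_to e.
Qed.

Lemma geodesic_proj_on (g : int -> tree d) j : geodesic_proj g (g j) = g j.
Proof.
have d0 : dist_to (g j) g = 0%N.
  by apply/eqP; rewrite -leqn0; have := dist_to_le g (g j) j; rewrite td_refl.
rewrite /geodesic_proj; case: xgetP => [u _ [_]|/(_ (g j))[]].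
  by rewrite d0 tree_distE => /td0P.
by split; [exists j|rewrite tree_distE td_refl d0].
Qed.

(** Under the [j]-th power of the translation [w] moves by at most [j] times its displacement, while
    [g 0] moves by exactly [j * |dl|]; these differ by at most [2 * td w (g 0)], which is exceeded
    for large [j] unless the bound holds. *)
Lemma translation_length (g : int -> tree d) dl w : geo g -> g 0 = tree_root d ->
  geo_period g dl -> (absz dl <= td w (tmul w (g dl)))%N.
Proof.
move=> gg g0 pdl; set T := td w _.
have H (j : nat) : (td w (tmul w (g (j%:Z * dl)%R)) <= j * T)%N.
  elim: j => [|j IH]; first by rewrite mul0r g0 tmult1 td_refl.
  have -> : g (j.+1%:Z * dl)%R = tmul (g dl) (g (j%:Z * dl)%R).
    by rewrite (geo_periodM g0 j pdl dl); congr g; rewrite (_ : j.+1%:Z = 1 + j%:Z) ?mulrDl ?mul1r //; lia.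
  rewrite -tmulA; apply: leq_trans (td_tri _ (tmul w (g (j%:Z * dl)%R)) _) _.
  by rewrite td_tmul mulSn addnC leq_add2l.
rewrite leqNgt; apply/negP => lt.
pose K := (2 * td w (g 0)).+1; have := H K.
have e1 : td (g 0) (tmul (g 0) (g (K%:Z * dl)%R)) = (K * absz dl)%N.
  by rewrite (geo_periodM g0 K pdl 0) geo_td // !add0r abszN abszM.
have := td_tri (g 0) w (tmul (g 0) (g (K%:Z * dl)%R)).
have := td_tri w (tmul w (g (K%:Z * dl)%R)) (tmul (g 0) (g (K%:Z * dl)%R)).
rewrite e1 td_tmul (tdC (g 0) w).
have : (K * T + K <= K * absz dl)%N by rewrite -mulnSr leq_mul2l lt orbT.
by rewrite /K; lia.
Qed.

End HsetFacts.

(** * Periodizing a filling *)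

Section LatticeDivision.
Variables m n : nat.
Local Notation V := 'rV[int]_m.
Implicit Types (x a : V).

Lemma entryMn a k : (a *+ n) 0 k = a 0 k * n%:Z.
Proof. by rewrite mulmxnE -mulr_natr natz. Qed.

Definition modv x : V := \row_k (x 0%R k %% n)%Z.
Definition divv x : V := \row_k (x 0%R k %/ n)%Z.

Lemma modvE x k : modv x 0 k = (x 0%R k %% n)%Z. Proof. by rewrite mxE. Qed.
Lemma divvE x k : divv x 0 k = (x 0%R k %/ n)%Z. Proof. by rewrite mxE. Qed.

Lemma divv_eq x : x = modv x + divv x *+ n.
Proof.
by apply/rowP => k; rewrite entryD entryMn modvE divvE addrC -divz_eq.
Qed.

Lemma modv_itv x k : (0 < n)%N -> 0 <= modv x 0 k < n%:Z.
Proof. by move=> n0; rewrite modvE modz_ge0 ?ltz_pmod //; lia. Qed.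

End LatticeDivision.

Section PeriodicFilling.
Variables (R : realType) (m d n : nat) (s : 'rV[R]_m) (g : int -> tree d) (N : 'I_m -> nat).
Local Notation V := 'rV[int]_m.
Implicit Types (x y u a b : V) (h : V -> tree d).
Hypotheses (k0 : 'I_m) (n0 : (0 < n)%N) (gg : geo g) (g0 : g 0 = tree_root d).
Hypothesis perN : forall k, geo_period g (N k)%:Z.
Hypothesis parN : forall k, odd (N k) = odd n.
Hypothesis floorN : forall k, Num.floor (s 0 k * n%:R) = (N k)%:Z.
Hypothesis s1 : l1norm s < 1.

Definition drift a : int := \sum_k a 0 k * (N k)%:Z.

Lemma driftD a b : drift (a + b) = drift a + drift b.
Proof. by rewrite /drift -big_split; apply: eq_bigr => k _; rewrite /= entryD mulrDl. Qed.

Lemma drift_period a : geo_period g (drift a).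
Proof. exact: geo_period_sum. Qed.

(** The slope that period [n] realises exactly; it is below [s] by less than [1 / n] in each
    coordinate, hence by a total height of at most [m] over one period. *)
Definition rslope : 'rV[R]_m := \row_k ((N k)%:R / n%:R).

Lemma rslope_itv k : rslope 0 k <= s 0 k < rslope 0 k + n%:R^-1.
Proof.
have nR : 0 < n%:R :> R by rewrite ltr0n.
have := floor_itv (s 0 k * n%:R); rewrite floorN mxE rmorphD /= -pmulrn -ler_pdivrMr //.
by rewrite -ltr_pdivlMr // mulrDl mul1r.
Qed.

Lemma rslope_lt1 : l1norm rslope < 1.
Proof.
apply: le_lt_trans s1; apply: ler_sum => k _; have /andP[h _] := rslope_itv k.
have r0 : 0 <= rslope 0 k by rewrite mxE divr_ge0.
by rewrite !ger0_norm //; exact: le_trans h.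
Qed.

(** Rounding commutes with the period because [dot rslope] gains the integer [drift a], and because
    [N k] and [n] have the same parity, so that this gain agrees modulo 2 with the lattice shift;
    [U] is half of the discrepancy. *)
Lemma height_drift x a : height rslope (x + a *+ n) = height rslope x + drift a.
Proof.
pose U := \sum_k a 0 k * (((N k)%:Z - n%:Z) %/ 2)%Z.
have vE : vsum (x + a *+ n) = vsum x + drift a - 2 * U.
  rewrite /vsum /drift /U mulr_sumr -sumrN -!big_split; apply: eq_bigr => k _ /=.
  rewrite entryD entryMn; have := parN k.
  set q := ((_ - _) %/ 2)%Z => pk; have -> : (N k)%:Z = n%:Z + 2 * q by rewrite /q; lia.
  by ring.
have dE : dot rslope (x + a *+ n) = dot rslope x + (drift a)%:~R.
  rewrite /dot /drift rmorph_sum /= -big_split; apply: eq_bigr => k _ /=.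
  rewrite entryD entryMn rmorphD !rmorphM /= mulrDr; congr (_ + _).
  by rewrite mxE -!pmulrn mulrCA divfK // gt_eqF // ltr0n.
have fE : Num.floor ((dot rslope (x + a *+ n) - (vsum (x + a *+ n))%:~R) / 2) =
    Num.floor ((dot rslope x - (vsum x)%:~R) / 2) + U.
  apply: floor_def; have := floor_itv ((dot rslope x - (vsum x)%:~R) / 2).
  by rewrite dE vE !(rmorphD, rmorphN, rmorphM) /=; lra.
by rewrite /height fE vE; ring.
Qed.

Let f := g \o height rslope.

Lemma f_drift x a : f (x + a *+ n) = tmul (f x) (g (drift a)).
Proof. by rewrite /f /= height_drift drift_period. Qed.

Lemma f_hom : tree_hom f.
Proof. by move=> x y; exact: height_hom rslope_lt1 gg _ _. Qed.

Lemma fill_hom D h : tree_hom f -> fill D f h -> tree_hom h.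
Proof.
move=> hf [hE hD] x y xy; have [Dx|nDx] := pselect (D x); first exact: hD.
have [Dy|nDy] := pselect (D y); first by apply: edgeC; apply: hD => //; rewrite l1C.
by rewrite /edge !hE //; exact: hf.
Qed.

Definition periodize h x := tmul (h (modv n x)) (g (drift (divv n x))).

(** The closed cube contains several representatives of the same point. If two of them differ, both
    lie on faces, where [h] equals the affine map [f], and [f] is exactly periodic up to its
    drift. *)
Lemma periodizeE h u a : fill (box 0 n) f h -> (forall k, 0 <= u 0 k <= n%:Z) ->
  periodize h (u + a *+ n) = tmul (h u) (g (drift a)).
Proof.
move=> [hE hD] cu; rewrite /periodize.
set x := u + a *+ n; set u' := modv n x; set a' := divv n x; pose b := a' - a.
have uE : u = u' + b *+ n.
  have := divv_eq n x; rewrite -/u' -/a' {1}/x /b mulrnBl addrA => <-.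
  by rewrite addrK.
have ek k : u 0 k = u' 0 k + b 0 k * n%:Z by rewrite {1}uE entryD entryMn.
have [b0|bn0] := eqVneq b 0.
  have -> : u' = u by rewrite uE b0 mul0rn addr0.
  by have -> : a' = a by apply/eqP; rewrite -subr_eq0 -/b b0.
have [k bk] := l1_neq bn0.
have b1 : b 0 k = 1.
  have := ek k; have := cu k; have := modv_itv x k n0; rewrite -/u'; move: bk; rewrite entry0.
  move: (u 0 k) (u' 0 k) (b 0 k) => p q r rn0 /andP[q0 qn] /andP[p0 pn] e.
  have r0 : 0 <= r.
    rewrite leNgt; apply/negP => r0; have : r * n%:Z <= (-1) * n%:Z by apply: ler_wpM2r; lia.
    by lia.
  have r1 : r <= 1.
    rewrite leNgt; apply/negP => r1; have : 2 * n%:Z <= r * n%:Z by apply: ler_wpM2r; lia.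
    by lia.
  by lia.
have hu : h u = f u.
  apply: hE => /(_ k); rewrite entry0; have := ek k; have := modv_itv x k n0; rewrite -/u' b1; lia.
have hu' : h u' = f u'.
  apply: hE => /(_ k); rewrite entry0; have := ek k; have := cu k; have := modv_itv x k n0.
  by rewrite -/u' b1; lia.
rewrite hu hu' {1}uE f_drift tmulA (drift_period a) -driftD.
by congr (tmul _ (g (drift _))); rewrite /b subrK.
Qed.

Lemma periodize_hom h : fill (box 0 n) f h -> tree_hom (periodize h).
Proof.
move=> Fh; have hh := fill_hom f_hom Fh.
have step x k : edge (periodize h) x (upd x k (x 0 k + 1)).
  have cu j : 0 <= modv n x 0 j <= n%:Z by have := modv_itv x j n0; lia.
  have cu' j : 0 <= upd (modv n x) k (modv n x 0 k + 1) 0 j <= n%:Z.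
    by rewrite updE; case: eqP => [_|_]; [have := modv_itv x k n0|have := modv_itv x j n0]; lia.
  have xE : upd x k (x 0 k + 1) = upd (modv n x) k (modv n x 0 k + 1) + divv n x *+ n.
    apply/rowP => j; rewrite entryD !updE entryMn {1 2}(divv_eq n x) !entryD !entryMn.
    by case: eqP => [->|_] //; ring.
  rewrite /edge xE {1}(divv_eq n x) !periodizeE // td_tmul; apply: hh.
  have := l1_upd (modv n x) (modv n x) k (modv n x 0 k + 1); rewrite l1_refl l1C; lia.
move=> x y /nbrP[k [e [[->|->] ->]]]; first exact: step.
apply: edgeC; set y' := upd _ _ _.
have -> : x = upd y' k (y' 0 k + 1); last exact: step.
by apply/rowP => j; rewrite !updE eqxx; case: eqP => [->|//]; rewrite subrK.
Qed.

Lemma drift_basis k : drift (basis_vec k) = (N k)%:Z.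
Proof.
rewrite /drift (bigD1 k) //= big1 => [|j /negPf jk]; last by rewrite mxE jk andbF mul0r.
by rewrite mxE !eqxx mul1r addr0.
Qed.

Lemma periodize_shift h x k : fill (box 0 n) f h ->
  periodize h (x + basis_vec k *+ n) = tmul (periodize h x) (g (N k)%:Z).
Proof.
move=> Fh; have cu j : 0 <= modv n x 0 j <= n%:Z by have := modv_itv x j n0; lia.
rewrite {1 2}(divv_eq n x) -addrA -mulrnDl !periodizeE // tmulA.
by rewrite driftD drift_basis (perN k).
Qed.

Lemma periodize0 h u : fill (box 0 n) f h -> (forall k, 0 <= u 0 k <= n%:Z) ->
  periodize h u = h u.
Proof.
move=> Fh cu; have := periodizeE 0 Fh cu; rewrite mul0rn addr0 => ->.
by rewrite /drift big1 ?g0 ?tmult1 // => k _; rewrite entry0 mul0r.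
Qed.

Lemma height0 : height rslope 0 = 0.
Proof.
rewrite /height (_ : vsum 0 = 0); last by rewrite /vsum big1 // => k _; rewrite entry0.
rewrite (_ : dot rslope 0 = 0); last by rewrite /dot big1 // => k _; rewrite entry0 mulr0.
by rewrite subr0 mul0r floor0 mulr0 addr0.
Qed.

Lemma periodize_at0 h : fill (box 0 n) f h -> periodize h 0 = g 0.
Proof.
move=> Fh; rewrite periodize0 // => [|k]; last by rewrite entry0; lia.
by rewrite Fh.1 /f /= ?height0 // => /(_ k0); rewrite entry0; lia.
Qed.

(** Moving one coordinate to the nearer of two opposite faces takes at most [n / 2] steps and ends
    where the map takes values on the geodesic. *)
Lemma periodize_near h x : fill (box 0 n) f h ->
  exists j, ((td (periodize h x) (g j)).*2 <= n)%N.
Proof.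
move=> Fh; have hh := fill_hom f_hom Fh.
have cu j : 0 <= modv n x 0 j <= n%:Z by have := modv_itv x j n0; lia.
set u := modv n x in cu.
pose u' := upd u k0 (if 2 * u 0 k0 <= n%:Z then 0 else n%:Z).
have hu' : h u' = g (height rslope u').
  by apply: Fh.1 => /(_ k0); rewrite entry0 updE eqxx; case: ifP; lia.
exists (height rslope u' + drift (divv n x)).
rewrite {1}(divv_eq n x) periodizeE // -drift_period -hu' td_tmul.
have := (hom_lip hh).1 u u' I I; have := l1_upd u u k0 (if 2 * u 0 k0 <= n%:Z then 0 else n%:Z).
rewrite -/u -/u' l1_refl (l1C u u'); have := cu k0; case: ifP; lia.
Qed.

Lemma periodize_Hset h : (0 < m)%N -> fill (box 0 n) f h -> Hset n g s (periodize h).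
Proof.
move=> m0 Fh; split.
- by apply/graph_homE => x y; exact: periodize_hom.
- move=> x y k _; rewrite /dual !periodize_shift //; by rewrite colour_tmul.
- move=> k; rewrite /slope floorN -pmulrn mulrC; congr (_%:R / _).
  apply: infimum_nat.
    exists 0 => //; rewrite tree_distE periodize_shift // periodize_at0 // (perN k) geo_td //.
    by lia.
  move=> _ [x _ <-]; rewrite tree_distE periodize_shift //.
  by have := translation_length (periodize h x) gg g0 (perN k).
- move=> x; have [j] := periodize_near x Fh; have := dist_to_le g (periodize h x) j.
  rewrite -!muln2; have : (n <= m * n)%N by rewrite leq_pmull.
  by lia.
- by rewrite periodize_at0 // geodesic_proj_on tree_distE td_refl.
Qed.

Lemma ncard_Hset_ge : (0 < m)%N -> finite_set (Hset n g s) ->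
  (ncard (fill (box 0 n) f) <= ncard (Hset n g s))%N.
Proof.
move=> m0 fin; apply: (ncard_inj (f := periodize) fin _ _).2.
  by move=> h; exact: periodize_Hset.
move=> h h' Fh Fh' e; apply/funext => x.
have [bx|nbx] := pselect (box 0 n x); last by rewrite Fh.1 ?Fh'.1.
have cx k : 0 <= x 0 k <= n%:Z by have := bx k; rewrite entry0; lia.
by rewrite -(periodize0 Fh cx) -(periodize0 Fh' cx) e.
Qed.

(** The error is 2 for rounding the height plus [m] for replacing [s] by [rslope]. *)
Lemma nearlin_f : nearlin s g 0 (2 + m%:R) f (obd (box 0 n)).
Proof.
move=> x /obd_box[cx _]; exists (height rslope x); rewrite td_refl; split.
  by rewrite addr_ge0.
have := height_itv rslope x; have : `|dot rslope x - dot s x| <= m%:R.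
  rewrite /dot -sumrB; apply: le_trans (ler_norm_sum _ _ _) _.
  have -> : m%:R = \sum_(k < m) 1 :> R by rewrite sumr_const card_ord.
  apply: ler_sum => k _; rewrite -mulrBl normrM.
  have nR : 0 < n%:R :> R by rewrite ltr0n.
  have h1 : `|rslope 0 k - s 0 k| <= n%:R^-1.
    by have := rslope_itv k; rewrite ler_norml; lra.
  have h2 : `|(x 0 k)%:~R| <= n%:R :> R.
    have := cx k; rewrite entry0 add0r -intr_norm => ck.
    have : `|x 0 k| <= n%:Z by lia.
    by rewrite -(ler_int R) -pmulrn.
  apply: (@le_trans _ _ (n%:R^-1 * n%:R)); first exact: ler_pM.
  by rewrite mulVf ?gt_eqF.
by rewrite addr0 !ler_norml; lra.
Qed.

End PeriodicFilling.

(** * Pasting periodic maps *)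

Section HsetPeriods.
Variables (R : realType) (m d n : nat) (s : 'rV[R]_m) (g : int -> tree d).
Local Notation V := 'rV[int]_m.
Implicit Types (x y u a b : V) (h : V -> tree d).
Hypotheses (n0 : (0 < n)%N) (gg : geo g) (g0 : g 0 = tree_root d).

Lemma Hset_infimum h k : Hset n g s h ->
  Num.floor (s 0 k * n%:R) =
    (infimum 0%N (range (fun x => td (h x) (h (x + basis_vec k *+ n)))))%:Z.
Proof.
move=> [_ _ /(_ k) + _ _]; rewrite /slope mulrC.
have nn : n%:R != 0 :> R by rewrite pnatr_eq0; lia.
move=> /(mulIf (invr_neq0 nn)); rewrite pmulrn => /eqP; rewrite eqr_int => /eqP <-.
congr (Posz (infimum _ _)); apply/seteqP; split=> i [x _ <-]; exists x => //.
  by rewrite tree_distE.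
by rewrite tree_distE.
Qed.

Lemma Hset_near h x : Hset n g s h -> exists j, (td (h x) (g j) <= m * n)%N.
Proof.
move=> [_ _ _ /(_ x) + _]; have [j ->] := dist_toP g (h x).
by move=> le; exists j; lia.
Qed.

(** The normalised projection, [g 0] or [g 1], confines [h 0] to a ball; this is what makes the
    counts finite. *)
Lemma Hset_at0 h : Hset n g s h -> (td (h 0%R) (g 0%R) <= m * n + 1)%N.
Proof.
move=> [_ _ _ /(_ 0) le pE].
have : tree_dist (h 0) (geodesic_proj g (h 0)) = dist_to (h 0) g.
  rewrite /geodesic_proj; case: xgetP => [u _ [_ ->] //|nx].
  have [j dj] := dist_toP g (h 0); case: (nx (g j)); split; first by exists j.
  by rewrite tree_distE dj.
rewrite pE tree_distE; have g1 : (td (g 1%R) (g 0%R) = 1)%N by rewrite geo_td.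
by case: ifP => _; have := td_tri (h 0) (g 1) (g 0); rewrite ?g1; lia.
Qed.

Variable N : 'I_m -> nat.
Hypothesis floorN : forall k, Num.floor (s 0 k * n%:R) = (N k)%:Z.
Hypothesis N1 : forall k, N k != 1%N.

(** The slope fixes only the length of the translation; the bit [e] records its direction along
    [g]. *)
Lemma Hset_translation h k : Hset n g s h -> exists e : bool,
  geo_period g (N k)%:Z /\
  forall x, h (x + basis_vec k *+ n) = tmul (h x) (g (if e then - (N k)%:Z else (N k)%:Z)).
Proof.
move=> Hh; have [hh th _ _ _] := Hh; have {}hh := (graph_homE _).1 hh.
have [t ht] := period_exists k hh th.
have infN := Hset_infimum k Hh; rewrite floorN in infN; case: infN => infN.
have [dl adl tdl] := period_translation hh gg ht (esym infN) (N1 k)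
  (fun x => Hset_near x Hh).
have [tE pdl] := translation_period g0 tdl.
have [dE|dE] : dl = (N k)%:Z \/ dl = - (N k)%:Z by lia.
  by exists false; rewrite -dE -tE.
by exists true; rewrite -dE -tE; split=> //; rewrite -(opprK (N k)%:Z) -dE; exact: geo_periodN.
Qed.

End HsetPeriods.

Section PeriodicMaps.
Variables (m d n : nat) (g : int -> tree d) (N : 'I_m -> nat).
Local Notation V := 'rV[int]_m.
Implicit Types (x y u a b : V) (h f : V -> tree d).
Hypotheses (m2 : (2 <= m)%N) (n0 : (0 < n)%N) (gg : geo g) (g0 : g 0 = tree_root d).
Hypothesis perN : forall k, geo_period g (N k)%:Z.

Let k0 : 'I_m := Ordinal (ltnW m2).

Definition periodic_maps : set (V -> tree d) :=
  [set h | [/\ tree_hom h,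
    forall k x, h (x + basis_vec k *+ n) = tmul (h x) (g (N k)%:Z) &
    (td (h 0%R) (g 0%R) <= m * n + 1)%N]].

Lemma periodic_drift h x a : periodic_maps h -> h (x + a *+ n) = tmul (h x) (g (drift N a)).
Proof.
move=> [_ hN _]; have dper := drift_period g0 perN.
apply: (@lattice_ind m (fun a => h (x + a *+ n) = tmul (h x) (g (drift N a))) 0).
  rewrite mul0rn addr0 (_ : drift N 0 = 0) ?g0 ?tmult1 //.
  by rewrite /drift big1 // => k _; rewrite entry0 mul0r.
have updB (b : V) k : upd b k (b 0 k + 1) = b + basis_vec k.
  apply/rowP => j; rewrite updE entryD mxE /=; case: eqP => [->|_] //.
  by rewrite addr0.
have stepD b k : h (x + b *+ n) = tmul (h x) (g (drift N b)) <->
    h (x + (b + basis_vec k) *+ n) = tmul (h x) (g (drift N (b + basis_vec k))).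
  rewrite mulrnDl addrA hN driftD drift_basis -(perN k) -tmulA.
  by split=> [->//|/tmul_inj].
move=> b c /nbrP[k [e [[->|->] ->]]]; first by rewrite updB => /(stepD b k).
move=> Hb; apply/(stepD _ k); rewrite -updB !updE eqxx.
rewrite (_ : upd _ _ _ = b) //; apply/rowP => j; rewrite !updE.
by case: eqP => [->|//]; rewrite subrK.
Qed.

(** Side [n + 1] includes both opposite faces of a period, so the shell covers the whole outer
    boundary of [box 0 n]. *)
Local Notation shell := (vertex_boundary (cube m n.+1)).

Lemma finite_shell : finite_set shell.
Proof.
apply: sub_finite_set (hbox_card (0 : V) n.+1).1.
by rewrite -cube_hbox => x [].
Qed.

Lemma modv_cases x : box 0 n (modv n x) \/ shell (modv n x).
Proof.
have [|bx|bx] := @cube_box m n.+1 m2 (ltn0Sn n) (modv n x); [|by left|by right].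
by move=> k; have := modv_itv x k n0; lia.
Qed.

Definition restrict_shell h : V -> tree d := fun x => if `[< shell x >] then h x else tree_root d.

Lemma restrict_shellE h x : shell x -> restrict_shell h x = h x.
Proof. by rewrite /restrict_shell; case: asboolP. Qed.

Lemma ball_card (r : nat) : finite_set [set u : tree d | (td u (g 0%R) <= r)%N] /\
  (ncard [set u : tree d | (td u (g 0%R) <= r)%N] <= d.+1 ^ r)%N.
Proof.
have fT : finite_set [set: {ffun 'I_r -> option 'I_d}] by exact: finite_finset.
have -> : (d.+1 ^ r = ncard [set: {ffun 'I_r -> option 'I_d}])%N.
  by rewrite ncard_setT card_ffun card_option !card_ord.
apply: (ncard_inj (f := fun u : tree d => [ffun i : 'I_r => onth (word u) i])) => //.
have inj (u v : tree d) : (td u (g 0%R) <= r)%N -> (td v (g 0%R) <= r)%N ->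
    [ffun i : 'I_r => onth (word u) i] = [ffun i : 'I_r => onth (word v) i] -> u = v.
  rewrite g0 (tdC u) (tdC v) !td_root => ru rv e; apply: val_inj; apply: eq_from_onth => i.
  have [ir|ri] := ltnP i r; last by rewrite !onth_default ?(leq_trans ru ri) ?(leq_trans rv ri).
  by have := congr1 (fun F : {ffun 'I_r -> option 'I_d} => F (Ordinal ir)) e; rewrite !ffunE.
by move=> u v; exact: inj.
Qed.

Lemma shell_card : (ncard shell <= n.+1 ^ m - n.-1 ^ m)%N.
Proof.
have fC := (hbox_card (0 : V) n.+1).1; have fB := finite_box (0 : V) n.
have <- : ncard (hbox (0 : V) n.+1) = (n.+1 ^ m)%N by exact: (hbox_card _ _).2.
have <- : ncard (box (0 : V) n) = (n.-1 ^ m)%N.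
  pose a : V := const_mx 1; have aE k : a 0 k = 1 by rewrite mxE.
  rewrite -(hbox_card a n.-1).2; congr ncard.
  by apply/seteqP; split=> x H k; have := H k; rewrite entry0 aE; lia.
have sub : (fset_set (box (0 : V) n) `<=` fset_set (hbox (0 : V) n.+1))%fset.
  apply/fsubsetP => x; rewrite !in_fset_set // !inE => H k; have := H k; lia.
rewrite /ncard -[in leqRHS](fsetIidPr sub) -cardfsD.
apply: fsubset_leq_card; apply/fsubsetP => x.
rewrite in_fset_set; last exact: finite_shell.
rewrite inE => sx; rewrite !inE !in_fset_set //; apply/andP; split.
  apply/negP; rewrite inE; exact: (bd_nbox m2 (ltn0Sn n) sx).
by rewrite inE -cube_hbox; case: sx.
Qed.

(** The value at 0 lies in a ball, and every other value follows from it by the edge colours along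
    lattice paths that lead to 0 within the shell. *)
Lemma restrict_card : finite_set (restrict_shell @` periodic_maps) /\
  (ncard (restrict_shell @` periodic_maps) <= d.+1 ^ (m * n + 1) * d.+1 ^ ncard shell)%N.
Proof.
have [fB cB] := ball_card (m * n + 1).
have s0 : shell 0 by apply: bd0.
pose ev0 (h : V -> tree d) := h 0.
suff fib (v : tree d) : finite_set ((restrict_shell @` periodic_maps) `&` ev0 @^-1` [set v]) /\
    (ncard ((restrict_shell @` periodic_maps) `&` ev0 @^-1` [set v]) <= d.+1 ^ ncard shell)%N.
  have [||fin le] := @ncard_fibre _ _ (restrict_shell @` periodic_maps)
    [set u : tree d | (td u (g 0%R) <= m * n + 1)%N] ev0 (d.+1 ^ ncard shell)%N fB.
  - by move=> _ [h [_ _ h0] <-] /=; rewrite /ev0 restrict_shellE.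
  - exact: fib.
  by split=> //; apply: leq_trans le _; rewrite leq_mul2r cB orbT.
pose P := fset_set (shell `\` [set 0]).
have finS : finite_set (shell `\` [set 0]) by apply: finite_setD; exact: finite_shell.
have par_ex x : exists k, (shell `\` [set 0]) x ->
    x 0 k != (0 : V) 0 k /\ shell (toward x 0 k).
  have [[sx x0]|nx] := pselect ((shell `\` [set 0]) x); last by exists k0 => /nx.
  have [k xk sk] := bd_parent m2 (ltn0Sn n) sx (introN eqP x0).
  by exists k.
have [pk Hpk] := choice par_ex.
have [|||fF cF] := @count_parents m d ((restrict_shell @` periodic_maps) `&`
    ev0 @^-1` [set v]) P (fun x => toward x 0 (pk x)) (fun x => l1 x 0).
- move=> _ _ x [[h _ <-] h0] [[h' _ <-] h0'] /negP xP.
  have [sx|nsx] := pselect (shell x); last by rewrite /restrict_shell; case: asboolP.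
  have [->|/eqP x0] := eqVneq x 0; first by rewrite -/(ev0 _) h0 -/(ev0 _) h0'.
  by case: xP; rewrite in_fset_set // inE; split.
- move=> _ x [[h [hh _ _] <-] _]; rewrite in_fset_set // inE => sx.
  have [xk sk] := Hpk x sx; rewrite /edge !restrict_shellE //; last exact: sx.1.
  by apply: hh; rewrite l1C; exact: (l1_toward xk).1.
- move=> x; rewrite in_fset_set // inE => /Hpk[xk _].
  by rewrite -(l1_toward xk).2.
split=> //; apply: leq_trans cF _; apply: leq_pexp2l => //.
by apply: ncard_sub finite_shell _ => x [].
Qed.

Lemma obd_shell a x : obd (box (a *+ n) n) x -> shell (x - a *+ n).
Proof.
move=> [nx [y Dy yx]]; apply: (obd_cube m2 (ltn0Sn n)); split.
  by move=> H; apply: nx => k; have := H k; rewrite entry0 entryD entryN; lia.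
exists (y - a *+ n); last by rewrite l1_add2r.
by move=> k; have := Dy k; rewrite entry0 entryD entryN; lia.
Qed.

(** Maps with the shell of [f] agree with [f] on the outer boundary of every translated period, not
    just the first, so each may be inserted into any one period of [f]. One period together with the
    shell determines a periodic map. *)
Lemma fibre_fill f a : periodic_maps f ->
  let Q := periodic_maps `&` restrict_shell @^-1` [set restrict_shell f] in
  finite_set Q /\ (ncard Q <= ncard (fill (box (a *+ n) n) f))%N.
Proof.
move=> Pf Q.
have agree h u : Q h -> shell u -> h u = f u.
  by move=> [_ e] su; rewrite -(restrict_shellE h su) e restrict_shellE.
apply: (ncard_inj (f := fun h x => if `[< box (a *+ n) n x >] then h x else f x)).
- exact: (fill_box_fin k0 f (a := a *+ n) (n := n) _).1.
- move=> h Qh; have Ph : periodic_maps h by case: Qh.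
  split=> [x nx|x y Dx xy]; first by case: asboolP.
  have hh : tree_hom h by case: Ph.
  rewrite /edge; case: asboolP => // _; case: asboolP => [_|ny]; first exact: hh.
  have oy : obd (box (a *+ n) n) y by split=> //; exists x.
  have sy := obd_shell oy.
  have -> : f y = h y; last exact: hh.
  rewrite -[y](subrK (a *+ n)) !periodic_drift //; congr tmul.
  by rewrite (agree h).
move=> h h' Qh Qh' e; apply/funext => x.
have Ph : periodic_maps h by case: Qh.
have Ph' : periodic_maps h' by case: Qh'.
rewrite (divv_eq n x) !periodic_drift //; congr tmul.
have [bx|sx] := modv_cases x; last by rewrite (agree h) // (agree h').
apply: (@tmul_inj _ (g (drift N a))); rewrite -!periodic_drift //.
have bx' : box (a *+ n) n (modv n x + a *+ n).
  by move=> k; have := bx k; rewrite entry0 entryD; lia.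
by have := congr1 (fun F : V -> tree d => F (modv n x + a *+ n)) e => /=; case: asboolP.
Qed.

End PeriodicMaps.

(** * Upper bound by reflection and pasting *)

Section HsetUpper.
Variables (R : realType) (m d n : nat) (s : 'rV[R]_m) (g : int -> tree d) (N : 'I_m -> nat).
Local Notation V := 'rV[int]_m.
Implicit Types (x y u a b : V) (h f : V -> tree d).
Hypotheses (m2 : (2 <= m)%N) (n0 : (0 < n)%N) (gg : geo g) (g0 : g 0 = tree_root d).
Hypothesis floorN : forall k, Num.floor (s 0 k * n%:R) = (N k)%:Z.
Hypothesis s1 : l1norm s < 1.

Let k0 : 'I_m := Ordinal (ltnW m2).

Definition flip (e : {ffun 'I_m -> bool}) x : V :=
  \row_k (if e k then - x 0 k else x 0 k).

Lemma flipE e x k : flip e x 0 k = if e k then - x 0 k else x 0 k.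
Proof. by rewrite mxE. Qed.

Lemma flipK e : involutive (flip e).
Proof. by move=> x; apply/rowP => k; rewrite !flipE; case: (e k); rewrite ?opprK. Qed.

Lemma l1_flip e x y : l1 (flip e x) (flip e y) = l1 x y.
Proof. by apply: eq_bigr => k _; rewrite !flipE; case: (e k); lia. Qed.

(** Reversing the coordinates whose period moves [g] backwards makes all translations go forward. *)
Lemma Hset_flip h : (forall k, N k != 1%N) -> Hset n g s h ->
  exists e, periodic_maps n g N (h \o flip e).
Proof.
move=> N1 Hh; have [c Hc] := choice (fun k => Hset_translation n0 gg g0 floorN N1 k Hh).
pose e := [ffun k => c k]; exists e; split.
- move=> x y xy; have [hh _ _ _ _] := Hh; apply: ((graph_homE _).1 hh).
  by rewrite l1_flip.
- move=> k x /=; have [pk hk] := Hc k.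
  case ck : (c k) hk => hk.
    have -> : flip e (x + basis_vec k *+ n) = flip e x - basis_vec k *+ n.
      apply/rowP => j; rewrite !(flipE, entryD, entryN, entryMn) ffunE mxE /=.
      by case: (eqVneq j k) => [->|_]; rewrite ?ck ?mul0r ?oppr0 ?addr0 // opprD.
    have := hk (flip e x - basis_vec k *+ n); rewrite subrK => ->.
    by rewrite tmulA pk addNr g0 tmult1.
  have -> : flip e (x + basis_vec k *+ n) = flip e x + basis_vec k *+ n; last exact: hk.
  apply/rowP => j; rewrite !(flipE, entryD, entryMn) ffunE mxE /=.
  by case: (eqVneq j k) => [->|_]; rewrite ?ck ?mul0r ?addr0.
- have -> : (h \o flip e) 0 = h 0.
    by congr h; apply/rowP => k; rewrite flipE entry0 oppr0; case: ifP.
  exact: Hset_at0 Hh.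
Qed.

Lemma ncard_Hset_le : (forall k, N k != 1%N) -> finite_set (periodic_maps n g N) ->
  finite_set (Hset n g s) /\
  (ncard (Hset n g s) <= 2 ^ m * ncard (periodic_maps n g N))%N.
Proof.
move=> N1 finP.
have ex h : exists e, Hset n g s h -> periodic_maps n g N (h \o flip e).
  have [Hh|nH] := pselect (Hset n g s h); last by exists [ffun _ => true] => /nH.
  by have [e He] := Hset_flip N1 Hh; exists e.
have [sg Hsg] := choice ex.
have fT : finite_set [set: {ffun 'I_m -> bool}] by exact: finite_finset.
have -> : (2 ^ m = ncard [set: {ffun 'I_m -> bool}])%N.
  by rewrite ncard_setT card_ffun card_bool card_ord.
apply: (@ncard_fibre _ _ _ _ sg) => // e.
apply: (ncard_inj (f := fun h => h \o flip e)) => //.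
  by move=> h [Hh <-]; exact: Hsg.
move=> h h' _ _ ehh'; apply/funext => x; rewrite -(flipK e x).
exact: (congr1 (fun F : V -> tree d => F (flip e x)) ehh').
Qed.

Hypothesis perN : forall k, geo_period g (N k)%:Z.

(** Reducing [x] modulo the period leaves at most [m * n] lattice steps to 0, and [f 0] is within
    [m * n + 1] of [g 0]. The height error is at most [2 * n] per coordinate: [n] for the floor
    repeated over at most [n] periods, and [n] for the remainder. *)
Lemma periodic_near f : periodic_maps n g N f ->
  nearlin s g 0 (2 * m * n + 1)%:R f (obd (box 0 (n * n))).
Proof.
move=> Pf x /obd_box[cx _]; exists (drift N (divv n x)).
have [hf _ f0] := Pf.
set u := modv n x; set a := divv n x; have xE : x = u + a *+ n by exact: divv_eq.
have cu k : 0 <= u 0 k < n%:Z by exact: modv_itv.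
have xk k : x 0 k = u 0 k + a 0 k * n%:Z by rewrite {1}xE entryD entryMn.
have ca k : 0 <= a 0 k <= n%:Z.
  have := cx k; have := cu k; rewrite entry0 add0r xk PoszM.
  move: (u 0 k) (a 0 k) => p q /andP[p0 pn] /andP[x0 xn]; apply/andP; split.
    rewrite leNgt; apply/negP => q0; have : q * n%:Z <= (-1) * n%:Z by apply: ler_wpM2r; lia.
    by lia.
  rewrite leNgt; apply/negP => qn; have : (n%:Z + 1) * n%:Z <= q * n%:Z by apply: ler_wpM2r; lia.
  by lia.
split.
  rewrite ler_nat xE (periodic_drift g0 perN u a Pf) -{2}(tmul1t (g (drift N a))) -g0 td_tmul.
  have l1u : (l1 u 0 <= m * n)%N.
    have -> : (m * n = \sum_(k < m) n)%N by rewrite sum_nat_const card_ord.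
    by apply: leq_sum => k _; have := cu k; rewrite entry0; lia.
  have := (hom_lip hf).1 u 0 I I; have := td_tri (f u) (f 0) (g 0).
  by rewrite -mulnA mul2n; lia.
have nR : 0 < n%:R :> R by rewrite ltr0n.
rewrite addr0 /drift /dot rmorph_sum -sumrB /=; apply: le_trans (ler_norm_sum _ _ _) _.
apply: (@le_trans _ _ (\sum_(k < m) (2 * n)%:R)); last first.
  by rewrite sumr_const card_ord -mulrnA ler_nat; lia.
apply: ler_sum => k _; rewrite xk.
have sk : `|s 0 k| <= 1.
  by apply: le_trans (ltW s1); rewrite /l1norm (bigD1 k) //= lerDl; apply: sumr_ge0.
have -> : (a 0 k * (N k)%:Z)%:~R - s 0 k * (u 0 k + a 0 k * n%:Z)%:~R =
   (a 0 k)%:~R * ((N k)%:R - s 0 k * n%:R) - s 0 k * (u 0 k)%:~R :> R.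
  by rewrite !(rmorphD, rmorphM) /= -!pmulrn; ring.
apply: le_trans (ler_normB _ _) _; rewrite mul2n -addnn natrD; apply: lerD.
  rewrite normrM -[leRHS]mulr1; apply: ler_pM => //.
    rewrite -intr_norm; have := ca k => cak; have : `|a 0 k| <= n%:Z by lia.
    by rewrite -(ler_int R) -pmulrn.
  by have := floor_itv (s 0 k * n%:R); rewrite floorN rmorphD /= -pmulrn ler_norml; lra.
rewrite normrM -[leRHS]mul1r; apply: ler_pM => //.
rewrite -intr_norm; have := cu k => cuk; have : `|u 0 k| <= n%:Z by lia.
by rewrite -(ler_int R) -pmulrn.
Qed.

(** The margin [C0 * n] suffices because [2 * ((2 m n + 1) + 3) = 4 m n + 8] is at most
    [(4 m + 8) n]. *)
Lemma fibre_ref (gr : int -> tree d) C0 f : geo gr -> (4 * m + 8)%:R <= (1 - l1norm s) * C0%:R ->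
  periodic_maps n g N f ->
  (ncard (periodic_maps n g N `&`
     restrict_shell n @^-1` [set restrict_shell n f]) ^ (n ^ m)
   <= refZ s gr (n * n + C0.*2 * n))%N.
Proof.
move=> ggr hC Pf; have [hf _ _] := Pf.
apply: (@leq_trans (ncard (fill (box 0 (n * n)) f))).
  apply: (tile_prod k0 (w := n)) => // [|F]; first by split=> // x y _; exact: hf.
  have -> : corner n F = (\row_k (F k : nat)%:Z) *+ n.
    by apply/rowP => k; rewrite cornerE entryMn mxE PoszM.
  exact: (fibre_fill m2 n0 g0 perN _ Pf).2.
have C0pos : (0 < C0)%N.
  rewrite lt0n; apply/eqP => C00; move: hC; rewrite C00 mulr0.
  by rewrite lern0; lia.
apply: (box_upper k0 (c := (C0 * n)%N) (g := g) (rho := 0) (E := (2 * m * n + 1)%:R)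
  (b := par (f 0)) gg ggr _ _ s1).
- by rewrite muln_gt0 C0pos.
- rewrite natrM mulrA; apply: (@le_trans _ _ ((4 * m + 8)%:R * n%:R)); last exact: ler_wpM2r.
  rewrite -[3]/(3%:R) -!natrD -!natrM ler_nat.
  by rewrite mulnDl; have := n0; lia.
- by rewrite -doubleMl.
- exact: periodic_near.
- exact: lipS (hom_lip hf) (@subsetT _ _).
Qed.

Lemma Hset_upper (gr : int -> tree d) C0 : geo gr -> (4 * m + 8)%:R <= (1 - l1norm s) * C0%:R ->
  (forall k, N k != 1%N) ->
  finite_set (Hset n g s) /\ exists B,
   (ncard (Hset n g s) <=
      2 ^ m * ((d.+1 ^ (m * n + 1) * d.+1 ^ (n.+1 ^ m - n.-1 ^ m)) * B))%N /\
   (B ^ (n ^ m) <= refZ s gr (n * n + C0.*2 * n))%N.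
Proof.
move=> ggr hC N1; set Z := refZ s gr _.
have nm0 : (0 < n ^ m)%N by rewrite expn_gt0 n0.
have Z0 : (0 < Z)%N by exact: (refZ_gt0 k0 s1 ggr).
(* The largest such [c] is the integer part of the [n^m]-th root of [Z]; it bounds every class of
   maps with a common shell at once. *)
pose P (c : nat) := (c ^ (n ^ m) <= Z)%N.
have exP : exists c, P c by exists 0%N; rewrite /P exp0n.
have bP c : P c -> (c <= Z)%N.
  by apply: leq_trans; case: c => // c; rewrite -{1}(expn1 c.+1) leq_pexp2l.
case: (ex_maxnP exP bP) => B PB maxB.
have [fR cR] := restrict_card n N m2 g0.
have [||fP cP] := @ncard_fibre _ _ (periodic_maps n g N) _ (restrict_shell n) B fR.
- by move=> h Ph; exists h.
- move=> y; have [[f [Pf <-]]|ne] := pselect (exists f, periodic_maps n g N f /\ restrict_shell n f = y).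
    split; first exact: (fibre_fill m2 n0 g0 perN 0 Pf).1.
    by apply: maxB; exact: fibre_ref.
  rewrite (_ : _ `&` _ = set0); first by split=> //; rewrite /ncard fset_set0 cardfs0.
  by apply/seteqP; split=> // h [Ph hy]; apply: ne; exists h.
have [fH cH] := ncard_Hset_le N1 fP.
split=> //; exists B; split=> //.
apply: leq_trans cH _; rewrite leq_mul2l; apply/orP; right.
apply: leq_trans cP _; rewrite leq_mul2r; apply/orP; right.
apply: leq_trans cR _; rewrite leq_mul2l; apply/orP; right.
by apply: leq_pexp2l => //; exact: shell_card m2 n0.
Qed.

End HsetUpper.

(** * Smooth majorants *)

Section PowerSeries.
Variable R : realType.
Implicit Types (c : R^nat) (x y : R).

Definition cvg_unit_disk c := forall x, `|x| < 1 -> cvgn (pseries c x).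

(** A mean value estimate for the power: it dominates the differentiated series at [a] by the
    original series at a larger point [y]. *)
Lemma geometric_gap (a y : R) n : 0 <= a -> a <= y -> n.+1%:R * a ^+ n * (y - a) <= y ^+ n.+1.
Proof.
move=> a0 ay; have y0 : 0 <= y by exact: le_trans ay.
elim: n => [|n IH]; first by rewrite expr0 expr1; lra.
have h1 : a ^+ n.+1 <= y ^+ n.+1 by apply: lerXn2r.
have h2 : (y - a) * a ^+ n.+1 <= (y - a) * y ^+ n.+1 by apply: ler_wpM2l; lra.
have h3 := ler_wpM2l a0 IH.
rewrite -natr1 (exprS y n.+1) (exprS a n) in h1 h2 *; rewrite (exprS y n) in h1 h2 h3 *.
by lra.
Qed.

Lemma cvg_unit_disk_diffs c : cvg_unit_disk c -> cvg_unit_disk (pseries_diffs c).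
Proof.
move=> cc x x1; have x0 := normr_ge0 x; set a := `|x| in x0 x1 *.
pose y := (a + 1) / 2; pose rho := (y + 1) / 2.
have ay : a < y by rewrite /y; lra.
have yr : y < rho by rewrite /rho /y; lra.
have r1 : rho < 1 by rewrite /rho /y; lra.
have nr z : 0 <= z -> z < 1 -> `|z| < 1 by move=> z0 z1; rewrite ger0_norm.
pose w n := `|c n| * y ^+ n.
have cw : cvgn (series w).
  apply: (@is_cvg_pseries_inside_norm _ c rho y); first by apply: cc; apply: nr; lra.
  by rewrite !ger0_norm; lra.
have w0 n : 0 <= w n by rewrite /w mulr_ge0 // exprn_ge0 //; lra.
have wle N : \sum_(0 <= n < N) w n <= limn (series w).
  by apply: nondecreasing_cvgn_le => //; apply: nondecreasing_series => n _ _.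
have cv : cvgn (series (fun n => w n.+1 / (y - a))).
  apply: nondecreasing_is_cvgn.
    apply: nondecreasing_series => n _ _; rewrite divr_ge0 //; lra.
  exists (limn (series w) / (y - a)) => _ [N _ <-]; rewrite /series /=.
  rewrite -mulr_suml ler_wpM2r ?invr_ge0; [by []|by lra|].
  by apply: le_trans (wle N.+1); rewrite big_nat_recl //= lerDr.
apply: normed_cvg; apply: series_le_cvg cv => [n|n|n].
- exact: normr_ge0.
- by rewrite divr_ge0 //; lra.
rewrite /= /pseries_diffs !normrM normrX -/a normr_nat ler_pdivlMr; last by lra.
rewrite /w (mulrC n.+1%:R) -!mulrA; apply: ler_wpM2l => //.
by rewrite mulrA; apply: geometric_gap => //; exact: ltW.
Qed.

Lemma pseries_is_derive c y : cvg_unit_disk c -> `|y| < 1 ->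
  is_derive y (1 : R) (fun x => limn (pseries c x)) (limn (pseries (pseries_diffs c) y)).
Proof.
move=> cc y1; pose K := (`|y| + 1) / 2.
have yK : `|y| < K by rewrite /K; lra.
have K1 : `|K| < 1.
  by rewrite ger0_norm; [rewrite /K; lra | apply: le_trans (ltW yK)].
have cd := cvg_unit_disk_diffs cc; have cdd := cvg_unit_disk_diffs cd.
by apply: (pseries_snd_diffs (K := K)); [exact: cc|exact: cd|exact: cdd|exact: lt_le_trans (ler_norm K)].
Qed.

(** A class stable under differentiation, with [k] changing sign and [c] replaced by its
    differentiated coefficients, so derivatives of all orders exist by induction. *)
Definition reflected_series (A k : R) c x := A + k * limn (pseries c (1 - x)).

Lemma reflected_is_derive A k c x : cvg_unit_disk c -> 0 < x < 1 ->
  is_derive x (1 : R) (reflected_series A k c) (reflected_series 0 (- k) (pseries_diffs c) x).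
Proof.
move=> cc x01.
have y1 : `|1 - x| < 1 by rewrite ger0_norm; lra.
have D1 : is_derive x (1 : R) (fun x => 1 - x) (-1).
  rewrite -[X in is_derive _ _ _ X]add0r.
  by apply: is_deriveB.
have D2 := @is_derive1_comp R (fun y => limn (pseries c y)) (fun x => 1 - x) x _ _
  (pseries_is_derive cc y1) D1.
have D3 := is_deriveZ k D2.
have D4 := is_deriveD (is_derive_cst A x 1) D3.
apply: is_derive_eq D4 _; rewrite /reflected_series !add0r /GRing.scale /=; ring.
Qed.

Lemma near_unit_itv x : 0 < x < 1 -> \forall z \near x, 0 < z < 1.
Proof.
move=> /andP[x0 x1]; near=> z; apply/andP; split; near: z; [exact: lt_nbhsr|exact: lt_nbhsl].
Unshelve. all: by end_near.
Qed.

Lemma derive1n_reflected (j : nat) (f : R -> R) A k c : cvg_unit_disk c ->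
  (forall x, 0 < x < 1 -> f x = reflected_series A k c x) ->
  exists A' k' c', cvg_unit_disk c' /\
    forall x, 0 < x < 1 -> derive1n j f x = reflected_series A' k' c' x.
Proof.
move=> cc fE; elim: j => [|j [A' [k' [c' [cc' H]]]]]; first by exists A, k, c.
exists 0, (- k'), (pseries_diffs c'); split=> [|x x01]; first exact: cvg_unit_disk_diffs.
rewrite derive1nS derive1E.
have D := reflected_is_derive A' k' cc' x01.
have [_ <-] := D; apply: near_eq_derive.
near=> z; apply: H; near: z; exact: near_unit_itv.
Unshelve. all: by end_near.
Qed.

Lemma reflected_smooth (j : nat) A k c x : cvg_unit_disk c -> 0 < x < 1 ->
  derivable (derive1n j (reflected_series A k c)) x 1.
Proof.
move=> cc x01; have [A' [k' [c' [cc' H]]]] :=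
  @derive1n_reflected j (reflected_series A k c) A k c cc (fun _ _ => erefl).
have [D _] := reflected_is_derive A' k' cc' x01.
apply: (near_eq_derivable _ D).
near=> z; apply/esym/H; near: z; exact: near_unit_itv.
Unshelve. all: by end_near.
Qed.

End PowerSeries.

Section SmoothMajorant.
Variable R : realType.

(* For [p x >= 1] each term [q >= p] of [sum_q (B q - B q.+1) (1 - (1 - x)^q)] keeps at
   least half of its weight, so that twice the sum dominates [B p]. *)
Section AlternatingWeights.
Implicit Types (x : R) (N : nat).
Variable B : R^nat.
Hypothesis B0 : forall p, 0 <= B p.
Hypothesis Bdec : forall p, B p.+1 <= B p.

Let c p := B p - B p.+1.

Let c0 p : 0 <= c p.
Proof. by rewrite /c subr_ge0. Qed.

Let partial x N := \sum_(0 <= p < N) c p * (1 - x) ^+ p.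

Let sum_c N : \sum_(0 <= p < N) c p = B 0%N - B N.
Proof.
elim: N => [|N IH]; first by rewrite big_geq // subrr.
by rewrite big_nat_recr //= IH /c; ring.
Qed.

Let BN N : B N <= B 0%N.
Proof. by elim: N => // N; exact: le_trans. Qed.

Let partial_le x N : 0 <= x <= 1 -> partial x N <= B 0%N - B N.
Proof.
move=> /andP[x0 x1]; rewrite -sum_c; apply: ler_sum => p _.
by rewrite ler_piMr // exprn_ile1 //; lra.
Qed.

Let partial_nondec x : 0 <= x <= 1 -> {homo (partial x) : n m / (n <= m)%N >-> n <= m}.
Proof.
move=> /andP[x0 x1]; apply: nondecreasing_series => n _ _.
by rewrite mulr_ge0 // exprn_ge0; lra.
Qed.

Let partial_cvg x : 0 <= x <= 1 -> cvgn (partial x).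
Proof.
move=> x01; apply: nondecreasing_is_cvgn; first exact: partial_nondec.
exists (B 0%N) => _ [N _ <-]; apply: le_trans (partial_le N x01) _.
by rewrite lerBlDr lerDl.
Qed.

Lemma weights_cvg : cvg_unit_disk c.
Proof.
move=> y y1; apply: normed_cvg.
have y01 : 0 <= 1 - `|y| <= 1 by have := normr_ge0 y; lra.
apply: cvgP; apply: cvg_trans (partial_cvg y01); apply: near_eq_cvg.
apply: nearW => N; apply: eq_bigr => p _ /=.
by rewrite normrM normrX (ger0_norm (c0 p)) opprB addrC subrK.
Qed.

Definition majorant := reflected_series (2 * B 0%N) (-2) c.

Let majorantE x : majorant x = 2 * (B 0%N - limn (partial x)).
Proof. by rewrite /majorant /reflected_series mulrBr mulNr. Qed.

Lemma majorant_ge0 x : 0 <= x <= 1 -> 0 <= majorant x.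
Proof.
move=> x01; rewrite majorantE mulr_ge0 // subr_ge0.
apply: limr_le; first exact: partial_cvg.
by apply: nearW => N; apply: le_trans (partial_le N x01) _; rewrite lerBlDr lerDl.
Qed.

Lemma majorant_ge p x : 0 <= x <= 1 -> 1 <= p%:R * x -> B p <= majorant x.
Proof.
move=> x01 px; have /andP[x0 x1] := x01.
(* Bernoulli gives [(1 + x)^p >= 1 + p x >= 2], while [(1 - x^2)^p <= 1]. *)
have hp : (1 - x) ^+ p <= 1 / 2.
  have xp : 0 <= (1 - x) ^+ p by rewrite exprn_ge0; lra.
  have h1 : (1 + x) ^+ p * (1 - x) ^+ p <= 1.
    by rewrite -exprMn exprn_ile1 //; nra.
  have h2 : 1 + p%:R * x <= (1 + x) ^+ p.
    elim: p {px xp h1} => [|q IH]; first by rewrite mul0r addr0.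
    rewrite exprS; apply: (@le_trans _ _ ((1 + x) * (1 + q%:R * x))).
      have q0 : 0 <= q%:R * x * x by rewrite !mulr_ge0.
      by rewrite -natr1; lra.
    by apply: ler_wpM2l => //; lra.
  have h3 : 2 * (1 - x) ^+ p <= (1 + x) ^+ p * (1 - x) ^+ p.
    by apply: ler_wpM2r => //; lra.
  by lra.
have half q : (p <= q)%N -> (1 - x) ^+ q <= 1 / 2.
  move=> pq; apply: le_trans hp; rewrite -(subnK pq) exprD.
  by rewrite ler_piMl ?exprn_ge0 ?exprn_ile1 //; lra.
have part N : partial x N <= B 0%N - B p / 2.
  apply: (@le_trans _ _ (B 0%N - B (maxn N p) / 2 - B p / 2)); last first.
    by have := B0 (maxn N p); lra.
  apply: (@le_trans _ _ (partial x (maxn N p))).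
    by apply: partial_nondec => //; exact: leq_maxl.
  rewrite /partial (big_cat_nat (leq0n p) (leq_maxr N p)) /=.
  have e1 : \sum_(0 <= q < p) c q * (1 - x) ^+ q <= B 0%N - B p by exact: partial_le.
  have e2 : \sum_(p <= q < maxn N p) c q * (1 - x) ^+ q <= (B p - B (maxn N p)) / 2.
    have -> : B p - B (maxn N p) = \sum_(p <= q < maxn N p) c q.
      have := sum_c (maxn N p); rewrite (big_cat_nat (leq0n p) (leq_maxr N p)) /= sum_c; lra.
    rewrite mulr_suml big_nat_cond [leRHS]big_nat_cond; apply: ler_sum => q /andP[/andP[pq _] _].
    apply: ler_wpM2l => //; have := half q pq; lra.
  by lra.
rewrite majorantE; have : limn (partial x) <= B 0%N - B p / 2.
  by apply: limr_le; [exact: partial_cvg|apply: nearW].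
by lra.
Qed.

(** Weights of index below [M] lose at most the proportion [M x], and the remaining ones have total
    at most [B M]. *)
Lemma majorant_le M x : 0 <= x <= 1 -> majorant x <= 2 * (B M + B 0%N * (M%:R * x)).
Proof.
move=> x01; have /andP[x0 x1] := x01; rewrite majorantE ler_pM2l //.
have h1 : partial x M <= limn (partial x).
  by apply: nondecreasing_cvgn_le; [exact: partial_nondec|exact: partial_cvg].
have h2 : (1 - M%:R * x) * (B 0%N - B M) <= partial x M.
  apply: (@le_trans _ _ ((1 - x) ^+ M * (B 0%N - B M))).
    by apply: ler_wpM2r; [rewrite subr_ge0|exact: expr1B_ge].
  rewrite -sum_c mulr_sumr big_nat_cond [leRHS]big_nat_cond; apply: ler_sum => q /andP[/andP[_ qM] _].
  rewrite mulrC; apply: ler_wpM2l => //; rewrite -(subnK (ltnW qM)) exprD.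
  by rewrite ler_piMl ?exprn_ge0 ?exprn_ile1 //; lra.
have h3 : 0 <= M%:R * x * B M by rewrite !mulr_ge0.
by lra.
Qed.

Hypothesis Blim : forall e, 0 < e -> exists p, B p <= e.

Lemma majorant_theta : theta_fun 1 majorant.
Proof.
split=> [j x x01|]; first exact: reflected_smooth weights_cvg x01.
apply/cvgrPdist_le => e e0.
have [M BM] := Blim (e := e / 4) ltac:(lra).
pose r := e / 4 / (B 0%N * M%:R + 1).
have r0 : 0 < r by rewrite divr_gt0 //; [lra|rewrite ltr_wpDl // mulr_ge0].
near=> x; have x0 : 0 < x by near: x; exact: nbhs_right_gt.
have x1 : x < 1 by near: x; exact: nbhs_right_lt.
have xr : x < r by near: x; exact: nbhs_right_lt.
have x01 : 0 <= x <= 1 by lra.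
rewrite sub0r normrN ger0_norm; last exact: majorant_ge0.
apply: le_trans (majorant_le M x01) _.
have : (B 0%N * M%:R + 1) * x <= e / 4.
  rewrite mulrC -ler_pdivlMr; [exact: ltW|by rewrite ltr_wpDl // mulr_ge0].
by have := BM; lra.
Unshelve. all: by end_near.
Qed.

End AlternatingWeights.

(** [E t v] reads: the error [v] occurs at parameter [t]. The sequence [B p] is the supremum of the
    errors at parameters up to about [1 / p]; including 0 keeps it defined and nonnegative when no
    error occurs. The index [p = trunc (1 / t) + 1] satisfies [p t >= 1], as the lower bound on the
    majorant requires. *)
Lemma smooth_majorant (E : R -> R -> Prop) :
  (forall e : R, 0 < e -> exists2 r : R, 0 < r & forall t v, 0 < t < r -> E t v -> v <= e) ->
  exists (r : R) (f : R -> R), [/\ 0 < r, theta_fun r f, forall x, 0 < x < r -> 0 <= f x &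
    forall t v, 0 < t < r -> E t v -> v <= f t].
Proof.
move=> HE; have [r1 r10 hr1] := HE 1 ltr01.
pose r := Num.min r1 1; have r0 : 0 < r by rewrite lt_min r10 ltr01.
pose S p := [set v : R | v = 0 \/ exists t, [/\ 0 < t < r, (p <= (Num.trunc t^-1).+1)%N & E t v]].
have S1 p v : S p v -> v <= 1.
  by case=> [->|[t [/andP[t0]]]]; [lra|rewrite lt_min => /andP[tr _] _; apply: hr1; rewrite t0].
have hsS p : has_sup (S p).
  by split; [exists 0; left|exists 1 => v /S1].
pose B p := sup (S p).
have B0 p : 0 <= B p by apply: ub_le_sup; [exact: (hsS p).2|left].
have Bdec p : B p.+1 <= B p.
  apply: ge_sup; first exact: (hsS p.+1).1.
  move=> v Sv; apply: ub_le_sup; first exact: (hsS p).2.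
  by case: Sv => [->|[t [t0 pt Etv]]]; [left|right; exists t; split=> //; exact: ltnW].
have Blim e : 0 < e -> exists p, B p <= e.
  move=> e0; have [re re0 hre] := HE e e0.
  have [K HK] := small_inv (e := re / 2) ltac:(lra).
  exists K.+2; apply: ge_sup; first exact: (hsS _).1.
  move=> v [->|[t [/andP[t0 tr] pt Etv]]]; first exact: ltW.
  apply: (hre t v _ Etv); rewrite t0 /=.
  have [K0 Kre] := HK K.+1 (leqnSn K).
  apply: (@le_lt_trans _ _ (K.+1%:R^-1)); last by apply: le_lt_trans Kre _; lra.
  have := truncn_itv (_ : 0 <= t^-1); rewrite invr_ge0 => /(_ (ltW t0))/andP[h _].
  rewrite -[leLHS]invrK lef_pV2 ?posrE ?invr_gt0 ?ltr0n //.
  by apply: le_trans h; rewrite ler_nat.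
exists r, (majorant B); have [sm lim0] := majorant_theta B0 Bdec Blim.
have rle1 : r <= 1 by rewrite ge_min lexx orbT.
split=> //.
- split=> // j x /andP[x0 xr]; apply: sm; rewrite x0 /=; exact: lt_le_trans rle1.
- by move=> x /andP[x0 xr]; apply: majorant_ge0 => //; lra.
move=> t v tr Etv; have /andP[t0 tr'] := tr.
pose p := (Num.trunc t^-1).+1.
apply: (@le_trans _ _ (B p)).
  by apply: ub_le_sup; [exact: (hsS p).2|right; exists t].
apply: majorant_ge => //; first by lra.
have := truncn_itv (_ : 0 <= t^-1); rewrite invr_ge0 => /(_ (ltW t0))/andP[_ h].
by rewrite -ler_pdivrMr // mul1r; exact: ltW.
Qed.

End SmoothMajorant.

(** * Comparison of the entropies *)

Section Assembly.
Variables (R : realType) (m d : nat) (s : 'rV[R]_m) (gr : int -> tree d).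
Local Notation V := 'rV[int]_m.
Hypotheses (m2 : (2 <= m)%N) (s1 : l1norm s < 1) (ggr : geo gr).

Let k0 : 'I_m := Ordinal (ltnW m2).
Let z n : R := ln (refZ s gr n)%:R.

Let gap0 : 0 < 1 - l1norm s.
Proof. by rewrite subr_gt0. Qed.

(** One margin for three uses: 10 for superadditivity, [2 m + 10] for periodized fillings and
    [4 m + 8] for pasting. *)
Lemma exists_margin : exists2 c, (0 < c)%N & (4 * m + 10)%:R <= (1 - l1norm s) * c%:R.
Proof.
have gp := gap0; pose y := (4 * m + 10)%:R / (1 - l1norm s).
exists (Num.trunc y).+1 => //.
by rewrite mulrC -ler_pdivrMr //; exact: ltW (truncnS_gt _).
Qed.

Let refR n : 1 <= (refZ s gr n)%:R :> R.
Proof. by rewrite ler1n; exact: (refZ_gt0 k0 s1 ggr n). Qed.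

Lemma ref_limit : exists2 lam, 0 <= lam & forall e : R, 0 < e ->
  exists K, forall n, (K <= n)%N -> `|z n - lam * n%:R ^+ m| <= e * n%:R ^+ m.
Proof.
have [c c0 hc] := exists_margin.
have p0 n : 0 < (refZ s gr n)%:R :> R by apply: lt_le_trans (refR n).
apply: (@superadditive_limit R m c.*2 z (ln d.+1%:R)).
- by rewrite double_gt0.
- by move=> n; apply: ln_ge0; exact: refR.
- move=> n; rewrite /z -natrX mulr_natr -lnXn ?ltr0n // ler_ln ?posrE ?exprn_gt0 //.
  by rewrite -natrX ler_nat; exact: refZ_le.
move=> k q M kM; rewrite /z -natrX mulr_natl -lnXn // ler_ln ?posrE ?exprn_gt0 //.
rewrite -natrX ler_nat; apply: (refZ_super k0 s1 ggr c0 _ kM).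
by apply: le_trans hc; rewrite ler_nat leq_addl.
Qed.

Variable lam : R.
Hypothesis lam0 : 0 <= lam.
Hypothesis zlim : forall e : R, 0 < e -> exists K, forall n, (K <= n)%N ->
  `|z n - lam * n%:R ^+ m| <= e * n%:R ^+ m.

Lemma boundary_entropy e : 0 < e -> exists2 r : R, 0 < r &
  forall (n : nat) (delta : R) (g : int -> tree d) (hb : vertex_boundary (cube m n) -> tree d),
    (0 < n)%N -> n%:R^-1 < r -> 0 < delta < r -> geo g ->
    graph_hom (@sub_nbr m (vertex_boundary (cube m n))) hb ->
    (forall x : vertex_boundary (cube m n),
        (tree_dist (hb x) (g (Num.floor (dot s (val x)))))%:R <= delta * n%:R) ->
    [/\ finite_set (extensions hb), extensions hb !=set0 &
        `|ln (ncard (extensions hb))%:R - lam * n%:R ^+ m| <= e * n%:R ^+ m].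
Proof.
move=> e0; have gp := gap0; set gap := 1 - l1norm s in gp.
(* The annulus has width [c], one more than the integer part of [2 (delta n + 4) / gap]; both sides
   of it and the layer lost in passing from [n] to [n - 1] cost at most [C (delta n + 1)]. *)
pose C : R := 16 / gap + 3.
have C0 : 0 < C by rewrite /C addr_gt0 ?divr_gt0.
have [ra ra0 Ha] := compare_lower lam0 zlim (ltW C0) e0.
have [rb rb0 Hb] := compare_upper lam0 zlim (ltW C0) e0.
(* [rc] makes the data on opposite faces Lipschitz; [rd] ensures [C (delta n + 1) <= n], so that a
   box of side 0 fits inside the annulus. *)
pose rc := gap / 16.
pose rd := (2 * C)^-1.
have rc0 : 0 < rc by rewrite divr_gt0.
have rd0 : 0 < rd by rewrite invr_gt0 mulr_gt0.
exists (Num.min (Num.min ra rb) (Num.min rc rd)); first by rewrite !lt_min ra0 rb0 rc0 rd0.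
move=> n delta g hb n0; rewrite !lt_min => /andP[/andP[na nb] /andP[nc nd]].
move=> /andP[d0 /andP[/andP[da db] /andP[dc dd]]] gg hh near_hb.
have nR : 0 < n%:R :> R by rewrite ltr0n.
have dn0 : 0 < delta * n%:R by rewrite mulr_gt0.
have n16 : 16 <= n%:R * gap.
  have : 1 < gap / 16 * n%:R by rewrite -ltr_pdivrMr // mul1r.
  by lra.
pose f := extend_bd hb.
have ef := graph_hom_bd hh; rewrite -/f in ef.
pose bd := vertex_boundary (cube m n).
have nf : nearlin s g 0 (delta * n%:R + 1) f bd.
  move=> x bx; exists (Num.floor (dot s x)).
  have := near_hb (exist _ x (mem_set bx)); rewrite -extend_bdE tree_distE -/f /= => h.
  split; first by lra.
  by have := floor_itv (dot s x); rewrite rmorphD /= ler_norml; lra.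
have lf : lip (par (f 0)) bd f.
  split=> [x y bx by_|x bx]; last exact: (bd_par m2 n0 ef bx).
  apply: (bd_td m2 n0 ef _ bx by_) => {x y bx by_} x y bx by_ nl.
  apply: (nearlin_cross gg nf nf bx by_).
  apply: (@le_trans _ _ (gap * n.-1%:R)); last by apply: ler_wpM2l; [lra|rewrite ler_nat].
  have n1 : n.-1%:R * gap = n%:R * gap - gap by rewrite -[in RHS](prednK n0) -natr1; ring.
  have dn : delta * n%:R <= gap / 16 * n%:R by apply: ler_wpM2r => //; exact: ltW.
  have g1 : gap <= 1 by rewrite /gap gerBl; apply: sumr_ge0 => k _; exact: normr_ge0.
  by rewrite (mulrC gap) n1; lra.
pose c := (Num.trunc (2 * (delta * n%:R + 4) / gap)).+1.
have y0 : 0 <= 2 * (delta * n%:R + 4) / gap by rewrite divr_ge0 //; lra.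
have /andP[c1 c2] := truncn_itv y0; rewrite -/c in c2.
have cgap : 2 * (delta * n%:R + 1 + 3) <= gap * c%:R.
  by move: (ltW c2); rewrite ler_pdivrMr //; lra.
have c3 : c.*2%:R + 1 <= C * (delta * n%:R + 1).
  have -> : c.*2%:R = 2 * c%:R :> R by rewrite -mul2n natrM.
  have -> : c%:R = (Num.trunc (2 * (delta * n%:R + 4) / gap))%:R + 1 :> R by rewrite natr1.
  have : 0 <= gap^-1 * (delta * n%:R) by rewrite mulr_ge0 ?invr_ge0; lra.
  by rewrite /C; lra.
have nfo := nearlinS nf (obd_cube m2 n0).
have lfo := lipS lf (obd_cube m2 n0).
have [fe cE] := ncard_extensions m2 n0 hh; rewrite -/f in cE.
have lowk (k : nat) : k%:R + C * (delta * n%:R + 1) <= n%:R ->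
    fill (box 0 n.-1) f !=set0 /\ (refZ s gr k <= ncard (fill (box 0 n.-1) f))%N.
  move=> kn; apply: (box_lower k0 gg ggr (ltn0Sn _) cgap s1 _ nfo lfo).
  have : (k + c.*2 + 1)%:R <= n%:R :> R by rewrite !natrD; lra.
  by rewrite ler_nat addn1 => h; rewrite -ltnS prednK.
(* The comparison with the empty box serves only to produce one filling. *)
have [ne _] : fill (box 0 n.-1) f !=set0 /\ (refZ s gr 0 <= ncard (fill (box 0 n.-1) f))%N.
  apply: lowk; rewrite add0r.
  have h1 : C * delta <= 1 / 2.
    have : C * delta <= C * rd by apply: ler_wpM2l; lra.
    by rewrite /rd invfM mulrCA divff ?gt_eqF //; lra.
  have h2 : C <= n%:R / 2.
    have : C * n%:R^-1 <= 1 / 2.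
      have : C * n%:R^-1 <= C * rd by apply: ler_wpM2l; lra.
      by rewrite /rd invfM mulrCA divff ?gt_eqF //; lra.
    by rewrite ler_pdivrMr //; lra.
  by have := ler_wpM2r (ltW nR) h1; lra.
have finF : finite_set (fill (box 0 n.-1) f).
  exact: (fill_box_fin k0 _ (a := 0) (n := n.-1) _).1.
have p0 : 0 < (ncard (fill (box 0 n.-1) f))%:R :> R.
  by rewrite ltr0n; case: ne => h Fh; exact: ncard_gt0 Fh.
have nex : extensions hb !=set0.
  apply/set0P/eqP => ex0; move: p0; rewrite -cE ex0 /ncard fset_set0 cardfs0 ltxx //.
split=> //; rewrite cE ler_norml; apply/andP; split.
  have d01 : 0 <= delta < ra by lra.
  have := Ha n delta (ln (ncard (fill (box 0 n.-1) f))%:R) n0 na d01.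
  have H : forall k : nat, k%:R + C * (delta * n%:R + 1) <= n%:R ->
      z k <= ln (ncard (fill (box 0 n.-1) f))%:R.
    move=> k /lowk[_ le]; rewrite /z ler_ln ?posrE // ?ler_nat //.
    exact: lt_le_trans (refR k).
  by move=> /(_ H); lra.
have d01 : 0 <= delta < rb by lra.
have := Hb n delta (ln (ncard (fill (box 0 n.-1) f))%:R) n0 nb d01.
have H : forall k : nat, n%:R + C * (delta * n%:R + 1) <= k%:R ->
    ln (ncard (fill (box 0 n.-1) f))%:R <= z k.
  move=> k nk; rewrite /z ler_ln ?posrE //; last exact: lt_le_trans (refR k).
  rewrite ler_nat; apply: (box_upper k0 gg ggr (ltn0Sn _) cgap s1 _ nfo lfo).
  have : (n + c.*2)%:R <= k%:R :> R by rewrite natrD; lra.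
  rewrite ler_nat; apply: leq_trans; by rewrite leq_add2r leq_pred.
by move=> /(_ H); lra.
Qed.

(** For [1 / n] below this radius every positive [s_k] satisfies [s_k n > 2]. The summand 1 covers
    the case without positive coordinates. *)
Lemma slope_radius : exists2 r : R, 0 < r & forall k, 0 < s 0 k -> r <= s 0 k / 2.
Proof.
pose F k := if 0 < s 0 k then 2 / s 0 k else 0.
have F0 k : 0 <= F k by rewrite /F; case: ifP => // sk; rewrite divr_ge0 // ltW.
have S0 : 0 <= \sum_k F k by apply: sumr_ge0.
exists (1 + \sum_k F k)^-1; first by rewrite invr_gt0 ltr_pwDl.
move=> k sk; rewrite -[leRHS]invrK lef_pV2 ?posrE ?invr_gt0 ?divr_gt0 //; last by rewrite ltr_pwDl.
rewrite invfM invrK mulrC; apply: (@le_trans _ _ (F k)); first by rewrite /F sk.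
rewrite (bigD1 k) //= addrCA lerDl addr_ge0 //; exact: sumr_ge0.
Qed.

Lemma ncard_gt0_neq (T : choiceType) (X : set T) : finite_set X -> X !=set0 ->
  0 < (ncard X)%:R :> R.
Proof. by move=> fX [x Xx]; rewrite ltr0n; exact: ncard_gt0 Xx. Qed.

(** The factors count reflections, values at 0 and shell colours. Since [2 <= m], the linear term
    [m n + 1] is also of order [n^(m-1)]. *)
Lemma beta_bound : exists2 D : R, 0 <= D & forall n : nat, (0 < n)%N ->
  ln (2 ^ m * (d.+1 ^ (m * n + 1) * d.+1 ^ (n.+1 ^ m - n.-1 ^ m)))%:R
    <= D * n%:R^-1 * n%:R ^+ m.
Proof.
pose La : R := ln d.+1%:R; have La0 : 0 <= La by apply: ln_ge0; rewrite ler1n.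
have l20 : 0 <= ln 2 :> R by apply: ln_ge0; rewrite ler1n.
exists (m%:R * ln 2 + m.+1%:R * La + (2 ^+ m + m%:R) * La).
  by rewrite !addr_ge0 // !mulr_ge0 // addr_ge0 // exprn_ge0.
move=> n n0; have nR : 0 < n%:R :> R by rewrite ltr0n.
have d0 : 0 < d.+1%:R :> R by rewrite ltr0n.
have nm : 0 < n%:R ^+ m :> R by rewrite exprn_gt0.
have ni : 0 < n%:R^-1 :> R by rewrite invr_gt0.
rewrite !natrM !natrX !lnM ?posrE ?mulr_gt0 ?exprn_gt0 // !lnXn // -/La.
pose w : R := n%:R^-1 * n%:R ^+ m.
have w1 : n%:R <= w.
  rewrite /w; case: (m) m2 => [|[|q]] // _; rewrite exprS mulKf ?gt_eqF //.
  by rewrite ler_eXnr // ler1n.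
have n1 : 1 <= n%:R :> R by rewrite ler1n.
have ub : (n.+1 ^ m - n.-1 ^ m)%:R <= (2 ^+ m + m%:R) * w.
  have u01 : 0 <= (n%:R : R)^-1 <= 1 by rewrite (ltW ni) invf_le1.
  have h1 : (n.+1 ^ m)%:R <= (1 + (2 ^+ m - 1) * n%:R^-1) * n%:R ^+ m :> R.
    rewrite natrX (_ : n.+1%:R = (1 + n%:R^-1) * n%:R); last first.
      by rewrite mulrDl mul1r mulVf ?gt_eqF // natr1.
    by rewrite exprMn; apply: ler_wpM2r; [exact: ltW|exact: expr1D_le].
  have h2 : (1 - m%:R * n%:R^-1) * n%:R ^+ m <= (n.-1 ^ m)%:R :> R.
    rewrite natrX (_ : n.-1%:R = (1 - n%:R^-1) * n%:R); last first.
      by rewrite mulrBl mul1r mulVf ?gt_eqF // -{2}(prednK n0) -natr1 addrK.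
    by rewrite exprMn; apply: ler_wpM2r; [exact: ltW|exact: expr1B_ge].
  have w0 : 0 <= w by apply: le_trans w1.
  rewrite natrB; last by rewrite leq_exp2r ?(ltnW m2) // (leq_trans (leq_pred n)).
  by rewrite /w in w0 *; lra.
have e1 : m%:R * ln 2 <= m%:R * ln 2 * w.
  by rewrite ler_peMr ?mulr_ge0 //; exact: le_trans w1.
have e2 : La * (m * n + 1)%:R <= m.+1%:R * La * w.
  rewrite (mulrC m.+1%:R) -mulrA; apply: ler_wpM2l => //.
  have : m.+1%:R * n%:R <= m.+1%:R * w by apply: ler_wpM2l.
  rewrite natrD natrM -natr1; lra.
have e3 := ler_wpM2r La0 ub.
rewrite -mulrA -/w -(mulr_natr (ln 2) m) -(mulr_natr La (m * n + 1)).
rewrite -(mulr_natr La (n.+1 ^ m - n.-1 ^ m)).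
by move: e1 e2 e3; rewrite !mulrDl; lra.
Qed.

End Assembly.

(** * Entropy of translation invariant maps *)

Section PeriodicEntropy.
Variables (R : realType) (m d : nat) (s : 'rV[R]_m) (gr : int -> tree d).
Local Notation V := 'rV[int]_m.
Hypotheses (m2 : (2 <= m)%N) (s1 : l1norm s < 1) (ggr : geo gr).
Variable lam : R.
Hypothesis lam0 : 0 <= lam.
Hypothesis zlim : forall e : R, 0 < e -> exists K, forall n, (K <= n)%N ->
  `|ln (refZ s gr n)%:R - lam * n%:R ^+ m| <= e * n%:R ^+ m.

Let k0 : 'I_m := Ordinal (ltnW m2).

Lemma l1_shift n (k : 'I_m) (x : V) : l1 x (x + basis_vec k *+ n) = n.
Proof.
rewrite /l1 (bigD1 k) //= big1 => [|j /negPf jk]; rewrite entryD entryMn mxE ?eqxx ?jk /=; lia.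
Qed.

(** A homomorphism preserves parities, and [x] and [x + n e_k] are [n] steps apart. *)
Lemma Hset_parity n (g : int -> tree d) h k (N : nat) : (0 < n)%N -> Hset n g s h ->
  Num.floor (s 0 k * n%:R) = N%:Z -> odd N = odd n.
Proof.
move=> n0 Hh; rewrite (Hset_infimum n0 k Hh) => -[<-].
have [hh _ _ _ _] := Hh; have [_ ph] := hom_lip ((graph_homE _).1 hh).
have [|[x _ <-] _] := @infimum_natP (range (fun x => td (h x) (h (x + basis_vec k *+ n)))).
  by exists (td (h 0) (h (0 + basis_vec k *+ n))); exists 0.
rewrite td_par (ph x I) (ph (x + basis_vec k *+ n) I) -[in RHS](l1_shift n k x) l1_par.
by case: par; case: vpar; case: vpar.
Qed.

(** A single member of [Hset] provides all that periodizing a filling requires: nonnegative integer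
    parts [N k], their parity, and the fact that [g] has the periods [N k]. *)
Lemma periodic_entropy e : 0 < e -> exists2 r : R, 0 < r &
  forall (n : nat) (g : int -> tree d),
    (0 < n)%N -> n%:R^-1 < r -> geo g -> g 0 = tree_root d -> Hset n g s !=set0 ->
    finite_set (Hset n g s) /\
    `|ln (ncard (Hset n g s))%:R - lam * n%:R ^+ m| <= e * n%:R ^+ m.
Proof.
move=> e0; have [c c0 hc] := exists_margin s1.
have [rs rs0 hrs] := slope_radius s.
have C0 : 0 <= c.*2%:R :> R by [].
have [ra ra0 Ha] := compare_lower lam0 zlim C0 e0.
have [D D0 hD] := beta_bound R d m2.
have [K HK] := paste_upper lam0 zlim c.*2 e0 D0.
pose rk : R := K.+1%:R^-1; have rk0 : 0 < rk by rewrite invr_gt0 ltr0n.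
exists (Num.min ra (Num.min rs rk)); first by rewrite !lt_min ra0 rs0 rk0.
move=> n g n0; rewrite !lt_min => /and3P[na ns nk] gg g0 [h0 Hh0].
have nR : 0 < n%:R :> R by rewrite ltr0n.
have [N floorN] := choice (fun k => ex_intro (fun N : nat => Num.floor (s 0 k * n%:R) = N%:Z) _
  (Hset_infimum n0 k Hh0)).
have parN k : odd (N k) = odd n by exact: Hset_parity n0 Hh0 (floorN k).
(* [N k = 1] would give [1 <= s_k n < 2], which [slope_radius] excludes. *)
have N1 k : N k != 1%N.
  apply/eqP => Nk; have := floor_itv (s 0 k * n%:R); rewrite floorN Nk => /andP[h1 h2].
  have sk : 0 < s 0 k by rewrite -(pmulr_lgt0 _ nR); apply: lt_le_trans h1.
  have : n%:R^-1 < s 0 k / 2 by apply: lt_le_trans ns _; exact: hrs.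
  rewrite -[n%:R^-1]mul1r ltr_pdivrMr //; move: h2; rewrite -[(1%Z + 1)%:~R]/(2%:R : R); lra.
have perN k : geo_period g (N k)%:Z.
  by have [_ [pk _]] := Hset_translation n0 gg g0 floorN N1 k Hh0.
have hc8 : (4 * m + 8)%:R <= (1 - l1norm s) * c%:R.
  by apply: le_trans hc; rewrite ler_nat leq_add2l.
have [fin [B [cB BZ]]] := Hset_upper m2 n0 gg g0 floorN s1 perN ggr hc8 N1.
have Hpos : 0 < (ncard (Hset n g s))%:R :> R by apply: ncard_gt0_neq => //; exists h0.
split=> //; rewrite ler_norml; apply/andP; split.
  have n01 : 0 <= (0 : R) < ra by apply/andP; split.
  have := Ha n 0 (ln (ncard (Hset n g s))%:R) n0 na n01.
  have H : forall k : nat, k%:R + c.*2%:R * (0 * n%:R + 1) <= n%:R :> R ->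
      ln (refZ s gr k)%:R <= ln (ncard (Hset n g s))%:R :> R.
    move=> k; rewrite mul0r add0r mulr1 -natrD ler_nat => kn.
    have zk : 0 < (refZ s gr k)%:R :> R by rewrite ltr0n (refZ_gt0 k0 s1 ggr).
    rewrite ler_ln ?posrE // ler_nat.
    apply: leq_trans (ncard_Hset_ge k0 n0 gg g0 perN parN floorN s1 (ltnW m2) fin).
    have hcm : 2 * ((2 + m%:R) + 3) <= (1 - l1norm s) * c%:R.
      have -> : 2 * ((2 + m%:R) + 3) = (2 * m + 10)%:R :> R by rewrite natrD natrM; ring.
      by apply: le_trans hc; rewrite ler_nat leq_add2r leq_mul2r orbT.
    apply: (box_lower k0 gg ggr c0 hcm s1 kn (nearlin_f g n0 floorN s1) _).2.
    exact: lipS (hom_lip (f_hom n0 gg floorN s1)) (@subsetT _ _).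
  by move=> /(_ H); lra.
have Kn : (K <= n)%N.
  apply/ltnW/ltnW; rewrite -(ltr_nat R).
  by rewrite -ltf_pV2 ?posrE ?ltr0n.
set W := (2 ^ m * (d.+1 ^ (m * n + 1) * d.+1 ^ (n.+1 ^ m - n.-1 ^ m)))%N.
have W0 : (0 < W)%N by rewrite !muln_gt0 !expn_gt0.
have {}cB : (ncard (Hset n g s) <= W * B)%N by rewrite /W -mulnA.
have B0 : (0 < B)%N.
  rewrite lt0n; apply/eqP => B0; move: cB Hpos; rewrite B0 muln0 leqn0 => /eqP ->.
  by rewrite ltxx.
have := HK n Kn (ln (ncard (Hset n g s))%:R) (ln W%:R) (hD n n0).
have H : n%:R ^+ m * (ln (ncard (Hset n g s))%:R - ln W%:R)
    <= ln (refZ s gr (n * n + c.*2 * n))%:R :> R.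
  apply: (@le_trans _ _ (n%:R ^+ m * ln B%:R)).
    apply: ler_wpM2l; first by rewrite exprn_ge0.
    rewrite lerBlDl -lnM ?posrE ?ltr0n // ler_ln ?posrE //; last by rewrite mulr_gt0 ?ltr0n.
    by rewrite -natrM ler_nat.
  rewrite -natrX mulr_natl -lnXn ?ltr0n // ler_ln ?posrE ?exprn_gt0 ?ltr0n //.
    by rewrite -natrX ler_nat.
  exact: (refZ_gt0 k0 s1 ggr).
by move=> /(_ H); lra.
Qed.

End PeriodicEntropy.

Section EntropyComparison.
Variables (R : realType) (m d : nat) (s : 'rV[R]_m).
Hypotheses (m2 : (2 <= m)%N) (s1 : l1norm s < 1).

Definition admissible (n : nat) (delta : R) (g g' : int -> tree d)
    (hb : vertex_boundary (cube m n) -> tree d) : Prop :=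
  [/\ (0 < n)%N, 0 < delta, two_sided_geodesic g,
    (periodic_geodesic g' /\ g' 0 = tree_root d) /\ Hset n g' s !=set0 &
    graph_hom (@sub_nbr m (vertex_boundary (cube m n))) hb /\
    forall x : vertex_boundary (cube m n),
      (tree_dist (hb x) (g (Num.floor (dot s (val x)))))%:R <= delta * n%:R].

(** The reference geodesic is chosen before [n], [g] and [g'], so both entropies approach the same
    [- lam]. If the tree has no two-sided geodesic, nothing is admissible. *)
Lemma entropy_comparison (e : R) : 0 < e -> exists2 r : R, 0 < r &
  forall (n : nat) (delta : R) (g g' : int -> tree d)
      (hb : vertex_boundary (cube m n) -> tree d),
    admissible delta g g' hb -> n%:R^-1 < r -> delta < r ->
    exists a b : R, [/\ Ent R hb = a%:E, ent n g' s = b%:E & `|a - b| <= e].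
Proof.
move=> e0; have [[gr ggr]|nogeo] := pselect (exists g : int -> tree d, geo g); last first.
  by exists 1 => // n delta g g' hb [_ _ /geoE gg]; case: nogeo; exists g.
have [lam lam0 zlim] := ref_limit m2 s1 ggr.
have e2 : 0 < e / 2 by rewrite divr_gt0.
have [r1 r10 H1] := boundary_entropy m2 s1 ggr lam0 zlim e2.
have [r2 r20 H2] := periodic_entropy m2 s1 ggr lam0 zlim e2.
exists (Num.min r1 r2); first by rewrite lt_min r10 r20.
move=> n delta g g' hb [n0 d0 /geoE gg [[[/geoE gg' _] g0'] neH] [hh near_hb]].
rewrite !lt_min => /andP[n1 n2] /andP[d1 _].
have d01 : 0 < delta < r1 by rewrite d0 d1.
have [fE [h Eh] cE] := H1 n delta g hb n0 n1 d01 gg hh near_hb.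
have [fH cH] := H2 n g' n0 n2 gg' g0' neH.
case: neH => h' Hh'.
rewrite (EntE R fE Eh) (entE fH Hh').
set a := ln _ in cE *; set b := ln _ in cH *.
exists (- ((n ^ m)%:R^-1 * a)), (- ((n ^ m)%:R^-1 * b)); split=> //.
have nm : 0 < n%:R ^+ m :> R by rewrite exprn_gt0 // ltr0n.
rewrite natrX -opprD normrN -mulrBr normrM ger0_norm ?invr_ge0 ?(ltW nm) //.
rewrite ler_pdivrMl // mulrC; move: cE cH; rewrite !ler_norml; lra.
Qed.

End EntropyComparison.

Theorem theorem3p12 (R : realType) (m d : nat) (s : 'rV[R]_m) :
  (2 <= m)%N -> l1norm s < 1 ->
  exists r : R, exists theta1 theta2 : R -> R,
    [/\ 0 < r, theta_fun r theta1, theta_fun r theta2 &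
    forall (n : nat) (delta : R) (g g' : int -> tree d)
           (hb : vertex_boundary (cube m n) -> tree d),
      (0 < n)%N -> n%:R^-1 < r ->
      0 < delta < r ->
      two_sided_geodesic g -> g 0 = tree_root d ->
      periodic_geodesic g' -> g' 0 = tree_root d ->
      Hset n g' s !=set0 ->
      graph_hom (@sub_nbr m (vertex_boundary (cube m n))) hb ->
      (forall x : vertex_boundary (cube m n),
        (tree_dist (hb x) (g (Num.floor (dot s (val x)))))%:R
          <= delta * n%:R) ->
      exists e1 e2 : R,
        [/\ `|e1| <= theta1 n%:R^-1, `|e2| <= theta2 delta &
            Ent R hb = (ent n g' s + e1%:E + e2%:E)%E]].
Proof.
move=> m2 s1.
(* Errors are filed under the single parameter [max (1/n, delta)], so that one function of one
   variable majorizes them all. *)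
pose E (t v : R) := exists n delta (g g' : int -> tree d)
  (hb : vertex_boundary (cube m n) -> tree d) (a b : R),
  [/\ admissible s delta g g' hb, t = Num.max n%:R^-1 delta, Ent R hb = a%:E,
      ent n g' s = b%:E & v = `|a - b|].
have [r [f [r0 [sm lim0] f0 fE]]] : exists (r : R) (f : R -> R),
    [/\ 0 < r, theta_fun r f, forall x, 0 < x < r -> 0 <= f x &
    forall t v, 0 < t < r -> E t v -> v <= f t].
  apply: smooth_majorant => e /(entropy_comparison d m2 s1)[r r0 H].
  exists r => // t v /andP[_ tr] [n [delta [g [g' [hb [a [b [adm tE aE bE ->]]]]]]]].
  move: tr; rewrite tE gt_max => /andP[nr dr].
  have [a' [b' [aE' bE' le]]] := H n delta g g' hb adm nr dr.
  by move: aE' bE'; rewrite aE bE => -[->] [->].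
(* The tolerance 1 is irrelevant: this radius is used for the finiteness of both entropies. *)
have [r1 r10 H1] := entropy_comparison d m2 s1 (@ltr01 R).
pose q := Num.min r r1.
have qr x : x < q -> x < r by rewrite lt_min => /andP[].
have qf : theta_fun q f.
  by split=> // j x /andP[x0 xq]; apply: sm; rewrite x0 qr.
exists q, f, f; split=> //; first by rewrite lt_min r0 r10.
move=> n delta g g' hb n0 nq /andP[d0 dq] gg g0 gg' g0' neH hh near_hb.
have adm : admissible s delta g g' hb by [].
have nR : 0 < n%:R^-1 :> R by rewrite invr_gt0 ltr0n.
have nr1 : n%:R^-1 < r1 by move: nq; rewrite lt_min => /andP[].
have dr1 : delta < r1 by move: dq; rewrite lt_min => /andP[].
have [a [b [aE bE _]]] := H1 n delta g g' hb adm nr1 dr1.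
have le : `|a - b| <= f (Num.max n%:R^-1 delta).
  apply: fE; first by rewrite lt_max d0 orbT gt_max !qr.
  by exists n, delta, g, g', hb, a, b.
have fn : 0 <= f n%:R^-1 by apply: f0; rewrite nR qr.
have fd : 0 <= f delta by apply: f0; rewrite d0 qr.
(* The whole error is charged to the larger of the two parameters and 0 to the other, where [f] is
   nonnegative. *)
rewrite aE bE; case: (leP n%:R^-1 delta) le => _ le.
  by exists 0, (a - b); split; rewrite ?normr0 //= -!EFinD addr0 addrC subrK.
by exists (a - b), 0; split; rewrite ?normr0 //= -!EFinD addr0 addrC subrK.
Qed.
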